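(* For every $n\ge 3$, the (discrete) group $\mathrm{SL}_n(\mathbf{Q})$ has Properties FM' and FW', but has neither Property FM nor Property FW.
   Context: Let $\Gamma$ be a discrete group. If $\Gamma$ acts on a set $X$, a subset $M\subset X$ is commensurated if the symmetric difference $M\bigtriangleup gM$ is finite for every $g\in\Gamma$; it is transfixed if there is a $\Gamma$-invariant subset $N\subset X$ with $M\bigtriangleup N$ finite. A mean on $X$ is a finitely additive probability measure defined on all subsets of $X$. - $\Gamma$ has Property FW (resp. FW') if for every $\Gamma$-set (resp. every transitive $\Gamma$-set) $X$, every commensurated subset of $X$ is transfixed. - $\Gamma$ has Property FM if every $\Gamma$-set with a $\Gamma$-invariant mean on all its subsets has a finite $\Gamma$-orbit; $\Gamma$ has Property FM' if every transitive $\Gamma$-set with a $\Gamma$-invariant mean on all its subsets is finite. *)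

(* Defs.v *)
From HB Require Import structures.
From mathcomp Require Import all_boot all_order all_algebra.
From mathcomp Require Import boolp classical_sets functions cardinality reals.

Set Implicit Arguments.
Unset Strict Implicit.
Unset Printing Implicit Defensive.

Import GRing.Theory.

Local Open Scope classical_set_scope.
Local Open Scope ring_scope.

Section SpecialLinear.
Variables (R : comUnitRingType) (n : nat).

(* The library's GL_n requires a finite ring and dimensions n.+1; this group is
   over an arbitrary ring and in every dimension, with mulmx as product. *)
Record SL : Type := MkSL { SLval :> 'M[R]_n; _ : \det SLval == 1 }.

HB.instance Definition _ := [isSub for SLval].
HB.instance Definition _ := [Choice of SL by <:].

Implicit Types A B C : SL.

Lemma det_SL A : \det A = 1.
Proof. by case: A => A /= /eqP. Qed.

Lemma SL_unitmx A : (A : 'M[R]_n) \in unitmx.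
Proof. by rewrite unitmxE det_SL unitr1. Qed.

Fact SL_one_subproof : \det (1%:M : 'M[R]_n) == 1.
Proof. by rewrite det1. Qed.

Fact SL_mul_subproof A B : \det (SLval A *m SLval B) == 1.
Proof. by rewrite det_mulmx !det_SL mulr1. Qed.

Fact SL_inv_subproof A : \det (invmx (SLval A)) == 1.
Proof. by rewrite det_inv det_SL invr1. Qed.

Definition SL_one : SL := MkSL SL_one_subproof.
Definition SL_mul A B : SL := MkSL (SL_mul_subproof A B).
Definition SL_inv A : SL := MkSL (SL_inv_subproof A).

Fact SL_mulA : associative SL_mul.
Proof. by move=> A B C; apply/val_inj; rewrite /= mulmxA. Qed.

Fact SL_mul1 : left_id SL_one SL_mul.
Proof. by move=> A; apply/val_inj; rewrite /= mul1mx. Qed.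

Fact SL_mulr1 : right_id SL_one SL_mul.
Proof. by move=> A; apply/val_inj; rewrite /= mulmx1. Qed.

Fact SL_mulV : left_inverse SL_one SL_inv SL_mul.
Proof. by move=> A; apply/val_inj; rewrite /= mulVmx ?SL_unitmx. Qed.

Fact SL_mulrV : right_inverse SL_one SL_inv SL_mul.
Proof. by move=> A; apply/val_inj; rewrite /= mulmxV ?SL_unitmx. Qed.

HB.instance Definition _ :=
  isGroup.Build SL SL_mulA SL_mul1 SL_mulr1 SL_mulV SL_mulrV.

Lemma SLval1 : SLval 1%g = 1%:M.
Proof. by []. Qed.

Lemma SLvalM A B : SLval (A * B)%g = SLval A *m SLval B.
Proof. by []. Qed.

End SpecialLinear.

Notation "''SL[' R ]_ n" := (SL R n)
  (at level 8, n at level 2, format "''SL[' R ]_ n") : type_scope.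

(* Left actions of a possibly infinite group; the library's actions are
   restricted to finite groups. *)
Record action_on (G : groupType) (X : Type) := ActionOn {
  act :> G -> X -> X;
  act1 : forall x, act 1%g x = x;
  actM : forall g h x, act (g * h)%g x = act g (act h x)
}.

Section Actions.
Variables (G : groupType) (X : Type) (a : action_on G X).

Definition orbit_of (x : X) : set X := range (fun g : G => a g x).

Definition transitive_action : Prop := exists x, orbit_of x = [set: X].

Definition invariant_set (N : set X) : Prop := forall g : G, a g @` N = N.

Definition commensurated (M : set X) : Prop :=
  forall g : G, finite_set (M `+` (a g @` M)).

Definition transfixed (M : set X) : Prop :=
  exists N : set X, invariant_set N /\ finite_set (M `+` N).

Definition invariant_mean (R : realType) (mu : set X -> R) : Prop :=
  forall (g : G) (A : set X), mu (a g @` A) = mu A.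

End Actions.

Definition is_mean (R : realType) (X : Type) (mu : set X -> R) : Prop :=
  [/\ forall A, 0 <= mu A,
      mu [set: X] = 1
    & forall A B, A `&` B = set0 -> mu (A `|` B) = mu A + mu B].

Definition has_invariant_mean (R : realType) (G : groupType) (X : Type)
    (a : action_on G X) : Prop :=
  exists mu : set X -> R, is_mean mu /\ invariant_mean a mu.

Definition property_FW (G : groupType) : Prop :=
  forall (X : Type) (a : action_on G X) (M : set X),
    commensurated a M -> transfixed a M.

Definition property_FW' (G : groupType) : Prop :=
  forall (X : Type) (a : action_on G X), transitive_action a ->
  forall M : set X, commensurated a M -> transfixed a M.

Definition property_FM (R : realType) (G : groupType) : Prop :=
  forall (X : Type) (a : action_on G X),
    has_invariant_mean R a -> exists x, finite_set (orbit_of a x).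

Definition property_FM' (R : realType) (G : groupType) : Prop :=
  forall (X : Type) (a : action_on G X), transitive_action a ->
    has_invariant_mean R a -> finite_set [set: X].

(* Main.v *)
From HB Require Import structures.
Require Import Defs.
From mathcomp Require Import all_boot all_order all_algebra.
From mathcomp Require Import boolp classical_sets functions cardinality reals.
From mathcomp Require Import filter trigo.
From mathcomp Require Import ring lra zify.

Set Implicit Arguments.
Unset Strict Implicit.
Unset Printing Implicit Defensive.

Import Order.TTheory GRing.Theory Num.Theory.

Local Open Scope classical_set_scope.
Local Open Scope ring_scope.

(** Write [G] for SL_n(Q), and [U_ij] for its root subgroups, the groups of
    elementary matrices [elem i j r].

    The failure of FM and FW only uses that [G] is an ascending union of
    subgroups [H k] of infinite index, here the matrices over the subrings of Q
    in which only the primes up to [k] are inverted.  On the disjoint union of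
    the coset spaces [G / H k] every group element fixes all but finitely many
    base points; so the set of base points is commensurated ([union_not_FW]) and
    point masses at the base points converge to an invariant mean
    ([union_not_FM]), although all orbits are infinite.

    For FM' and FW' let [G] act transitively on [X].  The condition that the
    stabilizer of [x] meets every root subgroup in something large, meaning
    nonzero, or everything after localization at a prime [p] ([root_loc]), does
    not depend on [x]: it is stable under elementary matrices because the
    stabilizers are closed under commutators ([root_loc_act]), and these generate
    [G] ([SL_ind]).  If the condition holds locally at every prime then root
    subgroups act trivially, and [X] is a point ([transitive_locally_full]).

    For FW', a commensurated set [M] has finitely many jumps along the orbits of
    an element [s], so every infinite orbit has two ends, lying inside or
    outside [M]. The ends do not change under the centralizer of [s], and a
    divisible group centralizing [s] fixes pointwise the finitely many orbits
    whose ends differ ([fix_two_ended]). If at each point some [U_ij] acts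
    freely then elementary matrices have no such orbits, being commutators of
    elements of two divisible subgroups centralizing them, and commuting
    elements see the same ends; this gives one invariant set that differs from
    [M] by finitely many points ([transfixed_root_free]). If stabilizers meet
    all root subgroups, but are not full locally at [p], the same argument
    applies to diagonal matrices whose entries are powers of [p]
    ([transfixed_torus]).

    For FM', an invariant mean [mu] is studied through the stabilizers of points
    in the planes [U_ik * U_jk], on which SL_2(Q) acts. Points for which this
    stabilizer has rank one are null, by the dynamics on the projective line
    ([rank_one_row], [rank_one_col]). At a prime, a stabilizer of rank two
    defines a norm on the plane; a diagonal matrix shows that two axis vectors
    almost surely have different norms unless both are zero, while the
    ultrametric inequality makes two of the norms of [e1], [e2], [e1 + e2] equal
    ([loc_full]). The remaining case, a free action of Z^2 ([free_plane_null]),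
    is the relative property (T) of Z^2 in its semidirect product with SL_2(Z):
    an invariant mean gives almost invariant finitely supported densities
    ([almost_invariant_density], a separation argument), and the spectral
    measures of their square roots on the dual of Z^2, sampled at the points of
    order [N], would be an almost invariant mass off the trivial character,
    which ping-pong on the quadrants excludes ([spectral_contradiction]). *)

(** * Elementary and diagonal matrices *)

Section Elementary.
Variables (F : fieldType) (n : nat).
Implicit Types (i j k l : 'I_n) (r s : F).

Lemma SLval_inj (g h : 'SL[F]_n) : SLval g = SLval h -> g = h.
Proof. exact: val_inj. Qed.

Definition elem i j r : 'SL[F]_n :=
  insubd (1%g : 'SL[F]_n) (1%:M + r *: delta_mx i j).

Lemma val_elem i j r : i != j -> SLval (elem i j r) = 1%:M + r *: delta_mx i j.
Proof.
move=> ij; suff d1 : \det (1%:M + r *: delta_mx i j : 'M[F]_n) == 1.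
  by rewrite /elem -[SLval _]/(val _) val_insubd d1.
have diag : \prod_k (1%:M + r *: delta_mx i j : 'M[F]_n) k k = 1.
  rewrite big1 // => k _; rewrite !mxE eqxx.
  case: (eqVneq k i) => [->|_]; last by rewrite mulr0 addr0.
  by rewrite (negbTE ij) mulr0 addr0.
have [ltij|] := ltnP i j.
  rewrite -det_tr det_trig; last first.
    apply/is_trig_mxP => k l kl; rewrite !mxE.
    have -> : (l == k) = false by apply/negbTE; rewrite neq_ltn kl orbT.
    rewrite add0r; case: (eqVneq l i) => [li|_]; last by rewrite mulr0.
    case: (eqVneq k j) => [kj|_]; last by rewrite mulr0.
    by move: kl; rewrite li kj ltnNge ltnW.
  by apply/eqP; rewrite -[RHS]diag; apply: eq_bigr => k _; rewrite mxE.
rewrite leq_eqVlt eq_sym (inj_eq val_inj) (negbTE ij) /= => ltji.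
rewrite det_trig ?diag //; apply/is_trig_mxP => k l kl; rewrite !mxE.
have -> : (k == l) = false by apply/negbTE; rewrite neq_ltn kl.
rewrite add0r; case: (eqVneq k i) => [ki|_]; last by rewrite mulr0.
case: (eqVneq l j) => [lj|_]; last by rewrite mulr0.
by move: kl; rewrite ki lj ltnNge ltnW.
Qed.

Lemma elem0 i j : i != j -> elem i j 0 = 1%g.
Proof. by move=> ij; apply: SLval_inj; rewrite val_elem // scale0r addr0. Qed.

Lemma delta_mulC i j k l r s :
  (r *: delta_mx i j) *m (s *: delta_mx k l) =
  (r * s * (j == k)%:R) *: (delta_mx i l : 'M[F]_n).
Proof.
rewrite -scalemxAl -scalemxAr scalerA; case: (eqVneq j k) => [->|jk].
  by rewrite mul_delta_mx mulr1.
by rewrite mul_delta_mx_0 // scaler0 mulr0 scale0r.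
Qed.

Lemma val_elemM i j k l r s : i != j -> k != l ->
  SLval (elem i j r * elem k l s)%g =
  1%:M + r *: delta_mx i j + s *: delta_mx k l +
  (r * s * (j == k)%:R) *: delta_mx i l.
Proof.
move=> ij kl; rewrite SLvalM !val_elem // mulmxDl !mulmxDr !mul1mx mulmx1.
by rewrite delta_mulC addrA -!addrA; congr (_ + _); rewrite addrCA.
Qed.

Lemma elemD i j r s : i != j -> elem i j (r + s) = (elem i j r * elem i j s)%g.
Proof.
move=> ij; apply: SLval_inj; rewrite val_elemM // val_elem //.
by rewrite (eq_sym j) (negbTE ij) mulr0 scale0r addr0 scalerDl addrA.
Qed.

Lemma elemV i j r : i != j -> elem i j (- r) = (elem i j r)^-1%g.
Proof.
by move=> ij; apply/esym/mulg1_eq; rewrite -elemD // subrr elem0.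
Qed.

Lemma elemX i j r m : i != j -> (elem i j r ^+ m)%g = elem i j (m%:R * r).
Proof.
move=> ij; elim: m => [|m IH]; first by rewrite mul0r elem0.
by rewrite expgS IH -elemD // -[m.+1]addn1 natrD mulrDl mul1r addrC.
Qed.

Lemma elem_commute i j k l r s : i != j -> k != l -> j != k -> i != l ->
  commute (elem i j r) (elem k l s).
Proof.
move=> ij kl jk il; apply: SLval_inj.
rewrite !val_elemM //.
rewrite (negbTE jk) (eq_sym l) (negbTE il) !mulr0 !scale0r !addr0.
by rewrite -!addrA; congr (_ + _); rewrite addrC.
Qed.

Lemma elem_comm i j l r s : i != j -> j != l -> i != l ->
  (elem i j r * elem j l s = elem j l s * elem i j r * elem i l (r * s))%g.
Proof.
move=> ij jl il; apply: SLval_inj.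
rewrite [RHS]SLvalM !val_elemM //.
rewrite (eq_sym l) (negbTE il) mulr0 scale0r addr0 eqxx mulr1 val_elem //.
rewrite mulmxDr mulmx1 !mulmxDl !mul1mx !delta_mulC (eq_sym l) (negbTE il).
rewrite (eq_sym j) (negbTE ij) !mulr0 !scale0r !addr0.
by congr (_ + _); rewrite addrAC.
Qed.

(** Two root subgroups that are not opposite generate a group of class at most
    two: their commutators form a root subgroup commuting with both (or are
    trivial, when [e = 0]).  The index pair is kept abstract because the
    arguments below only use this, never the shape of the roots. *)
Lemma elem_swap i j k l : i != j -> k != l -> (i, j) != (l, k) ->
  exists p q (e : F), [/\ p != q,
    forall r s, (elem i j r * elem k l s =
                 elem k l s * elem i j r * elem p q (e * r * s))%g,
    forall r s, commute (elem p q r) (elem i j s) &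
    forall r s, commute (elem p q r) (elem k l s)].
Proof.
move=> ij kl; rewrite xpair_eqE negb_and => opp.
case: (eqVneq j k) => [jk|jk].
  subst k; have il : i != l by move: opp; rewrite eqxx orbF.
  exists i, l, 1; split=> // r s; first by rewrite mul1r elem_comm.
    by apply: elem_commute => //; rewrite eq_sym.
  by apply: elem_commute => //; rewrite eq_sym.
case: (eqVneq i l) => [il|il].
  subst l; have kj : k != j by rewrite eq_sym.
  exists k, j, (-1); split=> // r s.
  - rewrite (elem_comm _ _ kl ij kj) mulN1r mulNr elemV // [r * s]mulrC.
    by rewrite mulgK.
  - by apply: elem_commute => //; rewrite eq_sym.
  - by apply: elem_commute => //; rewrite eq_sym.
exists i, j, 0; split=> // r s; last exact: elem_commute.
  by rewrite !mul0r elem0 // mulg1; exact: elem_commute.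
by apply: elem_commute => //; rewrite eq_sym.
Qed.

Definition diagSL (f : 'I_n -> F) : 'SL[F]_n :=
  insubd (1%g : 'SL[F]_n) (diag_mx (\row_i f i)).

Lemma val_diagSL f : \prod_i f i = 1 ->
  SLval (diagSL f) = diag_mx (\row_i f i).
Proof.
move=> f1; rewrite /diagSL -[SLval _]/(val _) val_insubd det_diag.
by under eq_bigr do rewrite mxE; rewrite f1 eqxx.
Qed.

Lemma diagSL_elem f i j r : \prod_i f i = 1 -> i != j ->
  (diagSL f * elem i j r = elem i j (f i * r / f j) * diagSL f)%g.
Proof.
move=> f1 ij; have fj : f j != 0.
  apply: contra_eqN f1 => /eqP fj.
  by rewrite (bigD1 j) //= fj mul0r eq_sym oner_eq0.
apply: SLval_inj; rewrite !SLvalM.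
rewrite !val_elem // val_diagSL // mulmxDl mulmxDr mul1mx mulmx1; congr (_ + _).
apply/matrixP=> k l; rewrite mul_diag_mx mul_mx_diag !mxE.
case: (eqVneq k i) => [->|_]; last by rewrite /= !(mulr0, mul0r).
case: (eqVneq l j) => [->|_]; last by rewrite /= !(mulr0, mul0r).
by rewrite /= !mulr1 divfK.
Qed.

Lemma diagSL_commute f g : \prod_i f i = 1 -> \prod_i g i = 1 ->
  commute (diagSL f) (diagSL g).
Proof.
move=> f1 g1; apply: SLval_inj.
rewrite !SLvalM !val_diagSL //.
by rewrite diag_mxC.
Qed.

(** Gaussian elimination: elementary operations on rows and columns clear one
    index after the other, and the determinant forces the last diagonal entry
    to be [1]. *)
Lemma SL_ind (P : 'SL[F]_n -> Prop) : (1 < n)%N ->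
  (forall i j r, i != j -> P (elem i j r)) ->
  (forall g h, P g -> P h -> P (g * h)%g) -> forall g, P g.
Proof.
move=> n1 PE PM.
have P1 : P 1%g.
  rewrite -(@elem0 (Ordinal (ltnW n1)) (Ordinal n1)) //; exact: PE.
have PL i j r g : i != j -> P (elem i j r * g)%g -> P g.
  move=> ij /(PM (elem i j (- r))); rewrite elemV // mulKg -elemV //.
  by apply; apply: PE.
have PR i j r g : i != j -> P (g * elem i j r)%g -> P g.
  move=> ij Pg; have /(PM _ _ Pg) := PE i j (- r) ij.
  by rewrite elemV // mulgK.
have rowL i j r g k l : i != j -> SLval (elem i j r * g)%g k l =
    SLval g k l + (k == i)%:R * r * SLval g j l.
  move=> ij; rewrite SLvalM val_elem // mulmxDl mul1mx mxE; congr (_ + _).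
  rewrite -scalemxAl mxE mxE (bigD1 j) //= big1 ?addr0.
    by rewrite mxE eqxx andbT mulrA [r * _]mulrC.
  by move=> m mj; rewrite mxE (negbTE mj) andbF mul0r.
have colR i j r g k l : i != j -> SLval (g * elem i j r)%g k l =
    SLval g k l + (l == j)%:R * r * SLval g k i.
  move=> ij; rewrite SLvalM val_elem // mulmxDr mulmx1 mxE; congr (_ + _).
  rewrite -scalemxAr mxE mxE (bigD1 i) //= big1 ?addr0.
    by rewrite mxE eqxx /=; ring.
  by move=> m mj; rewrite mxE (negbTE mj) mulr0.
(* [D] collects the indices whose row and column are already those of the
   identity matrix. *)
pose clean (D : {set 'I_n}) (g : 'SL[F]_n) :=
  forall i k, i \in D -> SLval g i k = (i == k)%:R /\ SLval g k i = (k == i)%:R.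
suff main m (D : {set 'I_n}) g : #|~: D| = m -> clean D g -> P g.
  by move=> g; apply: (main _ (finset.set0) g erefl) => i k; rewrite inE.
elim: m D g => [|m IH] D g cD cl.
  have -> : g = 1%g; last by [].
  apply: SLval_inj; apply/matrixP=> i k /=; rewrite mxE.
  have /setP/(_ i) := cards0_eq cD; rewrite !inE => /negbFE iD.
  by have [] := cl i k iD.
have /card_gt0P[p] : (0 < #|~: D|)%N by rewrite cD.
rewrite inE => pD.
have clpL i j r h : i != j -> i \notin D -> j \notin D -> clean D h ->
    clean D (elem i j r * h)%g.
  move=> ij iD jD clh k l kD; rewrite !rowL //.
  have [-> ->] := clh k l kD; have [_ ->] := clh k j kD.
  have -> : (k == i) = false by apply: contraNF iD => /eqP <-.
  have -> : (j == k) = false by apply: contraNF jD => /eqP ->.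
  by rewrite !(mul0r, mulr0) !addr0.
have clpR i j r h : i != j -> i \notin D -> j \notin D -> clean D h ->
    clean D (h * elem i j r)%g.
  move=> ij iD jD clh k l kD; rewrite !colR //.
  have [-> ->] := clh k l kD; have [-> _] := clh k i kD.
  have -> : (k == i) = false by apply: contraNF iD => /eqP <-.
  have -> : (k == j) = false by apply: contraNF jD => /eqP <-.
  by rewrite !(mul0r, mulr0) !addr0.
have pivot h : clean D h -> SLval h p p = 1 -> P h.
  move=> clh hp.
  have clear_col (s : seq 'I_n) : {subset s <= ~: (p |: D)} ->
      (forall h, clean D h -> SLval h p p = 1 ->
         (forall i, i \in s -> SLval h i p = 0) -> P h) ->
      forall h, clean D h -> SLval h p p = 1 -> P h.
    elim: s => [|i s IHs] sD K h' clh' h'p; first by apply: K.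
    have : i \in ~: (p |: D) by apply: sD; rewrite inE eqxx.
    rewrite !inE negb_or => /andP[ip iD].
    apply: IHs (clh') (h'p) => [k ks|h2 clh2 h2p h20].
      by apply: sD; rewrite inE ks orbT.
    apply: (PL i p (- SLval h2 i p)) => //; apply: K.
    - exact: clpL.
    - by rewrite rowL // h2p eq_sym (negbTE ip) mul0r mul0r addr0.
    - move=> k; rewrite inE rowL // h2p mulr1.
      case: (eqVneq k i) => [-> _|_ /= ks]; first by rewrite mul1r subrr.
      by rewrite mul0r addr0 h20.
  have clear_row (s : seq 'I_n) : {subset s <= ~: (p |: D)} ->
      (forall h, clean D h -> SLval h p p = 1 ->
         (forall i, i \in ~: (p |: D) -> SLval h i p = 0) ->
         (forall i, i \in s -> SLval h p i = 0) -> P h) ->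
      forall h, clean D h -> SLval h p p = 1 ->
         (forall i, i \in ~: (p |: D) -> SLval h i p = 0) -> P h.
    elim: s => [|i s IHs] sD K h' clh' h'p h'0; first by apply: K.
    have iD' : i \in ~: (p |: D) by apply: sD; rewrite inE eqxx.
    have := iD'; rewrite !inE negb_or => /andP[ip iD].
    apply: IHs (clh') (h'p) (h'0) => [k ks|h2 clh2 h2p h2c h20].
      by apply: sD; rewrite inE ks orbT.
    have pi : p != i by rewrite eq_sym.
    apply: (PR p i (- SLval h2 p i)) => //; apply: K.
    - exact: clpR.
    - by rewrite colR // h2p (negbTE pi) mul0r mul0r addr0.
    - move=> k kD; rewrite colR // (h2c k kD) mulr0 addr0.
      by [].
    - move=> k; rewrite inE colR // h2p mulr1.
      case: (eqVneq k i) => [-> _|_ /= ks]; first by rewrite mul1r subrr.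
      by rewrite mul0r addr0 h20.
  apply: (clear_col (enum (~: (p |: D)))) clh hp => [k|h1 clh1 h1p h1c].
    by rewrite mem_enum.
  apply: (clear_row (enum (~: (p |: D)))) clh1 h1p _ => [k||i iD].
  - by rewrite mem_enum.
  - move=> h2 clh2 h2p h2c h2r; apply: (IH (p |: D)).
      have := cardsC (p |: D); have := cardsC D; rewrite cardsU1 pD /= cD; lia.
    move=> i k; rewrite inE => /orP[|iD]; last exact: clh2.
    rewrite inE => /eqP->; case: (eqVneq p k) => [<-|pk]; first by [].
    have [kD|kD] := boolP (k \in D).
      by have [-> ->] := clh2 k p kD; rewrite (eq_sym k) (negbTE pk).
    by rewrite h2r ?mem_enum ?h2c ?inE ?negb_or 1?eq_sym ?pk //.
  - by apply: h1c; rewrite mem_enum.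
case: m => [|m] in cD IH *.
  have DE i : i != p -> i \in D.
    apply: contraR => iD; have /cards1P[q Eq] : #|~: D| == 1%N by rewrite cD.
    have : p \in ~: D by rewrite finset.in_setC.
    have : i \in ~: D by rewrite finset.in_setC.
    by rewrite Eq !inE => /eqP-> /eqP->.
  apply: pivot => //.
  have := det_SL g; have -> : SLval g = diag_mx (\row_i SLval g i i).
    apply/matrixP=> i k; rewrite !mxE; case: (eqVneq i k) => [->//|ik].
    rewrite mulr0n; case: (eqVneq i p) => [ip|/DE iD].
      have /DE kD : k != p by rewrite -ip eq_sym.
      by have [_ ->] := cl k i kD; rewrite (negbTE ik).
    by have [-> _] := cl i k iD; rewrite (negbTE ik).
  rewrite det_diag (bigD1 p) //= big1 => [|i /DE iD]; last first.
    by rewrite mxE; have [-> _] := cl i i iD; rewrite eqxx.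
  by rewrite mulr1 !mxE eqxx.
(* An entry off the diagonal allows making the diagonal entry [1]; the last
   lines produce one when it is missing. *)
have base h q : clean D h -> q != p -> q \notin D -> SLval h q p != 0 -> P h.
  move=> clh qp qD hq; have pq : p != q by rewrite eq_sym.
  apply: (PL p q ((1 - SLval h p p) / SLval h q p)) => //; apply: pivot.
    exact: clpL.
  by rewrite rowL // eqxx mul1r divfK // addrCA subrr addr0.
have [q qp qD] : exists2 q, q != p & q \notin D.
  have : (1 < #|~: D|)%N by rewrite cD.
  move/card_gt1P=> [q1 [q2 [+ + q12]]]; rewrite !inE => q1D q2D.
  case: (eqVneq q1 p) => [q1p|q1p]; last by exists q1.
  by exists q2 => //; rewrite -q1p eq_sym.
have [/existsP[k /and3P[kp kD gk]]|] :=
  boolP [exists k, [&& k != p, k \notin D & SLval g k p != 0]].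
  exact: (base g k).
move=> /existsPn H0.
have gpp : SLval g p p != 0.
  apply/eqP => gpp; have : \det (SLval g) = 0.
    rewrite (expand_det_col _ p) big1 // => i _.
    suff -> : SLval g i p = 0 by rewrite mul0r.
    case: (eqVneq i p) => [->//|ip].
    have [iD|iD] := boolP (i \in D).
      by have [-> _] := cl i p iD; rewrite (negbTE ip).
    by have := H0 i; rewrite ip iD /= negbK => /eqP.
  by rewrite det_SL => /eqP; rewrite oner_eq0.
apply: (PL q p 1) => //; apply: (base _ q) => //; first exact: clpL.
rewrite rowL // eqxx !mul1r.
by have := H0 q; rewrite qp qD /= negbK => /eqP->; rewrite add0r.
Qed.

End Elementary.
Global Opaque elem diagSL.

(** * Points whose stabilizer is large in every root subgroup *)

Section ActionTheory.
Variables (G : groupType) (X : Type) (a : action_on G X).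
Implicit Types (g h : G) (x : X).

Lemma actK g : cancel (a g) (a g^-1%g).
Proof. by move=> x; rewrite -actM mulVg act1. Qed.

Lemma actVK g : cancel (a g^-1%g) (a g).
Proof. by move=> x; rewrite -actM mulgV act1. Qed.

Lemma act_inj g : injective (a g).
Proof. exact: can_inj (actK g). Qed.

Lemma image_actE g (A : set X) x : (a g @` A) x <-> A (a g^-1%g x).
Proof.
split=> [[y Ay <-]|Ax]; first by rewrite actK.
by exists (a g^-1%g x) => //; rewrite actVK.
Qed.

Lemma fixM g h x : a g x = x -> a h x = x -> a (g * h)%g x = x.
Proof. by move=> gx hx; rewrite actM hx gx. Qed.

Lemma fixV g x : a g x = x -> a g^-1%g x = x.
Proof. by move=> gx; rewrite -{1}gx actK. Qed.

Lemma fixX g x m : a g x = x -> a (g ^+ m)%g x = x.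
Proof.
move=> gx; elim: m => [|m IH]; first by rewrite act1.
by rewrite expgS; apply: fixM.
Qed.

End ActionTheory.

Lemma third_index n (i j : 'I_n) : (2 < n)%N -> exists k : 'I_n, k != i /\ k != j.
Proof.
move=> n3; have /card_gt0P[k] : (0 < #|~: [set i; j]%SET|)%N.
  have := cardsC [set i; j]%SET; have := cards2 i j; rewrite card_ord.
  by case: (i != j) => /=; lia.
by rewrite !inE negb_or => /andP[ki kj]; exists k.
Qed.

Section LargeStabilizers.
Variables (F : fieldType) (n : nat) (n3 : (2 < n)%N).
Variables (X : Type) (a : action_on 'SL[F]_n X).
Implicit Types (i j k l : 'I_n) (r s c : F) (x : X) (K : nat -> Prop).

Lemma fix_elemM i j r m x : i != j ->
  a (elem i j r) x = x -> a (elem i j (m%:R * r)) x = x.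
Proof. by move=> ij rx; rewrite -elemX //; apply: fixX. Qed.

Lemma fix_elemD i j r s x : i != j -> a (elem i j r) x = x ->
  a (elem i j s) x = x -> a (elem i j (r + s)) x = x.
Proof. by move=> ij rx sx; rewrite elemD //; apply: fixM. Qed.

Lemma fix_elemN i j r x : i != j -> a (elem i j r) x = x ->
  a (elem i j (- r)) x = x.
Proof. by move=> ij rx; rewrite elemV //; apply: fixV. Qed.

Lemma fix_elemZ i j r (z : int) x : i != j ->
  a (elem i j r) x = x -> a (elem i j (z%:~R * r)) x = x.
Proof.
move=> ij rx; case: z => m; first exact: fix_elemM.
by rewrite NegzE rmorphN mulNr; apply: fix_elemN => //; apply: fix_elemM.
Qed.

Lemma fix_elem_comm i j k r s x : i != j -> j != k -> i != k ->
  a (elem i j r) x = x -> a (elem j k s) x = x ->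
  a (elem i k (r * s)) x = x.
Proof.
move=> ij jk ik rx sx.
have /(congr1 (a^~ x)) := elem_comm r s ij jk ik.
rewrite !actM sx rx => /esym /(congr1 (a (elem j k s)^-1%g)).
rewrite actK fixV // => /(congr1 (a (elem i j r)^-1%g)).
by rewrite actK fixV.
Qed.

Lemma fix_all x : (forall i j r, i != j -> a (elem i j r) x = x) ->
  forall g, a g x = x.
Proof.
move=> Ex; apply: (SL_ind (ltnW n3)) => // g h; exact: fixM.
Qed.

(** Over the rationals and with [K] the positive integers this says that the
    stabilizer of [x] meets every root subgroup nontrivially; with [K] the
    integers prime to [p], that it meets them in subgroups that become everything
    after localization at [p]. *)
Definition root_loc K x := forall i j r, i != j ->
  exists2 m, K m & a (elem i j (m%:R * r)) x = x.

Lemma root_locJ K x i j k l r c : (forall m m', K m -> K m' -> K (m * m')%N) ->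
  i != j -> k != l -> (i, j) != (l, k) -> root_loc K x ->
  exists2 m, K m & a (elem i j (m%:R * r)) (a (elem k l c) x) = a (elem k l c) x.
Proof.
move=> KM ij kl opp lx.
have [p [q [e [pq swap _ _]]]] := elem_swap F ij kl opp.
have [m Km mx] := lx i j r ij; have [m' Km' m'x] := lx p q (e * r * c) pq.
exists (m * m')%N; first exact: KM.
rewrite -actM swap !actM natrM.
have -> : e * (m%:R * m'%:R * r) * c = m%:R * (m'%:R * (e * r * c)) by ring.
rewrite fix_elemM //.
have -> : m%:R * m'%:R * r = m'%:R * (m%:R * r) by ring.
by rewrite fix_elemM.
Qed.

(** Opposite root subgroups are reached through a third index, since an
    elementary matrix is a commutator of two others. *)
Lemma root_loc_act K : (forall m m', K m -> K m' -> K (m * m')%N) ->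
  forall g x, root_loc K x -> root_loc K (a g x).
Proof.
move=> KM; apply: (SL_ind (ltnW n3)) => [k l c kl x lx i j r ij|g h Pg Ph x lx].
  have [|opp] := boolP ((i, j) != (l, k)); first by move=> /root_locJ; apply.
  have [q [qi qj]] := third_index i j n3.
  have {}opp : k = j /\ l = i by move: opp; rewrite negbK => /eqP[-> ->].
  case: opp => ? ?; subst k l.
  have [iq jq] : i != q /\ j != q by rewrite !(eq_sym _ q).
  have opp1 : (i, q) != (i, j) by rewrite xpair_eqE negb_and qj orbT.
  have opp2 : (q, j) != (i, j) by rewrite xpair_eqE negb_and qi.
  have [m Km mx] := root_locJ 1 c KM iq kl opp1 lx.
  have [m' Km' m'x] := root_locJ r c KM qj kl opp2 lx.
  exists (m * m')%N; first exact: KM.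
  have -> : (m * m')%N%:R * r = (m%:R * 1) * (m'%:R * r) by rewrite natrM; ring.
  exact: (fix_elem_comm iq qj ij).
by rewrite actM; apply: Pg; apply: Ph.
Qed.

(** The least positive element divides all others, hence has no prime factor. *)
Lemma nat_ideal_full (P : nat -> Prop) :
  (forall m m', P m -> P m' -> P (m %% m')%N) ->
  (forall p, prime p -> exists2 m, ~~ (p %| m)%N & P m) -> P 1%N.
Proof.
move=> Pmod Pp.
have exP : exists m, (0 < m)%N && `[< P m >].
  have [//|m m2 Pm] := Pp 2%N; exists m; apply/andP; split; last exact/asboolP.
  by case: m m2 {Pm}.
have [m /andP[m0 /asboolP Pm] minm] := ex_minnP exP.
have [m1|m1] : m = 1%N \/ (1 < m)%N by lia.
  by rewrite -m1.
have [m' pm' Pm'] := Pp (pdiv m) (pdiv_prime m1).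
have := Pmod _ _ Pm' Pm => Pr.
have /minm : (0 < m' %% m)%N && `[< P (m' %% m)%N >].
  apply/andP; split; last exact/asboolP.
  rewrite lt0n; apply: contra pm' => /eqP m'm.
  by apply: (dvdn_trans (pdiv_dvd m)); rewrite /dvdn m'm.
by rewrite leqNgt ltn_mod m0.
Qed.

(** The multipliers sending a vector into a subgroup form an ideal, which is not
    contained in any prime ideal. *)
Lemma root_loc_fix x :
  (forall p, prime p -> root_loc (fun m => ~~ (p %| m)%N) x) ->
  forall g, a g x = x.
Proof.
move=> lx; apply: fix_all => i j r ij.
rewrite -[r]mul1r -[1]/(1%N%:R).
apply: (nat_ideal_full (P := fun m => a (elem i j (m%:R * r)) x = x)); last first.
  by move=> p pp; apply: lx.
move=> m m' mx m'x.
have -> : (m %% m')%N%:R * r = m%:R * r + - ((m %/ m')%N%:R * (m'%:R * r)).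
  by rewrite {2}(divn_eq m m') natrD natrM; ring.
by apply: fix_elemD => //; apply: fix_elemN => //; apply: fix_elemM.
Qed.

End LargeStabilizers.

(** * Ends of orbits with respect to a commensurated set *)

Lemma finite_avoid (X : Type) (Z : set X) (y : nat -> X) : injective y ->
  finite_set Z -> exists K, forall k, (K <= k)%N -> ~ Z (y k).
Proof.
move=> yI /(@finite_seqP {classic X})[s ->].
elim: s => [|z s [K IH]]; first by exists 0%N => k _; rewrite /= in_nil.
have [[k0 zk0]|nz] := pselect (exists k, y k = z).
  exists (maxn K k0.+1) => k; rewrite geq_max => /andP[Kk k0k] /=.
  rewrite inE => /orP[/eqP yk|]; last exact: IH.
  have : k = k0 by apply: yI; rewrite zk0.
  by move=> kk; rewrite kk ltnn in k0k.
exists K => k Kk /=; rewrite inE => /orP[/eqP yk|]; last exact: IH.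
by apply: nz; exists k.
Qed.

Section Ends.
Variables (G : groupType) (X : Type) (a : action_on G X).
Variables (M : set X) (cM : commensurated a M).
Implicit Types (g s v : G) (x y : X).

Definition tends (y : nat -> X) := exists K, forall k, (K <= k)%N -> M (y k).

Definition jumps g : set X := [set x | ~ (M x <-> M (a g x))].

Lemma finite_jumps g : finite_set (jumps g).
Proof.
apply: sub_finite_set (cM g^-1%g) => x /= nMx.
have E : (a g^-1%g @` M) x <-> M (a g x).
  by rewrite image_actE invgK.
have [Mx|Mx] := pselect (M x).
  by left; split=> // /E Mg; apply: nMx.
by right; split=> //; apply/E; apply: contrapT => Mg; apply: nMx.
Qed.

Lemma tends_act g (y : nat -> X) : injective y ->
  tends (fun k => a g (y k)) <-> tends y.
Proof.
move=> yI; have [K HK] := finite_avoid yI (finite_jumps g).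
have E k : (K <= k)%N -> (M (y k) <-> M (a g (y k))).
  by move=> /HK/contrapT.
split=> -[L HL]; exists (maxn K L) => k; rewrite geq_max => /andP[/E Kk /HL].
  by move/Kk.
by move/Kk.
Qed.

Definition ray s x k := a (s ^+ k)%g x.
Definition free_at s x := forall k, (0 < k)%N -> a (s ^+ k)%g x <> x.
Definition limit s x := tends (ray s x).

Lemma rayD s x k l : ray s x (k + l) = a (s ^+ k)%g (ray s x l).
Proof. by rewrite /ray expgnDr actM. Qed.

Lemma ray_inj s x : free_at s x -> injective (ray s x).
Proof.
move=> sx; suff H k l : (k < l)%N -> ray s x k <> ray s x l.
  by move=> k l kl; have [/H|/H/nesym|->] := ltngtP k l.
move=> kl; rewrite -(subnKC (ltnW kl)) rayD => /(@act_inj _ _ a _ _ _)/esym.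
by apply: sx; rewrite subn_gt0.
Qed.

Lemma free_atV s x : free_at s x -> free_at s^-1%g x.
Proof.
move=> sx k k0; rewrite expVgn => /(congr1 (a (s ^+ k)%g)).
by rewrite actVK => /esym; apply: sx.
Qed.

Lemma free_at_comm s g x :
  (forall k, a (s ^+ k)%g (a g x) = a g (a (s ^+ k)%g x)) ->
  free_at s x -> free_at s (a g x).
Proof. by move=> sg sx k k0; rewrite sg => /(@act_inj _ _ a _ _ _); apply: sx. Qed.

Lemma limit_comm s g x :
  (forall k, a (s ^+ k)%g (a g x) = a g (a (s ^+ k)%g x)) ->
  free_at s x -> limit s (a g x) <-> limit s x.
Proof.
move=> sg sx; apply: iff_trans _ (tends_act g (ray_inj sx)).
by rewrite /limit (_ : ray s _ = fun k => a g (ray s x k)) //; apply/funext.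
Qed.

Lemma jump_between s z k : ~ (M z <-> M (ray s z k)) ->
  exists k', jumps s (ray s z k').
Proof.
elim: k => [|k IH]; first by move=> nE; case: nE; rewrite /ray act1.
have [Mk|/IH//] := pselect (M z <-> M (ray s z k)).
move=> zk; exists k => Jk; apply: zk; apply: (iff_trans Mk).
by rewrite -(add1n k) (rayD _ _ 1) expg1.
Qed.

(** Beyond its last jump a ray stays inside [M] or outside. *)
Lemma ray_alternative s x : free_at s x ->
  limit s x \/ exists K, forall k, (K <= k)%N -> ~ M (ray s x k).
Proof.
move=> sx; have [K HK] := finite_avoid (ray_inj sx) (finite_jumps s).
have E k : M (ray s x (k + K)) <-> M (ray s x K).
  elim: k => // k IH; apply: iff_trans _ IH; apply: iff_sym.
  have /contrapT := HK _ (leq_addl k K).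
  by rewrite addSn -(add1n (k + K)) (rayD _ _ 1) expg1.
have [MK|MK] := pselect (M (ray s x K)).
  by left; exists K => k Kk; rewrite -(subnK Kk); apply/E.
by right; exists K => k Kk; rewrite -(subnK Kk) => /E.
Qed.

Definition two_sided s :=
  forall x, free_at s x -> limit s x <-> limit s^-1%g x.

Definition wrong s := [set x | free_at s x /\ ~ (M x <-> limit s x)].

(** Following the orbit of a wrong point forward one meets a jump, so wrong
    points lie behind one of finitely many points; and far behind such a point
    nothing is wrong, because the two ends of the orbit agree. *)
Lemma finite_wrong s : two_sided s -> finite_set (wrong s).
Proof.
move=> ts.
have Vray j k : a (s^-1 ^+ k)%g (ray s j k) = j by rewrite /ray expVgn actK.
have bound j : exists K, forall k, (K <= k)%N -> ~ wrong s (ray s^-1%g j k).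
  have [sj|sj] := pselect (free_at s j); last first.
    exists 0%N => k _ [sr _]; apply: sj.
    rewrite -[j](actK a (s^-1 ^+ k)%g); apply: free_at_comm sr => l.
    by rewrite -!actM expVgn invgK -!expgnDr addnC.
  have E k : limit s (ray s^-1%g j k) <-> limit s j.
    apply: limit_comm => // l; rewrite -!actM; congr (a _ j).
    by apply: commuteX2; apply/commuteV/commute_refl.
  have [Vj|[K HK]] := ray_alternative (free_atV sj).
    have [K HK] := Vj; exists K => k /HK Mk [_]; apply; split=> // _.
    by apply/E/ts.
  exists K => k Kk [_]; apply; split=> [/(HK _ Kk)//|/E/(ts _ sj)[L HL]].
  by have := HL _ (leq_maxr K L); have := HK _ (leq_maxl K L).
have /choice[K HK] := bound.
have fin : finite_set (\bigcup_(j in jumps s)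
    [set ray s^-1%g j k | k in [set k | (k < K j)%N]]).
  apply: bigcup_finite; first exact: finite_jumps.
  by move=> j _; apply: finite_image; apply: finite_II.
apply: sub_finite_set fin => x wx; have [sx nMx] := wx.
have [k nk] : exists k, ~ (M x <-> M (ray s x k)).
  have [lx|[L HL]] := ray_alternative sx.
    by have [L HL] := lx; exists L => E; apply: nMx; split=> // _; apply/E/HL.
  exists L => E; apply: nMx; split=> [/E/(HL _ (leqnn L))//|[L' HL']].
  by have := HL' _ (leq_maxr L L'); have := HL _ (leq_maxl L L').
have [k' Jk'] := jump_between nk.
exists (ray s x k') => //; exists k'; last by rewrite /ray expVgn actK.
rewrite /= ltnNge; apply/negP => /HK; apply.
by rewrite {1}/ray Vray.
Qed.

(** Two elements whose powers commute at [x] see the same end: the second ray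
    leaves the finite set of points that are wrong for the first element. *)
Lemma limit_agree s v x : two_sided s -> free_at s x -> free_at v x ->
  (forall k l, a (s ^+ k)%g (a (v ^+ l)%g x) = a (v ^+ l)%g (a (s ^+ k)%g x)) ->
  limit v x <-> limit s x.
Proof.
move=> ts sx vx sv.
have [K HK] := finite_avoid (ray_inj vx) (finite_wrong ts).
have E k : (K <= k)%N -> M (ray v x k) <-> limit s x.
  move=> /HK wk; apply: iff_trans (limit_comm (g := (v ^+ k)%g) _ sx) => //.
  apply: contrapT => nE; apply: wk; split=> //.
  exact: free_at_comm.
split=> [[L HL]|lx]; last by exists K => k /E->.
by apply/(E (maxn K L)); rewrite ?leq_maxl //; apply: HL; rewrite leq_maxr.
Qed.

(** An orbit with different ends contains a jump, so there are finitely many of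
    them; a group [D] commuting with [s] permutes these orbits, and if [D] is
    divisible it has to fix every point on them. *)
Lemma fix_two_ended (F : numFieldType) (D : F -> G) s x :
  (forall r r', D (r + r') = (D r * D r')%g) -> (forall r, commute (D r) s) ->
  free_at s x -> ~ (limit s x <-> limit s^-1%g x) -> forall r, a (D r) x = x.
Proof.
move=> DD Ds sx nx.
have D0 : D 0 = 1%g by apply: (mulgI (D 0)); rewrite -DD addr0 mulg1.
have Dsk r k y : a (s ^+ k)%g (a (D r) y) = a (D r) (a (s ^+ k)%g y).
  by rewrite -!actM (commuteX k (Ds r)).
(* The orbit of every [a (D r) x] has different ends as well, so it meets a jump. *)
have near r : exists j k l, jumps s j /\ a (s ^+ k)%g (a (D r) x) = a (s ^+ l)%g j.
  have sDx : free_at s (a (D r) x) by apply: free_at_comm.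
  have Dx : ~ (limit s (a (D r) x) <-> limit s^-1%g (a (D r) x)).
    move=> E; apply: nx.
    apply: iff_trans (iff_sym (limit_comm (g := D r) _ sx)) _ => //.
    apply: (iff_trans E); apply: limit_comm; last exact: free_atV.
    move=> k; rewrite -!actM; congr (a _ x).
    by apply/esym/commuteX/commuteV.
  have [l [k nk]] : exists l k, ~ (M (ray s^-1%g (a (D r) x) l) <->
      M (ray s (ray s^-1%g (a (D r) x) l) k)).
    have shift l k : ray s (ray s^-1%g (a (D r) x) l) (l + k) = ray s (a (D r) x) k.
      by rewrite /ray -actM expVgn addnC expgnDr mulgK.
    apply: contrapT => nn; apply: Dx.
    have {}nn l k : M (ray s^-1%g (a (D r) x) l) <-> M (ray s (a (D r) x) k).
      apply: contrapT => nE; apply: nn; exists l, (l + k)%N.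
      by rewrite shift.
    by split=> -[L HL]; exists 0%N => k _; apply/nn; apply: HL (leqnn L).
  have [k' Jk'] := jump_between nk.
  exists (ray s (ray s^-1%g (a (D r) x) l) k'), k', l; split=> //.
  rewrite /ray; set y := a (D r) x; rewrite -[in RHS]actM -expgnDr addnC.
  by rewrite expgnDr actM expVgn actVK.
(* [rel r u w] says that [D r] moves [x] by [w - u] steps along its orbit. *)
pose rel r u (w : nat) := a (s ^+ u)%g (a (D r) x) = a (s ^+ w)%g x.
have relM q r u (v : nat) : rel r u v -> rel (q%:R * r) (q * u)%N (q * v)%N.
  rewrite /rel => ruv; elim: q => [|q IH]; first by rewrite mul0r D0 !act1.
  rewrite -[q.+1]add1n natrD mulrDl mul1r DD !mulnDl !mul1n !expgnDr !actM.
  rewrite Dsk IH -Dsk -actM -expgnDr addnC expgnDr actM ruv.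
  by rewrite -!actM -!expgnDr addnC.
have /(@finite_seqP {classic X})[js Js] := finite_jumps s.
pose N := size js.
(* Pigeonhole: among the multiples [0, r, ..., N r] two lead to orbits through
   the same jump. *)
have close r : exists d u (v : nat), [/\ (0 < d)%N, (d <= N)%N & rel (d%:R * r) u v].
  have nearI k : exists i : nat, (i < N)%N /\ exists u (v : nat),
      a (s ^+ u)%g (a (D (k%:R * r)) x) =
      a (s ^+ v)%g (nth (x : {classic X}) js i).
    have [j [u [v [Jj E]]]] := near (k%:R * r).
    have jjs : (j : {classic X}) \in js by move: Jj; rewrite Js.
    exists (index (j : {classic X}) js); split; first by rewrite index_mem.
    by exists u, v; rewrite nth_index.
  have /choice[f Hf] := nearI.
  pose g (k : 'I_N.+1) : 'I_N := Ordinal (proj1 (Hf k)).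
  have : ~ injective g.
    by move=> /leq_card; rewrite !card_ord ltnn.
  move=> /existsNP[k1 /existsNP[k2 /not_implyP[gk k12]]].
  wlog lt12 : k1 k2 gk k12 / (k1 < k2)%N.
    move=> H; have [|lt21|/val_inj//] := ltngtP k1 k2; first exact: H.
    by apply: (H k2 k1) => // /esym.
  have [_ [u1 [v1 E1]]] := Hf k1; have [_ [u2 [v2 E2]]] := Hf k2.
  have fk : f k1 = f k2 by have := congr1 val gk.
  exists (k2 - k1)%N, (v1 + u2)%N, (v2 + u1)%N; split.
  - by rewrite subn_gt0.
  - by rewrite (leq_trans (leq_subr _ _)) // -ltnS.
  rewrite /rel; apply: (@act_inj _ _ a (D (k1%:R * r))).
  rewrite -!Dsk -[a (D _) (a (D _) x)]actM -DD -mulrDl -natrD subnKC 1?ltnW //.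
  rewrite [in LHS]expgnDr [in RHS]expgnDr !actM E1 E2 fk.
  by rewrite -!actM -!expgnDr addnC.
(* The difference of the two multiples divides [N!], and [r] is [N!] times
   another element. *)
have all_rel r : exists u (v : nat), rel r u v.
  have N0 : N`!%:R != 0 :> F by rewrite pnatr_eq0 -lt0n fact_gt0.
  have [d [u [v [d0 dN /(relM (N`! %/ d)%N) H]]]] := close (r / N`!%:R).
  move: H; have dN' : (d %| N`!)%N by apply: dvdn_fact; rewrite d0.
  rewrite mulrA -natrM divnK // mulrCA divff // mulr1 => H.
  by exists ((N`! %/ d) * u)%N, ((N`! %/ d) * v)%N.
(* The displacement [v - u] of [D r] is divisible by [q > |v - u|]. *)
move=> r; have [u [v ruv]] := all_rel r.
pose q := (u + v).+1.
have q0 : q%:R != 0 :> F by rewrite pnatr_eq0.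
have [u' [v' /(relM q)]] := all_rel (r / q%:R).
rewrite mulrCA divff // mulr1 /rel => E.
have /(ray_inj sx) : ray s x (q * u' + v) = ray s x (u + q * v').
  rewrite rayD /ray -ruv -actM -expgnDr addnC expgnDr actM E.
  by rewrite -actM -expgnDr.
have [uv _|uv] := eqVneq u v.
  by apply: (@act_inj _ _ a (s ^+ u)%g); rewrite ruv uv.
rewrite /q; have [uv'|uv'] := leqP u' v'.
  rewrite -(subnKC uv') mulnDr; set w := (v' - u')%N; case: w => [|w]; nia.
rewrite -(subnKC (ltnW uv')) mulnDr; set w := (u' - v')%N; case: w => [|w]; nia.
Qed.

End Ends.

(** * Commensurated subsets of transitive actions *)

Lemma invariant_setP (G : groupType) (X : Type) (a : action_on G X) (N : set X) :
  (forall g x, N x -> N (a g x)) -> invariant_set a N.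
Proof.
move=> NJ g; apply/seteqP; split=> [_ [x Nx <-]|x Nx]; first exact: NJ.
by apply/image_actE; apply: NJ.
Qed.

Definition coprime_to (p : nat) : nat -> Prop := fun m => ~~ (p %| m)%N.
Definition positive : nat -> Prop := fun m => (0 < m)%N.

Lemma positiveM m m' : positive m -> positive m' -> positive (m * m')%N.
Proof. by rewrite /positive muln_gt0 => -> ->. Qed.

Lemma coprime_toM p : prime p -> forall m m',
  coprime_to p m -> coprime_to p m' -> coprime_to p (m * m')%N.
Proof. by move=> pp m m'; rewrite /coprime_to Euclid_dvdM // negb_or => -> ->. Qed.

Section Dichotomy.
Variables (F : numFieldType).
Hypothesis ratF : forall r : F, exists2 b : nat, (0 < b)%N &
  exists z : int, b%:R * r = z%:~R.
Variables (n : nat) (n3 : (2 < n)%N) (X : Type) (a : action_on 'SL[F]_n X).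
Implicit Types (i j k l : 'I_n) (r s c : F) (x : X).

Definition root_free i j x := forall r, r != 0 -> a (elem i j r) x <> x.

Lemma root_free_at i j r x : i != j -> r != 0 -> root_free i j x ->
  free_at a (elem i j r) x.
Proof.
by move=> ij r0 fx k k0; rewrite elemX //; apply: fx; rewrite mulf_neq0 // pnatr_eq0 -lt0n.
Qed.

Lemma root_freeN i j x : i != j -> ~ root_free i j x ->
  forall r, exists2 m, (0 < m)%N & a (elem i j (m%:R * r)) x = x.
Proof.
move=> ij /existsNP[r0 /not_implyP[r00 /contrapT r0x]] r.
have [b b0 [z E]] := ratF (r / r0); exists b => //.
have -> : b%:R * r = z%:~R * r0 by rewrite -E -mulrA divfK.
exact: fix_elemZ.
Qed.

Lemma root_free_exists x : ~ root_loc a positive x ->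
  exists i j, i != j /\ root_free i j x.
Proof.
move=> nx; apply: contrapT => H; apply: nx => i j r ij.
by apply: root_freeN => // fx; apply: H; exists i, j.
Qed.

Lemma root_free_third i j q x : i != j -> i != q -> q != j ->
  root_free i j x -> root_free i q x \/ root_free q j x.
Proof.
move=> ij iq qj fx; apply: contrapT => /not_orP[].
move=> /(root_freeN iq)/(_ 1)[m m0 mx] /(root_freeN qj)/(_ 1)[m' m'0 m'x].
apply: fx (fix_elem_comm iq qj ij mx m'x).
by rewrite !mulr1 mulf_neq0 // pnatr_eq0 -lt0n.
Qed.

Lemma root_free_act i j g x : (forall r, commute (elem i j r) g) ->
  root_free i j x -> root_free i j (a g x).
Proof.
move=> cg fx r r0; rewrite -actM cg actM => /(@act_inj _ _ a _ _ _).
exact: fx.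
Qed.

Variables (M : set X) (cM : commensurated a M).

(** The root subgroups [elem i q] and [elem q j] centralize [elem i j], so they
    fix any point where the latter has two different ends; but together they
    generate it. *)
Lemma two_sided_elem i j r : i != j -> two_sided a M (elem i j r).
Proof.
move=> ij x fx; apply: contrapT => nx.
have [q [qi qj]] := third_index i j n3.
have iq : i != q by rewrite eq_sym.
have H1 : a (elem i q 1) x = x.
  apply: (fix_two_ended cM (D := elem i q)) fx nx _ => r1 => [r2|].
    exact: elemD.
  by apply: elem_commute => //; rewrite eq_sym.
have H2 : a (elem q j r) x = x.
  apply: (fix_two_ended cM (D := elem q j)) fx nx _ => r1 => [r2|].
    exact: elemD.
  by apply: elem_commute => //; rewrite eq_sym.
by apply: (fx 1%N); rewrite // expg1 -[r]mul1r; apply: fix_elem_comm H1 H2.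
Qed.

Local Notation elimit i j := (limit a M (elem i j 1)).

(** Either both root subgroups can be compared with the one generated by their
    commutators, or multiples of the latter fix [x], and after passing to a
    multiple the two commute at [x]. *)
Lemma elimit_nonopp i j k l x : i != j -> k != l -> (i, j) != (l, k) ->
  root_free i j x -> root_free k l x -> elimit i j x <-> elimit k l x.
Proof.
move=> ij kl opp fij fkl; have n10 := oner_neq0 F.
have [p [q [e [pq swap cij ckl]]]] := elem_swap F ij kl opp.
have [fpq|/(root_freeN pq) npq] := pselect (root_free p q x).
  have agree i' j' : i' != j' -> root_free i' j' x ->
      (forall r s, commute (elem p q r) (elem i' j' s)) ->
      elimit i' j' x <-> elimit p q x.
    move=> ij' fx cc; apply: limit_agree => //; [exact: two_sided_elem| | |].
    - exact: root_free_at.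
    - exact: root_free_at.
    - by move=> u v; rewrite !elemX // -!actM cc.
  exact: iff_trans (agree _ _ ij fij cij) (iff_sym (agree _ _ kl fkl ckl)).
have [m m0 mx] := npq e.
have m0' : m%:R != 0 :> F by rewrite pnatr_eq0 -lt0n.
apply: (@iff_trans _ (limit a M (elem k l m%:R) x)).
  apply: iff_sym; apply: limit_agree => //; [exact: two_sided_elem| | |].
  - exact: root_free_at.
  - exact: root_free_at.
  move=> u v; rewrite !elemX // -!actM swap !actM; congr (a _ (a _ _)).
  have -> : e * (u%:R * 1) * (v%:R * m%:R) = (u * v)%N%:R * (m%:R * e).
    by rewrite natrM; ring.
  exact: fix_elemM.
apply: limit_agree => //; [exact: two_sided_elem| | |].
- exact: root_free_at.
- exact: root_free_at.
- by move=> u v; rewrite !elemX // -!actM -!elemD // addrC.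
Qed.

Lemma elimit_agree i j k l x : i != j -> k != l ->
  root_free i j x -> root_free k l x -> elimit i j x <-> elimit k l x.
Proof.
move=> ij kl fij fkl.
have [|opp] := boolP ((i, j) != (l, k)); first by move=> /elimit_nonopp; apply.
have [q [qi qj]] := third_index i j n3.
have [iq jq] : i != q /\ j != q by rewrite !(eq_sym _ q).
have {}opp : k = j /\ l = i by move: opp; rewrite negbK => /eqP[-> ->].
case: opp => ? ?; subst k l.
have [fiq|fqj] := root_free_third ij iq qj fij.
  apply: (@iff_trans _ (elimit i q x)).
    by apply: elimit_nonopp => //; rewrite xpair_eqE negb_and iq.
  by apply: elimit_nonopp => //; rewrite xpair_eqE negb_and qj orbT.
apply: (@iff_trans _ (elimit q j x)).
  by apply: elimit_nonopp => //; rewrite xpair_eqE negb_and ij.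
by apply: elimit_nonopp => //; rewrite xpair_eqE negb_and qi.
Qed.

(** Conjugating a root subgroup by [elem k l c] changes it by a subgroup
    commuting with [elem k l c]; if that one acts freely at [x] it may be used
    instead, otherwise its multiples are invisible at [x]. *)
Lemma elimit_act k l c x : k != l -> (exists i j, i != j /\ root_free i j x) ->
  exists i j, [/\ i != j, root_free i j x, root_free i j (a (elem k l c) x) &
    elimit i j (a (elem k l c) x) <-> elimit i j x].
Proof.
move=> kl [i [j [ij fij]]]; have n10 := oner_neq0 F.
have [{}i [{}j [{}ij {}fij opp]]] : exists i j,
    [/\ i != j, root_free i j x & (i, j) != (l, k)].
  have [|opp] := boolP ((i, j) != (l, k)); first by exists i, j.
  have [q [qi qj]] := third_index i j n3.
  have [iq jq] : i != q /\ j != q by rewrite !(eq_sym _ q).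
  have {}opp : k = j /\ l = i by move: opp; rewrite negbK => /eqP[-> ->].
  case: opp => ? ?; subst k l.
  have [fiq|fqj] := root_free_third ij iq qj fij.
    by exists i, q; split=> //; rewrite xpair_eqE negb_and qj orbT.
  by exists q, j; split=> //; rewrite xpair_eqE negb_and qi.
have [p [q [e [pq swap cij ckl]]]] := elem_swap F ij kl opp.
have [fpq|/(root_freeN pq) npq] := pselect (root_free p q x).
  exists p, q; split=> //; first by apply: root_free_act => // r; apply: ckl.
  apply: limit_comm => //; last exact: root_free_at.
  by move=> u; rewrite elemX // -!actM ckl.
have [m m0 mx] := npq (e * c).
have m0' : m%:R != 0 :> F by rewrite pnatr_eq0 -lt0n.
pose g := elem k l c.
have gE (u : int) : a (elem i j (u%:~R * m%:R)) (a g x) =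
    a g (a (elem i j (u%:~R * m%:R)) x).
  rewrite /g -!actM swap !actM; congr (a _ (a _ _)).
  have -> : e * (u%:~R * m%:R) * c = u%:~R * (m%:R * (e * c)) by ring.
  exact: fix_elemZ.
have fg : root_free i j (a g x).
  move=> r r0 rx; have [b b0 [z E]] := ratF (r / m%:R).
  have z0 : z%:~R != 0 :> F.
    by rewrite -E !mulf_neq0 ?invr_eq0 // pnatr_eq0 -lt0n.
  have := fix_elemM b ij rx.
  have -> : b%:R * r = z%:~R * m%:R by rewrite -E -mulrA divfK.
  by rewrite gE => /(@act_inj _ _ a _ _ _); apply: fij; rewrite mulf_neq0.
exists i, j; split=> //.
have toM y : root_free i j y ->
    limit a M (elem i j m%:R) y <-> elimit i j y.
  move=> fy; apply: limit_agree => //; [exact: two_sided_elem| | |].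
  - exact: root_free_at.
  - exact: root_free_at.
  - by move=> u v; rewrite !elemX // -!actM -!elemD // addrC.
apply: (iff_trans (iff_sym (toM _ fg))); apply: iff_trans (toM _ fij).
apply: limit_comm => //; last exact: root_free_at.
by move=> u; rewrite elemX // (gE u).
Qed.

(** The end of a free orbit of a root subgroup does not depend on the root
    subgroup, and the points with end in [M] form the invariant set. *)
Lemma transfixed_root_free : (forall x, ~ root_loc a positive x) ->
  transfixed a M.
Proof.
move=> H; have ex x := root_free_exists (H x).
pose N := [set x | exists i j, [/\ i != j, root_free i j x & elimit i j x]].
have NE i j x : i != j -> root_free i j x -> N x <-> elimit i j x.
  move=> ij fx; split=> [[k [l [kl fkl]]]|lx]; last by exists i, j.
  by move/(elimit_agree ij kl fx fkl).
exists N; split.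
  apply: invariant_setP; apply: (SL_ind (ltnW n3)) => [k l c kl x|g h Pg Ph x].
    have [i [j [ij fx fgx E]]] := elimit_act c kl (ex x).
    by move=> /(NE i j x ij fx)/E; move/(NE i j _ ij fgx).
  by rewrite actM => /Ph/Pg.
have fin : finite_set (\bigcup_(ij in [set: 'I_n * 'I_n])
    [set x | ij.1 != ij.2 /\ wrong a M (elem ij.1 ij.2 1) x]).
  apply: bigcup_finite; first exact: finite_finset.
  move=> [i j] _ /=; have [ij|ij] := boolP (i != j).
    apply: sub_finite_set (finite_wrong cM (two_sided_elem (r := 1) ij)).
    by move=> x [].
  by apply: sub_finite_set (finite_set0 X) => x [].
apply: sub_finite_set fin => x MN; have [i [j [ij fx]]] := ex x.
exists (i, j) => //=; split=> //; split.
  by apply: root_free_at => //; exact: oner_neq0.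
move=> E; have {}E : M x <-> N x := iff_trans E (iff_sym (NE i j x ij fx)).
by case: MN => -[] Mx nNx; apply: nNx; apply/E.
Qed.

Variables (p : nat) (pp : prime p).
Hypothesis loc_pos : forall x, root_loc a positive x.
Hypothesis nloc_p : forall x, ~ root_loc a (coprime_to p) x.

(** The weights of a diagonal matrix commuting with all root subgroups that do
    not involve the index [i]. *)
Definition tweight i j : F := if j == i then p%:R ^- n.-1 else p%:R.
Definition torus i := diagSL (tweight i).

Lemma p_neq0 : p%:R != 0 :> F.
Proof. by rewrite pnatr_eq0 -lt0n prime_gt0. Qed.

Lemma tweight1 i : \prod_j tweight i j = 1.
Proof.
rewrite (bigD1 i) //= {1}/tweight eqxx.
rewrite (eq_bigr (fun=> p%:R)) => [|j /negbTE ji]; last by rewrite /tweight ji.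
rewrite prodr_const cardC1 card_ord mulVf // expf_neq0 //; exact: p_neq0.
Qed.

Lemma torus_row i j r (k : nat) : i != j ->
  (torus i ^+ k * elem i j r = elem i j (r / p%:R ^+ (n * k)) * torus i ^+ k)%g.
Proof.
move=> ij; elim: k r => [|k IH] r; first by rewrite muln0 divr1 mulg1 mul1g.
rewrite !expgSr -mulgA diagSL_elem ?tweight1 // mulgA IH -!mulgA.
rewrite /tweight eqxx eq_sym (negbTE ij).
congr (elem i j _ * _)%g; have p0 := p_neq0.
have -> : (n * k.+1 = n * k + n.-1 + 1)%N by lia.
rewrite !exprD expr1; field.
by rewrite p0 !expf_neq0.
Qed.

Lemma torus_col i j r (k : nat) : i != j ->
  (torus i ^+ k * elem j i r = elem j i (r * p%:R ^+ (n * k)) * torus i ^+ k)%g.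
Proof.
move=> ij; elim: k r => [|k IH] r; first by rewrite muln0 mulr1 mulg1 mul1g.
have ji : j != i by rewrite eq_sym.
rewrite !expgSr -mulgA diagSL_elem ?tweight1 // mulgA IH -!mulgA.
rewrite /tweight eqxx (negbTE ji).
congr (elem j i _ * _)%g; have p0 := p_neq0.
have -> : (n * k.+1 = n * k + n.-1 + 1)%N by lia.
by rewrite invrK !exprD expr1; ring.
Qed.

Lemma torus_commute i j k r : j != k -> j != i -> k != i ->
  commute (elem j k r) (torus i).
Proof.
move=> jk ji ki; rewrite /commute /torus diagSL_elem ?tweight1 //.
by rewrite /tweight (negbTE ji) (negbTE ki) mulrC mulKf ?p_neq0.
Qed.

(** A power of [torus i] fixing [x] makes the stabilizer of [x] stable under
    division by a power of [p] in the root subgroups it contracts or expands. *)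
Lemma torus_free i x : free_at a (torus i) x.
Proof.
move=> k k0 tx; apply: (@nloc_p x).
pose N := (n * k)%N; have N0 : (0 < N)%N by rewrite muln_gt0 k0; lia.
have p0 := p_neq0.
have divp (j1 j2 : 'I_n) : j1 != j2 ->
    (forall r, a (elem j1 j2 r) x = x -> a (elem j1 j2 (r / p%:R ^+ N)) x = x) ->
    forall r, exists2 m, coprime_to p m & a (elem j1 j2 (m%:R * r)) x = x.
  move=> j12 D r.
  have DL L s : a (elem j1 j2 s) x = x -> a (elem j1 j2 (s / p%:R ^+ (N * L))) x = x.
    elim: L s => [|L IH] s sx; first by rewrite muln0 divr1.
    by rewrite mulnS exprD invfM mulrA; apply/IH/D.
  have [m0 m00 m0x] := loc_pos x r j12.
  have [m pm E] := pfactor_coprime pp m00.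
  exists m; first by rewrite /coprime_to -prime_coprime.
  have := fix_elemM (p ^ (N * logn p m0 - logn p m0))%N j12 (DL (logn p m0) _ m0x).
  rewrite E natrM !natrX -E; set c := logn p m0.
  have [d Nc] : exists d, (N * c = d + c)%N.
    by exists (N * c - c)%N; rewrite subnK // leq_pmull.
  rewrite Nc addnK exprD (_ : p%:R ^+ d * _ = m%:R * r) //.
  by field; rewrite !expf_neq0.
have row j : i != j -> forall r,
    exists2 m, coprime_to p m & a (elem i j (m%:R * r)) x = x.
  move=> ij; apply: divp => // r rx.
  have /(congr1 (a^~ x)) := torus_row r k ij.
  by rewrite !actM tx rx tx.
have col j : i != j -> forall r,
    exists2 m, coprime_to p m & a (elem j i (m%:R * r)) x = x.
  move=> ij; apply: divp => [|r rx]; first by rewrite eq_sym.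
  have /(congr1 (a^~ x)) := torus_col (r / p%:R ^+ N) k ij.
  rewrite divfK ?expf_neq0 // !actM tx rx => E.
  by apply: (@act_inj _ _ a (torus i ^+ k)%g); rewrite E tx.
move=> j l r jl; have [ij|] := eqVneq i j; first by subst j; apply: row.
have [il ij|il ij] := eqVneq i l; first by subst l; apply: col.
have [m Km mx] := col j ij 1; have [m' Km' m'x] := row l il r.
exists (m * m')%N; first exact: coprime_toM.
have -> : (m * m')%N%:R * r = (m%:R * 1) * (m'%:R * r) by rewrite natrM; ring.
by apply: fix_elem_comm mx m'x => //; rewrite eq_sym.
Qed.

(** The centralizer of [torus i] contains all root subgroups not involving the
    index [i]; with the nontrivial stabilizers in the other ones they generate
    the whole group, so no point can have two different ends. *)
Lemma two_sided_torus i : two_sided a M (torus i).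
Proof.
move=> x fx; apply: contrapT => nx.
have other j k r : j != k -> j != i -> k != i -> a (elem j k r) x = x.
  move=> jk ji ki; apply: (fix_two_ended cM (D := elem j k)) fx nx _ => r1.
    by move=> r2; apply: elemD.
  exact: torus_commute.
apply: (fx 1%N) => //; apply: (fix_all n3) => j k r jk.
have [ij|ij] := eqVneq j i.
  subst j; have [q [qi qk]] := third_index i k n3.
  have iq : i != q by rewrite eq_sym.
  have [m m0 mx] := loc_pos x 1 iq.
  have -> : r = m%:R * 1 * (r / m%:R).
    by rewrite mulr1 mulrCA divff ?mulr1 // pnatr_eq0 -lt0n.
  by apply: fix_elem_comm mx _ => //; apply: other => //; rewrite eq_sym.
have [ik|ik] := eqVneq k i; last exact: other.
subst k; have [q [qi qj]] := third_index i j n3.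
have [m m0 mx] := loc_pos x 1 qi.
have -> : r = (r / m%:R) * (m%:R * 1).
  by rewrite mulr1 divfK // pnatr_eq0 -lt0n.
by apply: fix_elem_comm _ mx => //; rewrite 1?eq_sym //; apply: other; rewrite // eq_sym.
Qed.

(** The tori commute, hence see the same ends, and every elementary matrix is
    centralized by one of them. *)
Lemma transfixed_torus : transfixed a M.
Proof.
have agree i j x : limit a M (torus i) x <-> limit a M (torus j) x.
  apply: limit_agree => //; [exact: two_sided_torus|exact: torus_free..|].
  move=> u v; rewrite -!actM; congr (a _ x).
  by apply/commuteX2/diagSL_commute; apply: tweight1.
have i0 : 'I_n by apply: (Ordinal (ltnW (ltnW n3))).
exists [set x | limit a M (torus i0) x]; split.
  apply: invariant_setP; apply: (SL_ind (ltnW n3)) => [k l c kl x|g h Pg Ph x].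
    have [i [ik il]] := third_index k l n3 => /= /(agree _ i) lx.
    apply/(agree _ i)/limit_comm => //; last exact: torus_free.
    move=> u; rewrite -!actM; congr (a _ x); apply/commute_sym/commuteX.
    by apply: torus_commute; rewrite // eq_sym.
  by rewrite actM => /Ph/Pg.
have fw := finite_wrong cM (two_sided_torus (i := i0)).
apply: sub_finite_set fw => x MN.
split; first exact: torus_free.
by case: MN => -[] Mx nNx E; apply: nNx; apply/E.
Qed.

End Dichotomy.

Section Transitive.
Variables (F : numFieldType).
Hypothesis ratF : forall r : F, exists2 b : nat, (0 < b)%N &
  exists z : int, b%:R * r = z%:~R.
Variables (n : nat) (n3 : (2 < n)%N).

Lemma transitive_invariant (G : groupType) (X : Type) (a : action_on G X)
    (P : X -> Prop) : transitive_action a ->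
  (forall g x, P x -> P (a g x)) -> (exists x, P x) -> forall x, P x.
Proof.
move=> [x0 ox0] PJ [x Px] y.
have [g _ gx] : orbit_of a x0 x by rewrite ox0.
have [h _ hy] : orbit_of a x0 y by rewrite ox0.
by rewrite -hy; apply: (PJ); rewrite -[x0](actK a g) gx; apply: (PJ).
Qed.

Lemma transitive_locally_full X (a : action_on 'SL[F]_n X) :
  transitive_action a ->
  (forall p, prime p -> exists x, root_loc a (coprime_to p) x) ->
  exists x, [set: X] = [set x].
Proof.
move=> tr lp.
have fixed x : forall g, a g x = x.
  apply: (root_loc_fix n3) => p pp.
  apply: (transitive_invariant tr) (lp p pp) x => g x; apply: root_loc_act => //.
  exact: coprime_toM.
have [x0 ox0] := tr; exists x0; apply/seteqP; split=> // x _.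
by have [g _ <-] : orbit_of a x0 x by rewrite ox0.
Qed.

Lemma SL_FW' : property_FW' 'SL[F]_n.
Proof.
move=> X a tr M cM.
have [ex|nex] := pselect (exists x, root_loc a positive x); last first.
  by apply: (transfixed_root_free ratF n3 cM) => x lx; apply: nex; exists x.
have pos x : root_loc a positive x.
  apply: (transitive_invariant tr) ex x => g x; apply: root_loc_act => //.
  exact: positiveM.
have [lp|] := pselect (forall p, prime p -> exists x, root_loc a (coprime_to p) x).
  have [x0 X0] := transitive_locally_full tr lp.
  have eqx0 x : x = x0 by have : [set: X] x by []; rewrite X0.
  exists M; split; first by apply: invariant_setP => g x; rewrite (eqx0 x) (eqx0 (a g x0)).
  by apply: sub_finite_set (finite_set0 X) => x []-[].
move=> /existsNP[p /not_implyP[pp np]].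
by apply: (transfixed_torus n3 cM pp pos) => x lx; apply: np; exists x.
Qed.

End Transitive.

(** * A dominated additive functional *)

Section DominatedFunctional.
Variables (R : realType) (V : lmodType R) (S : V -> Prop).
Hypothesis SD : forall u v, S u -> S v -> S (u + v).
Hypothesis SZ : forall t u, S u -> S (t *: u).
Implicit Types (p q : V -> R) (u v : V) (t : R).

Definition sublinear_on q :=
  (forall u v, S u -> S v -> q (u + v) <= q u + q v) /\
  (forall t u, 0 < t -> S u -> q (t *: u) <= t * q u).

Lemma sublinear_opp q u : sublinear_on q -> S u -> - q (- u) <= q u.
Proof.
move=> [qD _] Su; have SN : S (- u) by rewrite -scaleN1r; apply: SZ.
have S0 : S 0 by rewrite -(scale0r u); apply: SZ.
have := qD _ _ Su SN; have := qD _ _ S0 S0; rewrite addr0 subrr; lra.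
Qed.

Lemma sublinear_scale q t u : sublinear_on q -> S u -> 0 <= t ->
  t * q u <= q (t *: u).
Proof.
move=> qs Su; rewrite le_eqVlt => /orP[/eqP <-|t0].
  have S0 : S 0 by rewrite -(scale0r u); apply: SZ.
  by rewrite mul0r scale0r; have := (proj1 qs) _ _ S0 S0; rewrite addr0; lra.
have ti0 : 0 < t^-1 by rewrite invr_gt0.
have := (proj2 qs) t^-1 (t *: u) ti0 (SZ t Su).
by rewrite scalerA mulVf ?gt_eqF // scale1r mulrC ler_pdivlMr // mulrC.
Qed.

Variables (p : V -> R) (ps : sublinear_on p).

(** Being [0] off [S] makes a functional determined by its values on [S], so
    that the pointwise order is antisymmetric. *)
Definition admissible q :=
  [/\ forall u, ~ S u -> q u = 0, sublinear_on q & forall u, S u -> q u <= p u].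

Lemma admissible_inf (A : set (V -> R)) q0 : A q0 ->
  (forall q, A q -> admissible q) ->
  (forall q1 q2, A q1 -> A q2 ->
     (forall u, q1 u <= q2 u) \/ (forall u, q2 u <= q1 u)) ->
  admissible (fun u => inf [set q u | q in A]).
Proof.
move=> Aq0 Aad Atot.
have ne u : [set q u | q in A] !=set0 by exists (q0 u), q0.
have lb u : S u -> has_lbound [set q u | q in A].
  move=> Su; exists (- p (- u)) => _ [q /Aad[_ qs qp] <-].
  apply: le_trans (sublinear_opp qs Su); rewrite lerN2; apply: qp.
  by rewrite -scaleN1r; apply: SZ.
have ilb u q : S u -> A q -> inf [set q u | q in A] <= q u.
  by move=> Su Aq; apply: ge_inf (lb u Su) _ _; exists q.
split=> [u nSu||u Su].
- suff -> : [set q u | q in A] = [set 0] by rewrite inf1.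
  apply/seteqP; split=> [_ [q /Aad[q00 _ _] <-]|_ ->]; first exact: q00.
  by exists q0 => //; have [-> //] := Aad _ Aq0.
- split=> [u v Su Sv|t u t0 Su].
    suff H q1 q2 : A q1 -> A q2 -> inf [set q (u + v) | q in A] <= q1 u + q2 v.
      rewrite -lerBlDl; apply: lb_le_inf => // _ [q2 Aq2 <-].
      rewrite lerBlDl -lerBlDr; apply: lb_le_inf => // _ [q1 Aq1 <-].
      by rewrite lerBlDr; apply: H.
    move=> Aq1 Aq2; have [le12|le21] := Atot _ _ Aq1 Aq2.
      apply: (le_trans (ilb _ _ (SD Su Sv) Aq1)).
      have [_ [q1D _] _] := Aad _ Aq1; apply: (le_trans (q1D _ _ Su Sv)).
      by rewrite lerD2l.
    apply: (le_trans (ilb _ _ (SD Su Sv) Aq2)).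
    have [_ [q2D _] _] := Aad _ Aq2; apply: (le_trans (q2D _ _ Su Sv)).
    by rewrite lerD2r.
  rewrite mulrC -ler_pdivrMr //; apply: lb_le_inf => // _ [q Aq <-].
  rewrite ler_pdivrMr // mulrC; apply: (le_trans (ilb _ _ (SZ t Su) Aq)).
  by have [_ [_ qZ] _] := Aad _ Aq; apply: qZ.
- by apply: (le_trans (ilb _ _ Su Aq0)); have [_ _ ->] := Aad _ Aq0.
Qed.

(** Subtracting as much as possible along the half-line directed by [v0]. *)
Definition tilt q v0 u :=
  if pselect (S u) then inf [set q (u + t *: v0) - t * q v0 | t in [set t | 0 <= t]]
  else 0.

Lemma tilt_le q v0 u t : sublinear_on q -> S v0 -> S u -> 0 <= t ->
  tilt q v0 u <= q (u + t *: v0) - t * q v0.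
Proof.
move=> qs Sv0 Su t0; rewrite /tilt; case: pselect => [Su'|//].
apply: ge_inf; last by exists t.
exists (- q (- u)) => _ [t' /= t'0 <-].
have SN : S (- u) by rewrite -scaleN1r; apply: SZ.
have := (proj1 qs) (- u) (u + t' *: v0) SN (SD Su (SZ t' Sv0)).
rewrite addKr; have := sublinear_scale qs Sv0 t'0; lra.
Qed.

Lemma tilt_admissible q v0 : admissible q -> S v0 -> admissible (tilt q v0).
Proof.
move=> [q0 qs qp] Sv0.
have ge_tilt u c : S u ->
    (forall t, 0 <= t -> c <= q (u + t *: v0) - t * q v0) -> c <= tilt q v0 u.
  move=> Su H; rewrite /tilt; case: pselect => [Su'|//].
  apply: lb_le_inf; first by exists (q (u + 0 *: v0) - 0 * q v0), 0 => /=.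
  by move=> _ [t /= t0 <-]; apply: H.
split=> [u nSu||u Su]; first by rewrite /tilt; case: pselect.
- split=> [u v Su Sv|t u t0 Su].
    suff H t1 t2 : 0 <= t1 -> 0 <= t2 -> tilt q v0 (u + v) <=
        (q (u + t1 *: v0) - t1 * q v0) + (q (v + t2 *: v0) - t2 * q v0).
      rewrite -lerBlDl; apply: (ge_tilt) => // t2 t20.
      rewrite lerBlDl -lerBlDr; apply: (ge_tilt) => // t1 t10.
      by rewrite lerBlDr; apply: H.
    move=> t10 t20.
    apply: (le_trans (tilt_le qs Sv0 (SD Su Sv) (addr_ge0 t10 t20))).
    have := (proj1 qs) _ _ (SD Su (SZ t1 Sv0)) (SD Sv (SZ t2 Sv0)).
    rewrite addrACA -scalerDl; lra.
  rewrite mulrC -ler_pdivrMr //; apply: (ge_tilt) => // t' t'0.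
  rewrite ler_pdivrMr //.
  apply: (le_trans (tilt_le qs Sv0 (SZ t Su) (mulr_ge0 (ltW t0) t'0))).
  have := (proj2 qs) t _ t0 (SD Su (SZ t' Sv0)).
  rewrite scalerDr scalerA; lra.
apply: (le_trans (tilt_le qs Sv0 Su (lexx 0))).
by rewrite scale0r addr0 mul0r subr0; apply: qp.
Qed.

(** A minimal sublinear functional is additive, because tilting it along any
    vector cannot make it smaller. *)
Lemma dominated_additive : exists phi : V -> R,
  (forall u v, S u -> S v -> phi (u + v) = phi u + phi v) /\
  (forall u, S u -> phi u <= p u).
Proof.
pose T := {q : V -> R | admissible q}.
pose below (q1 q2 : T) := `[< forall u, sval q2 u <= sval q1 u >].
pose p0 u := if pselect (S u) then p u else 0.
have p0ad : admissible p0.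
  have p0E u : S u -> p0 u = p u by rewrite /p0; case: pselect.
  split=> [u nSu||u Su]; first by rewrite /p0; case: pselect.
    split=> [u v Su Sv|t u t0 Su].
      by rewrite !p0E //; [apply: (proj1 ps)|apply: SD].
    by rewrite !p0E //; [apply: (proj2 ps)|apply: SZ].
  by rewrite p0E.
have [||||[q qad] qmin] := @Zorn T below.
- by move=> q; apply/asboolP.
- move=> q1 q2 q3 /asboolP q12 /asboolP q23; apply/asboolP => u.
  exact: le_trans (q23 u) (q12 u).
- move=> [q1 a1] [q2 a2] /asboolP /= q12 /asboolP /= q21; apply: eq_exist.
  by apply/funext => u; apply/eqP; rewrite eq_le q12 q21.
- move=> A Atot; have [[q0 Aq0]|A0] := pselect (exists q1 : T, A q1); last first.
    by exists (exist _ p0 p0ad) => q Aq; case: A0; exists q.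
  pose A' : set (V -> R) := [set sval q | q in A].
  have A'q0 : A' (sval q0) by exists q0.
  have A'ad q : A' q -> admissible q by move=> [q' _ <-]; apply: (svalP q').
  have A'tot q1 q2 : A' q1 -> A' q2 ->
      (forall u, q1 u <= q2 u) \/ (forall u, q2 u <= q1 u).
    move=> [q1' Aq1 <-] [q2' Aq2 <-].
    by have [/asboolP|/asboolP] := Atot _ _ Aq1 Aq2; [right|left].
  have Iad := admissible_inf A'q0 A'ad A'tot.
  exists (exist _ _ Iad) => q Aq; apply/asboolP => u /=.
  have [Su|nSu] := pselect (S u).
    apply: ge_inf; last by exists (sval q) => //; exists q.
    exists (- p (- u)) => _ [q1 /A'ad[_ q1s q1p] <-].
    apply: le_trans (sublinear_opp q1s Su); rewrite lerN2; apply: q1p.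
    by rewrite -scaleN1r; apply: SZ.
  have [I0 _ _] := Iad; rewrite (I0 u nSu).
  by have [q00 _ _] := svalP q; rewrite q00.
have [q0 qs qp] := qad; exists q; split=> // u v Su Sv.
apply/eqP; rewrite eq_le (proj1 qs) //=.
have tad := tilt_admissible qad Sv.
have /qmin/(congr1 sval) /= tq : below (exist _ q qad) (exist _ _ tad).
  apply/asboolP => w /=; have [Sw|nSw] := pselect (S w).
    by have := tilt_le qs Sv Sw (lexx 0); rewrite scale0r addr0 mul0r subr0.
  by have [-> //] := tad; rewrite q0.
have := tilt_le qs Sv Su ler01; rewrite tq scale1r mul1r; lra.
Qed.

End DominatedFunctional.

(** * Almost invariant functions from an invariant mean *)

Section L1norm.
Variables (R : realType) (T : eqType).
Implicit Types (u v f g : T -> R) (s : seq T).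

Definition l1_sums v := [set \sum_(z <- s) `|v z| | s in [set s | uniq s]].
Definition summable v := has_ubound (l1_sums v).
Definition l1 v := sup (l1_sums v).

Lemma l1_sums_ne v : l1_sums v !=set0.
Proof. by exists 0; exists [::]; rewrite ?big_nil. Qed.

Lemma summableP v c : (forall s, uniq s -> \sum_(z <- s) `|v z| <= c) ->
  summable v.
Proof. by move=> H; exists c => _ [s us <-]; apply: H. Qed.

Lemma l1_ub v s : summable v -> uniq s -> \sum_(z <- s) `|v z| <= l1 v.
Proof. by move=> sv us; apply: (ub_le_sup sv); exists s. Qed.

Lemma l1_le v c : (forall s, uniq s -> \sum_(z <- s) `|v z| <= c) -> l1 v <= c.
Proof.
move=> H; apply: ge_sup (l1_sums_ne v) _ => _ [s us <-]; exact: H.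
Qed.

Lemma l1_ge0 v : summable v -> 0 <= l1 v.
Proof. by move=> sv; have := @l1_ub v [::] sv isT; rewrite big_nil. Qed.

Lemma l1_sumD u v s : \sum_(z <- s) `|u z + v z| <=
  \sum_(z <- s) `|u z| + \sum_(z <- s) `|v z|.
Proof. by rewrite -big_split; apply: ler_sum => z _; apply: ler_normD. Qed.

Lemma summableD u v : summable u -> summable v -> summable (fun z => u z + v z).
Proof.
move=> su sv; apply: (@summableP _ (l1 u + l1 v)) => s us.
by apply: (le_trans (l1_sumD _ _ _)); rewrite lerD ?l1_ub.
Qed.

Lemma l1D u v : summable u -> summable v -> l1 (fun z => u z + v z) <= l1 u + l1 v.
Proof.
move=> su sv; apply: l1_le => s us.
by apply: (le_trans (l1_sumD _ _ _)); rewrite lerD ?l1_ub.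
Qed.

Lemma l1_sumZ t v s : \sum_(z <- s) `|t * v z| = `|t| * \sum_(z <- s) `|v z|.
Proof. by rewrite mulr_sumr; apply: eq_bigr => z _; rewrite normrM. Qed.

Lemma summableZ t v : summable v -> summable (fun z => t * v z).
Proof.
move=> sv; apply: (@summableP _ (`|t| * l1 v)) => s us.
by rewrite l1_sumZ ler_wpM2l // l1_ub.
Qed.

Lemma l1Z t v : summable v -> l1 (fun z => t * v z) <= `|t| * l1 v.
Proof.
by move=> sv; apply: l1_le => s us; rewrite l1_sumZ ler_wpM2l // l1_ub.
Qed.

Lemma summableN v : summable v -> summable (fun z => - v z).
Proof.
move=> sv; apply: (@summableP _ (l1 v)) => s us.
by under eq_bigr do rewrite normrN; apply: l1_ub.
Qed.

Lemma l1N v : summable v -> l1 (fun z => - v z) <= l1 v.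
Proof.
by move=> sv; apply: l1_le => s us; under eq_bigr do rewrite normrN; apply: l1_ub.
Qed.

Lemma sum_mono f s1 s2 : (forall z, 0 <= f z) -> uniq s1 -> {subset s1 <= s2} ->
  \sum_(z <- s1) f z <= \sum_(z <- s2) f z.
Proof.
move=> f0 u1 s12.
have -> : \sum_(z <- s1) f z =
    \sum_(z <- [seq z <- undup s2 | z \in s1]) f z.
  apply: perm_big; apply: uniq_perm => //; first by rewrite filter_uniq ?undup_uniq.
  move=> z; rewrite mem_filter mem_undup.
  by case: (boolP (z \in s1)) => // /s12 ->.
rewrite big_filter; apply: (@le_trans _ _ (\sum_(z <- undup s2) f z)).
  by rewrite [leRHS](bigID (mem s1)) /= lerDl sumr_ge0.
elim: s2 {s12} => //= z s IH; case: ifP => zs; rewrite !big_cons; last first.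
  by rewrite lerD2l.
by apply: (le_trans IH); rewrite lerDr.
Qed.

Lemma sum_support f s1 s2 : uniq s1 -> uniq s2 -> {subset s1 <= s2} ->
  (forall z, z \notin s1 -> f z = 0) -> \sum_(z <- s2) f z = \sum_(z <- s1) f z.
Proof.
move=> u1 u2 s12 f0.
rewrite (bigID (mem s1)) /= [X in _ + X]big1 ?addr0; last by move=> z /f0.
rewrite -big_filter; apply: perm_big; apply: uniq_perm => //.
  exact: filter_uniq.
by move=> z; rewrite mem_filter; case: (boolP (z \in s1)) => // /s12 ->.
Qed.

Lemma l1_sum_support f s1 s2 : uniq s1 -> uniq s2 ->
  (forall z, z \notin s1 -> f z = 0) ->
  \sum_(z <- s2) `|f z| <= \sum_(z <- s1) `|f z|.
Proof.
move=> u1 u2 f0; rewrite (bigID (mem s1)) /= [X in _ + X]big1 ?addr0; last first.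
  by move=> z /f0 ->; rewrite normr0.
rewrite -big_filter; apply: sum_mono => //; first exact: filter_uniq.
by move=> z; rewrite mem_filter => /andP[].
Qed.

Lemma summable_support f s : uniq s -> (forall z, z \notin s -> f z = 0) ->
  summable f.
Proof.
move=> us f0; apply: (@summableP _ (\sum_(z <- s) `|f z|)) => s2 us2.
exact: l1_sum_support.
Qed.

Lemma l1_support f s : uniq s -> (forall z, z \notin s -> f z = 0) ->
  l1 f = \sum_(z <- s) `|f z|.
Proof.
move=> us f0; apply/eqP; rewrite eq_le; apply/andP; split.
  by apply: l1_le => s2 us2; apply: l1_sum_support.
by apply: l1_ub => //; apply: summable_support f0.
Qed.

Lemma l1D_ge0 f g : (forall z, 0 <= f z) -> (forall z, 0 <= g z) ->
  summable f -> summable g -> l1 (fun z => f z + g z) = l1 f + l1 g.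
Proof.
move=> f0 g0 sf sg; apply/eqP; rewrite eq_le l1D //=.
rewrite -lerBrDl; apply: l1_le => s2 u2.
rewrite lerBrDl -lerBrDr; apply: l1_le => s1 u1; rewrite lerBrDr.
pose s := undup (s1 ++ s2).
have us : uniq s by apply: undup_uniq.
apply: le_trans (l1_ub (summableD sf sg) us).
under [leRHS]eq_bigr do rewrite ger0_norm ?addr_ge0 //.
rewrite big_split /=; apply: lerD.
  under eq_bigr do rewrite ger0_norm //.
  by apply: sum_mono => // z zs; rewrite mem_undup mem_cat zs.
under eq_bigr do rewrite ger0_norm //.
by apply: sum_mono => // z zs; rewrite mem_undup mem_cat zs orbT.
Qed.

End L1norm.

Section FinitelyAdditive.
Variables (R : realType) (X : Type) (mu : set X -> R).
Hypothesis mu_ge0 : forall A, 0 <= mu A.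
Hypothesis muU : forall A B, A `&` B = set0 -> mu (A `|` B) = mu A + mu B.

Lemma fa_set0 : mu set0 = 0.
Proof.
have := muU (set0I (set0 : set X)); rewrite setU0 => E.
by apply: (addrI (mu set0)); rewrite addr0.
Qed.

Lemma fa_partition (T : finType) (c : X -> T) (D : set X) (P : pred T) :
  mu (D `&` [set x | P (c x)]) = \sum_(t | P t) mu (D `&` [set x | c x = t]).
Proof.
have H (ts : seq T) : uniq ts -> mu (D `&` [set x | c x \in ts]) =
    \sum_(t <- ts) mu (D `&` [set x | c x = t]).
  elim: ts => [|t ts IH] /=.
    move=> _; rewrite big_nil -fa_set0; congr mu; apply/seteqP; split=> // x [] _.
    by rewrite /= in_nil.
  move=> /andP[tts /IH E]; rewrite big_cons -E -muU; last first.
    apply/seteqP; split=> // x [[_ /= xt] [_ /=]].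
    by rewrite xt (negbTE tts).
  congr mu; rewrite -setIUr; congr (_ `&` _); apply/seteqP; split=> x /=.
    by rewrite inE => /orP[/eqP|]; [left|right].
  by rewrite inE => -[->|->]; rewrite ?eqxx ?orbT.
rewrite -big_filter -H ?filter_uniq ?index_enum_uniq //.
congr mu; congr (_ `&` _); apply/seteqP; split=> x /=;
  by rewrite mem_filter mem_index_enum andbT.
Qed.

(** The integral of a bounded integer function does not change along a measure
    preserving map, so the total of finitely many such functions cannot
    increase everywhere. *)
Lemma no_increase (I : finType) (s : I -> X -> X) (D : set X) (L : nat)
    (k : I -> X -> nat) : (forall i x, (k i x < L)%N) ->
  (forall i A, A `<=` D -> mu (D `&` [set x | A (s i x)]) = mu A) ->
  (forall i x, D x -> D (s i x)) ->
  (forall x, D x -> (\sum_i k i x < \sum_i k i (s i x))%N) -> mu D = 0.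
Proof.
move=> kL sinv sD incr.
case: L => [|L] in kL *.
  have -> : D = set0; last exact: fa_set0.
  apply/seteqP; split=> // x /incr; rewrite [X in (_ < X)%N]big1 // => i.
  by have := kL i x.
pose c x : {ffun I -> 'I_L.+1 * 'I_L.+1} :=
  [ffun i => (Ordinal (kL i x), Ordinal (kL i (s i x)))].
pose m t := mu (D `&` [set x | c x = t]).
have push i (pr : 'I_L.+1 * 'I_L.+1 -> 'I_L.+1) :
    \sum_t m t * (pr (t i))%:R =
    \sum_(j : 'I_L.+1) mu (D `&` [set x | pr (c x i) = j]) * j%:R.
  rewrite (partition_big (fun t : {ffun _} => pr (t i)) xpredT) //=.
  apply: eq_bigr => j _; under eq_bigr => t /eqP -> do [].
  rewrite -mulr_suml /m -(fa_partition c D (fun t => pr (t i) == j)).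
  congr (mu (D `&` _) * _); apply/seteqP; by split=> x /eqP.
have bal i : \sum_t m t * (t i).2%:R = \sum_t m t * (t i).1%:R.
  rewrite (push i snd) (push i fst); apply: eq_bigr => j _; congr (_ * _).
  rewrite -(sinv i (D `&` [set x | (c x i).1 = j])); last by move=> x [].
  congr mu; apply/seteqP; split=> x [Dx]; rewrite /= !ffunE /= => E.
    by split=> //; split; [exact: sD|rewrite -E; exact/val_inj].
  by split=> //; case: E => _ <-; apply/val_inj.
have : \sum_t m t * (\sum_i (t i).2%:R - \sum_i (t i).1%:R) = 0.
  under eq_bigr do rewrite mulrBr !mulr_sumr.
  rewrite big_split /= sumrN [X in X - _]exchange_big [X in _ - X]exchange_big /=.
  by rewrite (eq_bigr _ (fun i _ => bal i)) subrr.
have mD : mu D = \sum_t m t.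
  rewrite -(fa_partition c D xpredT); congr mu.
  by apply/seteqP; split=> x //= [].
suff : \sum_t m t <= \sum_t m t * (\sum_i (t i).2%:R - \sum_i (t i).1%:R).
  by move=> le1 E; apply/eqP; rewrite eq_le mu_ge0 andbT mD (le_trans le1) ?E.
apply: ler_sum => t _; have [[x [Dx /= cx]]|nx] :=
  pselect (exists x, D x /\ c x = t); last first.
  suff -> : m t = 0 by rewrite mul0r.
  rewrite /m -fa_set0; congr mu; apply/seteqP; split=> // x [Dx /= cx].
  by apply: nx; exists x.
rewrite ler_peMr ?mu_ge0 // -!natr_sum lerBrDr nat1r ler_nat.
have := incr x Dx.
rewrite (eq_bigr (fun i => (t i).1 : nat)) => [|i _]; last by rewrite -cx ffunE.
rewrite [X in (_ < X)%N](eq_bigr (fun i => (t i).2 : nat)) // => i _.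
by rewrite -cx ffunE.
Qed.

End FinitelyAdditive.

Section AlmostInvariant.
Variables (R : realType) (X : choiceType) (I : finType) (s s' : I -> X -> X).
Hypothesis sK : forall i, cancel (s i) (s' i).
Hypothesis s'K : forall i, cancel (s' i) (s i).
Variables (D : set X) (mu : set X -> R).
Hypothesis s'D : forall i x, D x -> D (s' i x).
Hypothesis mu_ge0 : forall A, 0 <= mu A.
Hypothesis muU : forall A B, A `&` B = set0 -> mu (A `|` B) = mu A + mu B.
Hypothesis s'mu : forall i A, A `<=` D -> mu (D `&` [set x | A (s' i x)]) = mu A.
Hypothesis muD : mu D <> 0.
Variables (eps : R) (eps0 : 0 < eps).

Definition fin_density (f : X -> R) := (forall x, 0 <= f x) /\
  exists om : seq X, [/\ uniq om, forall x, x \in om -> D x &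
    forall x, x \notin om -> f x = 0].

Definition shift_diff (f : X -> R) (z : I * X) : R := f (s z.1 z.2) - f z.2.

Lemma fin_density_summable f : fin_density f -> summable f.
Proof. by move=> [_ [om [uom _ f0]]]; apply: summable_support f0. Qed.

Lemma shift_diff_summable f : fin_density f -> summable (shift_diff f).
Proof.
move=> [_ [om [uom _ f0]]].
pose om1 := [seq (i, y) | i <- enum I, y <- om].
pose om2 := [seq (i, s' i y) | i <- enum I, y <- om].
apply: (@summable_support _ _ _ (undup (om1 ++ om2))) => [|[i x]].
  exact: undup_uniq.
rewrite mem_undup mem_cat negb_or => /andP[n1 n2]; rewrite /shift_diff /=.
rewrite !f0 ?subrr //.
  apply: contra n1 => xom; apply/allpairsP; exists (i, x).
  by rewrite mem_enum.
apply: contra n2 => xom; apply/allpairsP; exists (i, s i x).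
by rewrite mem_enum /= sK.
Qed.

Lemma fin_densityD f g : fin_density f -> fin_density g ->
  fin_density (fun x => f x + g x).
Proof.
move=> [f0 [o1 [u1 d1 f1]]] [g0 [o2 [u2 d2 g1]]]; split=> [x|].
  by rewrite addr_ge0.
exists (undup (o1 ++ o2)); split=> [|x|x]; first exact: undup_uniq.
  by rewrite mem_undup mem_cat => /orP[/d1|/d2].
by rewrite mem_undup mem_cat negb_or => /andP[/f1-> /g1->]; rewrite addr0.
Qed.

Lemma fin_densityZ t f : 0 <= t -> fin_density f -> fin_density (fun x => t * f x).
Proof.
move=> t0 [f0 [om [uom dom f1]]]; split=> [x|]; first by rewrite mulr_ge0.
by exists om; split=> // x /f1 ->; rewrite mulr0.
Qed.

Lemma fin_density0 : fin_density (fun=> 0).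
Proof. by split=> //; exists [::]. Qed.

Lemma fin_density_point x : D x -> fin_density (fun y => (y == x)%:R).
Proof.
move=> Dx; split=> [y|]; first exact: ler0n.
exists [:: x]; split=> // y; first by rewrite inE => /eqP->.
by rewrite inE => /negbTE->.
Qed.

Lemma l1_scale (T : eqType) t (v : T -> R) : 0 < t -> summable v ->
  l1 (fun z => t * v z) = t * l1 v.
Proof.
move=> t0 sv; apply/eqP; rewrite eq_le; apply/andP; split.
  by have := l1Z t sv; rewrite gtr0_norm.
have := l1Z t^-1 (summableZ t sv); rewrite gtr0_norm ?invr_gt0 //.
under [X in l1 X]funext do rewrite mulKf ?gt_eqF //.
by rewrite mulrC ler_pdivlMr // mulrC.
Qed.

Hypothesis no_reiter : forall f om, uniq om -> (forall x, x \in om -> D x) ->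
  (forall x, 0 <= f x) -> (forall x, x \notin om -> f x = 0) ->
  \sum_(x <- om) f x = 1 ->
  exists i om', uniq om' /\ eps < \sum_(x <- om') `|f (s i x) - f x|.

Lemma shift_gap f : fin_density f -> eps * l1 f <= l1 (shift_diff f).
Proof.
move=> Cf; have sw := shift_diff_summable Cf; have sf := fin_density_summable Cf.
have [f0 [om [uom dom f1]]] := Cf.
have := l1_ge0 sf; rewrite le_eqVlt => /orP[/eqP <-|m0].
  by rewrite mulr0; apply: l1_ge0.
have [|||i [om' [uom']]] := @no_reiter (fun x => (l1 f)^-1 * f x) om uom dom.
- by move=> x; rewrite mulr_ge0 // invr_ge0 ltW.
- by move=> x xom; rewrite f1 ?mulr0.
- rewrite -mulr_sumr (l1_support uom f1).
  under [X in _ * X]eq_bigr do rewrite -[f _]ger0_norm //.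
  by rewrite mulVf // -(l1_support uom f1) gt_eqF.
under eq_bigr do rewrite -mulrBr normrM gtr0_norm ?invr_gt0 //.
rewrite -mulr_sumr mulrC ltr_pdivlMr // => /ltW le1; apply: (le_trans le1).
have := @l1_ub _ _ _ [seq (i, x) | x <- om'] sw; rewrite big_map; apply.
by rewrite map_inj_uniq // => x y [].
Qed.

Local Notation V := (I * X -> R^o).

(** The distance from [- v] to the cone of the differences [shift_diff f],
    rewarded by the mass of [f].  It is finite because, by [shift_gap], moving a
    density costs more than the reward, and an additive functional below it is
    bounded and at least [eps] on each [shift_diff] of a point mass. *)
Definition gauge (v : V) :=
  inf [set l1 (fun z => v z + shift_diff f z) - eps * l1 f | f in fin_density].

Lemma gauge_le v f : summable v -> fin_density f ->
  gauge v <= l1 (fun z => v z + shift_diff f z) - eps * l1 f.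
Proof.
move=> sv Cf; apply: ge_inf; last by exists f.
exists (- l1 v) => _ [g Cg <-].
have sw := shift_diff_summable Cg.
have := l1D (summableD sv sw) (summableN sv).
under [X in l1 X <= _]funext do rewrite addrAC subrr add0r.
have := l1N sv; have := shift_gap Cg; lra.
Qed.

Lemma gauge_ge v c : (forall f, fin_density f ->
  c <= l1 (fun z => v z + shift_diff f z) - eps * l1 f) -> c <= gauge v.
Proof.
move=> H; apply: lb_le_inf; last by move=> _ [f Cf <-]; apply: H.
by eexists; exists (fun=> 0); [exact: fin_density0|].
Qed.

Lemma gauge_sublinear : sublinear_on (@summable R _ : V -> Prop) gauge.
Proof.
split=> [u v su sv|t v t0 sv].
  suff H f g : fin_density f -> fin_density g -> gauge (u + v) <=
     (l1 (fun z => u z + shift_diff f z) - eps * l1 f) +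
     (l1 (fun z => v z + shift_diff g z) - eps * l1 g).
    rewrite -lerBlDl; apply: gauge_ge => g Cg.
    rewrite lerBlDl -lerBlDr; apply: gauge_ge => f Cf.
    by rewrite lerBlDr; apply: H.
  move=> Cf Cg; apply: le_trans (gauge_le (summableD su sv) (fin_densityD Cf Cg)) _.
  rewrite (l1D_ge0 (proj1 Cf) (proj1 Cg) (fin_density_summable Cf)
    (fin_density_summable Cg)).
  have := l1D (summableD su (shift_diff_summable Cf))
    (summableD sv (shift_diff_summable Cg)).
  rewrite (_ : (fun z => u z + _ + _) = (fun z => u z + v z +
    shift_diff (fun x => f x + g x) z)); last first.
    by apply/funext => z; rewrite /shift_diff; ring.
  lra.
rewrite mulrC -ler_pdivrMr //; apply: gauge_ge => f Cf; rewrite ler_pdivrMr //.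
apply: le_trans (gauge_le (summableZ t sv) (fin_densityZ (ltW t0) Cf)) _.
have := l1_scale t0 (summableD sv (shift_diff_summable Cf)).
have := l1_scale t0 (fin_density_summable Cf).
rewrite (_ : (fun z => t * (v z + _)) = (fun z => t * v z +
    shift_diff (fun x => t * f x) z)); last first.
  by apply/funext => z; rewrite /shift_diff; ring.
move=> -> ->; lra.
Qed.

Definition point (z : I * X) : V := fun w => (w == z)%:R.

Lemma l1_point (T : eqType) (z : T) : l1 (fun w => (w == z)%:R : R) = 1.
Proof.
rewrite (@l1_support _ _ _ [:: z]) // ?big_seq1 ?eqxx ?normr1 // => w.
by rewrite inE => /negbTE->.
Qed.

Lemma point_summable z : summable (point z).
Proof.
apply: (@summable_support _ _ _ [:: z]) => // w.
by rewrite inE /point => /negbTE->.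
Qed.

Lemma no_reiter_contra : False.
Proof.
have S0 : summable (fun=> 0 : R) by move=> T; apply: (@summable_support _ T _ [::]).
have SD (u v : V) : summable u -> summable v -> summable (u + v).
  exact: summableD.
have SZ t (u : V) : summable u -> summable (t *: u) by exact: summableZ.
have [phi [phiD phip]] := dominated_additive SD SZ gauge_sublinear.
have phil1 v : summable v -> phi v <= l1 v.
  move=> sv; apply: le_trans (phip _ sv) _.
  apply: le_trans (gauge_le sv fin_density0) _.
  have -> : (fun z => v z + shift_diff (fun=> 0) z) = v.
    by apply/funext => z; rewrite /shift_diff subrr addr0.
  by rewrite lerBlDr lerDl mulr_ge0 ?(ltW eps0) //; apply/l1_ge0/S0.
have phi0 : phi 0 = 0.
  have := phiD 0 0 (S0 _) (S0 _); rewrite addr0 => E.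
  by apply: (addrI (phi 0)); rewrite addr0 -E.
have phiN v : summable v -> phi (- v) = - phi v.
  move=> sv; have := phiD _ _ sv (summableN sv).
  by rewrite (_ : v + _ = 0) ?phi0 => [E|]; [lra|exact: subrr].
have phisum (v : I -> V) : (forall i, summable (v i)) ->
    summable (\sum_i v i) /\ phi (\sum_i v i) = \sum_i phi (v i).
  move=> sv; elim: (index_enum I) => [|i r [IHs IHp]].
    by rewrite !big_nil; split; first exact: S0.
  rewrite !big_cons -IHp; split; first exact: summableD.
  exact: phiD.
pose h i x := phi (point (i, x)).
have h_le i x : -1 <= h i x <= 1.
  have le1 := phil1 _ (point_summable (i, x)).
  have := phil1 _ (summableN (point_summable (i, x))).
  have := l1N (point_summable (i, x)).
  rewrite (phiN _ (point_summable _)) l1_point -/(h i x) in le1 *.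
  by move=> H1 H2; apply/andP; split; lra.
have h_gap x : D x -> eps <= \sum_i (h i (s' i x) - h i x).
  move=> Dx; have Cx := fin_density_point Dx.
  pose v i : V := point (i, s' i x) - point (i, x).
  have sv i : summable (v i).
    by apply: summableD; [|apply: summableN]; exact: point_summable.
  have [ssv pv] := phisum v sv.
  have vE : \sum_i v i = shift_diff (fun y => (y == x)%:R).
    apply/funext => -[j y]; rewrite fct_sumE (bigD1 j) //= big1 => [|i ij].
      rewrite addr0 /v /point /shift_diff /= !fctE /= !xpair_eqE eqxx /=.
      by rewrite (can2_eq (@sK j) (@s'K j)).
    rewrite /v /point !fctE !xpair_eqE eq_sym (negbTE ij) /=; exact: subrr.
  have -> : \sum_i (h i (s' i x) - h i x) = phi (\sum_i v i).
    rewrite pv; apply: eq_bigr => i _; rewrite phiD ?phiN //.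
    - exact: point_summable.
    - exact: point_summable.
    - by apply: summableN; exact: point_summable.
  have := phip _ (summableN ssv); rewrite (phiN _ ssv).
  have := gauge_le (summableN ssv) Cx; rewrite l1_point.
  have -> : (fun z => - (\sum_i v i) z + shift_diff (fun y => (y == x)%:R) z) = (fun=> 0).
    by apply/funext => z; rewrite vE addNr.
  have : l1 (fun=> 0 : R) <= 0 :> R.
    move=> T; apply: l1_le => o _; under eq_bigr do rewrite normr0.
    by rewrite big1.
  move=> /(_ (I * X)%type); lra.
(* Rounding [q (h + 1)] to integers loses less than [#|I|] of the gain [q eps]. *)
pose q := (Num.trunc ((#|I|%:R + 1) / eps)).+1.
have q0 : 0 < q%:R :> R by rewrite ltr0n.
have qeps : #|I|%:R + 1 < q%:R * eps.
  by rewrite -ltr_pdivrMr //; apply: truncnS_gt.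
pose k i x := Num.trunc (q%:R * (h i x + 1)).
have kP i x : (k i x)%:R <= q%:R * (h i x + 1) < (k i x).+1%:R.
  apply: truncn_itv; apply: mulr_ge0; first exact: ltW.
  by have := h_le i x; lra.
apply: muD; apply: (@no_increase _ _ mu mu_ge0 muU I s' D (2 * q).+1 k) => //.
  move=> i x; rewrite ltnS -(ler_nat R) natrM.
  have /andP[le1 _] := kP i x; apply: (le_trans le1).
  have /andP[_ h1] := h_le i x; rewrite mulrC ler_pM2r //; lra.
move=> x Dx; rewrite -(ltr_nat R) !natr_sum.
have : \sum_i (q%:R * (h i x + 1)) + (#|I|%:R + 1) <= \sum_i (q%:R * (h i (s' i x) + 1)).
  rewrite -lerBrDl -sumrB.
  under eq_bigr do rewrite -mulrBr opprD addrACA subrr addr0.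
  rewrite -mulr_sumr; apply: le_trans (ltW qeps) _.
  by rewrite ler_pM2l // h_gap.
have : \sum_i (k i x)%:R <= \sum_i (q%:R * (h i x + 1)) :> R.
  by apply: ler_sum => i _; have /andP[] := kP i x.
have : \sum_i (q%:R * (h i (s' i x) + 1)) <= \sum_i (k i (s' i x))%:R + #|I|%:R :> R.
  rewrite -[X in _ + X%:R]sum1_card natr_sum -big_split /=.
  by apply: ler_sum => i _; have /andP[_ /ltW] := kP i (s' i x); rewrite -natr1.
lra.
Qed.

End AlmostInvariant.

(** If no finitely supported density is almost invariant, separating the
    differences [f \o s i - f] from [0] in l1 yields bounded functions whose
    total increases everywhere under the maps; no invariant mean allows it. *)
Lemma almost_invariant_density (R : realType) (X : choiceType) (I : finType)
    (s s' : I -> X -> X) (D : set X) (mu : set X -> R) (eps : R) :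
  (forall i, cancel (s i) (s' i)) -> (forall i, cancel (s' i) (s i)) ->
  (forall i x, D x -> D (s' i x)) ->
  (forall A, 0 <= mu A) ->
  (forall A B, A `&` B = set0 -> mu (A `|` B) = mu A + mu B) ->
  (forall i A, A `<=` D -> mu (D `&` [set x | A (s' i x)]) = mu A) ->
  mu D <> 0 -> 0 < eps ->
  exists f om, [/\ uniq om, forall x, x \in om -> D x,
    (forall x, 0 <= f x) /\ (forall x, x \notin om -> f x = 0),
    \sum_(x <- om) f x = 1 &
    forall i om', uniq om' -> \sum_(x <- om') `|f (s i x) - f x| <= eps].
Proof.
move=> sK s'K s'D mu0 muU s'mu muD eps0; apply: contrapT => nex.
apply: (no_reiter_contra sK s'K s'D mu0 muU s'mu muD eps0) => f om u1 dom f0 f1 sf.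
apply: contrapT => ni; apply: nex; exists f, om; split=> // i om' uom'.
by rewrite leNgt; apply/negP => lt1; apply: ni; exists i, om'.
Qed.

(** * Characters of Z / N *)

Section DiscreteTrig.
Variables (R : realType) (N' : nat).
Local Notation N := N'.+1.
Implicit Types (s t z q : int) (k : nat).

Definition cosn t : R := cos (t%:~R * (pi *+ 2 / N%:R)).
Definition sinn t : R := sin (t%:~R * (pi *+ 2 / N%:R)).

Lemma cosnD s t : cosn (s + t) = cosn s * cosn t - sinn s * sinn t.
Proof. by rewrite /cosn rmorphD mulrDl cosD. Qed.

Lemma sinnD s t : sinn (s + t) = sinn s * cosn t + cosn s * sinn t.
Proof. by rewrite /sinn rmorphD mulrDl sinD. Qed.

Lemma cosnN t : cosn (- t) = cosn t.
Proof. by rewrite /cosn rmorphN mulNr cosN. Qed.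

Lemma sinnN t : sinn (- t) = - sinn t.
Proof. by rewrite /sinn rmorphN mulNr sinN. Qed.

Lemma cosn0 : cosn 0 = 1.
Proof. by rewrite /cosn mul0r cos0. Qed.

Lemma sinn0 : sinn 0 = 0.
Proof. by rewrite /sinn mul0r sin0. Qed.

Lemma cosnB s t : cosn (s - t) = cosn s * cosn t + sinn s * sinn t.
Proof. by rewrite cosnD cosnN sinnN mulrN opprK. Qed.

Lemma cosn2Dsinn2 t : cosn t ^+ 2 + sinn t ^+ 2 = 1.
Proof. exact: cos2Dsin2. Qed.

Lemma cosn_period q : cosn (N%:Z * q) = 1 /\ sinn (N%:Z * q) = 0.
Proof.
have cN : cosn N = 1 /\ sinn N = 0.
  rewrite /cosn /sinn mulrCA mulfV ?mulr1 ?cos2pi ?sin2pi //.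
  by rewrite -[N%:~R]/(N%:R) pnatr_eq0.
have H k : cosn (N%:Z * k%:Z) = 1 /\ sinn (N%:Z * k%:Z) = 0.
  elim: k => [|k [cI sI]]; first by rewrite mulr0 cosn0 sinn0.
  rewrite (_ : k.+1%:Z = k%:Z + 1) ?mulrDr ?mulr1; last by rewrite -addn1 PoszD.
  rewrite cosnD sinnD cI sI; case: cN => -> ->.
  by rewrite !mulr0 mulr1 subr0 mul0r addr0.
case: q => k; first exact: H.
rewrite NegzE mulrN cosnN sinnN; have [-> ->] := H k.+1.
by rewrite oppr0.
Qed.

Lemma cosn_shift t q : cosn (t + N%:Z * q) = cosn t.
Proof. by have [c s] := cosn_period q; rewrite cosnD c s mulr1 mulr0 subr0. Qed.

Lemma sinn_shift t q : sinn (t + N%:Z * q) = sinn t.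
Proof. by have [c s] := cosn_period q; rewrite sinnD c s mulr1 mulr0 addr0. Qed.

Lemma cosn_modn k z t : cosn ((k %% N)%N%:Z * z + t) = cosn (k%:Z * z + t).
Proof.
rewrite [in RHS](divn_eq k N) PoszD PoszM.
rewrite -[RHS](cosn_shift _ (- ((k %/ N)%N%:Z * z))); congr cosn; ring.
Qed.

Lemma cosn_lt1 z : (0 < `|z| < N)%N -> cosn z < 1.
Proof.
wlog : z / 0 <= z.
  move=> H; have [|z0] := lerP 0 z; first exact: H.
  by rewrite -cosnN -abszN; apply: H; rewrite oppr_ge0 ltW.
case: z => // k _; rewrite absz_nat => /andP[k0 kN].
have N0 : 0 < N%:R :> R by rewrite ltr0n.
pose x : R := k%:R * (pi / N%:R).
have xpi : 0 < x < pi.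
  rewrite mulr_gt0 ?ltr0n ?divr_gt0 ?pi_gt0 //= /x mulrCA gtr_pMr ?pi_gt0 //.
  by rewrite ltr_pdivrMr // mul1r ltr_nat.
have -> : cosn k = cos (x *+ 2).
  by rewrite /cosn /x -[k%:~R]/(k%:R); congr cos; ring.
rewrite cos_mulr2n cos2sin2; have := sin_gt0_pi xpi => sx.
by have := mulr_gt0 sx sx; rewrite -expr2 => ?; lra.
Qed.

Lemma sum_ord_shift (F : nat -> R) : (forall k, F (k %% N)%N = F k) ->
  \sum_(k < N) F k.+1 = \sum_(k < N) F k.
Proof.
move=> FN; rewrite [RHS](reindex_inj (@addIr _ (inZp 1 : 'I_N))) /=; apply: eq_bigr => k _.
by rewrite modnDmr FN addn1.
Qed.

(** Shifting the summation index rotates the vector of the two sums by a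
    nontrivial angle. *)
Lemma sum_cosn z : (0 < `|z| < N)%N ->
  \sum_(k < N) cosn (k%:Z * z) = 0 /\ \sum_(k < N) sinn (k%:Z * z) = 0.
Proof.
move=> zN; have c1 := cosn_lt1 zN.
have modc k : cosn ((k %% N)%N%:Z * z) = cosn (k%:Z * z).
  by have := cosn_modn k z 0; rewrite !addr0.
have mods k : sinn ((k %% N)%N%:Z * z) = sinn (k%:Z * z).
  rewrite [in RHS](divn_eq k N) PoszD PoszM.
  rewrite -[RHS](sinn_shift _ (- ((k %/ N)%N%:Z * z))); congr sinn; ring.
pose Fc k := cosn (k%:Z * z); pose Fs k := sinn (k%:Z * z).
have stepE (k : nat) : k.+1%:Z * z = k%:Z * z + z.
  by rewrite -addn1 PoszD mulrDl mul1r.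
have Ec k : Fc k.+1 = Fc k * cosn z - Fs k * sinn z by rewrite /Fc stepE cosnD.
have Es k : Fs k.+1 = Fs k * cosn z + Fc k * sinn z by rewrite /Fs stepE sinnD.
have := sum_ord_shift (F := Fs) mods; have := sum_ord_shift (F := Fc) modc.
rewrite -/Fc -/Fs; set C := \sum_(k < N) Fc k; set S := \sum_(k < N) Fs k.
under eq_bigr do rewrite Ec.
rewrite sumrB -!mulr_suml -/C -/S => EC.
under eq_bigr do rewrite Es.
rewrite big_split /= -!mulr_suml -/C -/S => ES.
set c := cosn z in EC ES c1; set s := sinn z in EC ES.
have pos : 0 < (1 - c) ^+ 2 + s ^+ 2.
  by rewrite ltr_wpDr ?sqr_ge0 // exprn_gt0 // subr_gt0.
have C0 : C * ((1 - c) ^+ 2 + s ^+ 2) = 0.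
  rewrite (_ : _ * _ = (1 - c) * (C - (C * c - S * s)) - s * (S - (S * c + C * s)));
    by [rewrite EC ES !subrr !mulr0 subr0 | ring].
have S0 : S * ((1 - c) ^+ 2 + s ^+ 2) = 0.
  rewrite (_ : _ * _ = (1 - c) * (S - (S * c + C * s)) + s * (C - (C * c - S * s)));
    by [rewrite EC ES !subrr !mulr0 addr0 | ring].
move: C0 S0 => /eqP + /eqP; rewrite !mulf_eq0 (gt_eqF pos) !orbF.
by move=> /eqP C0 /eqP S0; split.
Qed.

Lemma cosn_quarter k : (N < 4 * k)%N -> (2 * k <= N)%N -> cosn k <= 0.
Proof.
move=> k4 k2; have N0 : 0 < N%:R :> R by rewrite ltr0n.
pose y : R := pi - k%:R * (pi *+ 2 / N%:R).
have -> : cosn k = - cos y.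
  by rewrite /cosn -[k%:~R]/(k%:R) /y cosB cospi sinpi; ring.
rewrite oppr_le0; apply: cos_ge0_pihalf.
pose w : R := k%:R / N%:R.
have yE : y = pi * (1 - 2 * w) by rewrite /y /w; ring.
have p0 := pi_gt0 R.
have kN2 : 2 * w <= 1.
  by rewrite mulrA ler_pdivrMr // mul1r -natrM ler_nat.
have kN4 : 1 < 4 * w.
  by rewrite mulrA ltr_pdivlMr // mul1r -natrM ltr_nat.
have y0 : 0 <= pi * (1 - 2 * w).
  by rewrite mulr_ge0 ?subr_ge0 // ltW.
rewrite yE; apply/andP; split; first by apply: le_trans y0; lra.
by rewrite ler_pM2l //; lra.
Qed.

End DiscreteTrig.

(** * Spectral measure of a finitely supported function on a free Z^2-set *)

Section Energy.
Variables (R : realType) (N' : nat) (X : choiceType).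
Local Notation N := N'.+1.
Local Notation cosn := (@cosn R N').
Local Notation sinn := (@sinn R N').
Local Notation dual := ('I_N * 'I_N)%type.
(* The orbit representative of a point, and the translation leading from it to
   the point. *)
Variables (rep : X -> X) (c1 c2 : X -> int).
Variables (om : seq X) (uom : uniq om).
Implicit Types (k : dual) (x y u v r : X) (f g : X -> R).

Definition phase k x : int := (k.1 : nat)%:Z * c1 x + (k.2 : nat)%:Z * c2 x.

Definition cos_coef k r f := \sum_(x <- om) (rep x == r)%:R * f x * cosn (phase k x).
Definition sin_coef k r f := \sum_(x <- om) (rep x == r)%:R * f x * sinn (phase k x).

Definition energy k f :=
  \sum_(r <- undup (map rep om)) (cos_coef k r f ^+ 2 + sin_coef k r f ^+ 2).

Definition kernel k x y := (rep x == rep y)%:R * cosn (phase k x - phase k y).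

Lemma energyE k f :
  energy k f = \sum_(x <- om) \sum_(y <- om) f x * f y * kernel k x y.
Proof.
rewrite /energy /cos_coef /sin_coef.
under eq_bigr do rewrite !expr2 !mulr_suml -big_split /=.
rewrite exchange_big /=; apply: eq_big_seq => x xom.
under eq_bigr do rewrite !mulr_sumr -big_split /=.
rewrite exchange_big /=; apply: eq_bigr => y _.
rewrite (bigD1_seq (rep x)) ?undup_uniq ?mem_undup ?map_f //= eqxx.
rewrite [X in _ + X]big1 ?addr0 => [|r /negbTE rx].
  by rewrite /kernel cosnB (eq_sym (rep y)) !mulr1n; ring.
by rewrite eq_sym rx !mul0r addr0.
Qed.

Lemma energy_ge0 k f : 0 <= energy k f.
Proof. by apply: sumr_ge0 => r _; rewrite addr_ge0 ?sqr_ge0. Qed.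

Lemma cos_coefD k r f g : cos_coef k r (fun x => f x + g x) =
  cos_coef k r f + cos_coef k r g.
Proof. by rewrite /cos_coef -big_split; apply: eq_bigr => x _ /=; ring. Qed.

Lemma cos_coefB k r f g : cos_coef k r (fun x => f x - g x) =
  cos_coef k r f - cos_coef k r g.
Proof. by rewrite /cos_coef -sumrB; apply: eq_bigr => x _ /=; ring. Qed.

Lemma sin_coefD k r f g : sin_coef k r (fun x => f x + g x) =
  sin_coef k r f + sin_coef k r g.
Proof. by rewrite /sin_coef -big_split; apply: eq_bigr => x _ /=; ring. Qed.

Lemma sin_coefB k r f g : sin_coef k r (fun x => f x - g x) =
  sin_coef k r f - sin_coef k r g.
Proof. by rewrite /sin_coef -sumrB; apply: eq_bigr => x _ /=; ring. Qed.

(** A difference of squares, estimated with a free weight [l] so that a small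
    [g - f] can be played against a bounded [g + f]. *)
Lemma energy_diff k f g (l : R) : 0 < l ->
  energy k g - energy k f <=
  (l * energy k (fun x => g x - f x) + l^-1 * energy k (fun x => g x + f x)) / 2.
Proof.
move=> l0; rewrite /energy -sumrB !mulr_sumr -big_split /= mulr_suml.
apply: ler_sum => r _; rewrite cos_coefB cos_coefD sin_coefB sin_coefD.
have amgm (a b : R) : (a - b) * (a + b) <= (l * (a - b) ^+ 2 + l^-1 * (a + b) ^+ 2) / 2.
  have : 0 <= l^-1 * (l * (a - b) - (a + b)) ^+ 2.
    by rewrite mulr_ge0 ?sqr_ge0 // invr_ge0 ltW.
  have -> : l^-1 * (l * (a - b) - (a + b)) ^+ 2 =
      l * (a - b) ^+ 2 + l^-1 * (a + b) ^+ 2 - 2 * ((a - b) * (a + b)).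
    by field; rewrite gt_eqF.
  lra.
have := amgm (cos_coef k r g) (cos_coef k r f).
have := amgm (sin_coef k r g) (sin_coef k r f).
rewrite -!subr_sqr; lra.
Qed.

(** The points of [om] in one orbit have to be distinguished by the characters
    of (Z/N)^2. *)
Hypothesis sep : forall x y, x \in om -> y \in om -> rep x = rep y ->
  [/\ (`|c1 x - c1 y| < N)%N, (`|c2 x - c2 y| < N)%N &
      c1 x = c1 y -> c2 x = c2 y -> x = y].

Lemma sum_phase (z1 z2 : int) : (`|z1| < N)%N -> (`|z2| < N)%N ->
  \sum_(k : dual) cosn ((k.1 : nat)%:Z * z1 + (k.2 : nat)%:Z * z2) =
  ((z1 == 0) && (z2 == 0))%:R * N%:R ^+ 2.
Proof.
move=> b1 b2.
have sums z : (`|z| < N)%N -> \sum_(k < N) cosn (k%:Z * z) = (z == 0)%:R * N%:R /\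
    \sum_(k < N) sinn (k%:Z * z) = 0.
  move=> zN; case: (eqVneq z 0) => [->|z0].
    split; first by under eq_bigr do rewrite mulr0 cosn0;
      rewrite sumr_const card_ord mul1r.
    by rewrite big1 // => k _; rewrite mulr0 sinn0.
  by rewrite mul0r; apply: sum_cosn; rewrite zN absz_gt0 z0.
have [C1 S1] := sums z1 b1; have [C2 S2] := sums z2 b2.
transitivity (\sum_(k1 < N) \sum_(k2 < N) cosn (k1%:Z * z1 + k2%:Z * z2)).
  by rewrite pair_big.
under eq_bigr => k1 _ do under eq_bigr => k2 _ do rewrite cosnD.
under eq_bigr => k1 _ do rewrite sumrB -!mulr_sumr C2 S2 mulr0 subr0.
by rewrite -mulr_suml C1 -mulnb natrM; ring.
Qed.

(** Plancherel's formula. *)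
Lemma energy_total f :
  \sum_(k : dual) energy k f = N%:R ^+ 2 * \sum_(x <- om) f x ^+ 2.
Proof.
under eq_bigr do rewrite energyE.
rewrite exchange_big /= mulr_sumr; apply: eq_big_seq => x xom.
rewrite exchange_big /= (bigD1_seq x) //= [X in _ + X]big1_seq ?addr0; last first.
  move=> y /andP[yx yom]; rewrite -mulr_sumr.
  suff -> : \sum_k kernel k x y = 0 by rewrite mulr0.
  rewrite /kernel; case: (eqVneq (rep x) (rep y)) => [E|_]; last first.
    by rewrite big1 // => k _; rewrite mul0r.
  have [b1 b2 cE] := sep xom yom E.
  under eq_bigr do rewrite mul1r /phase opprD addrACA -!mulrBr.
  rewrite sum_phase // !subr_eq0; case: eqP => [E1|_]; last by rewrite mul0r.
  case: eqP => [E2|_]; last by rewrite mul0r.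
  by move: yx; rewrite (cE E1 E2) eqxx.
rewrite -mulr_sumr (_ : \sum_k kernel k x x = N%:R ^+ 2); first by ring.
rewrite /kernel eqxx; under eq_bigr do rewrite subrr cosn0 mul1r.
by rewrite sumr_const card_prod card_ord -natrX mulnn.
Qed.

Variables (s : seq X) (us : uniq s) (s_om : {subset s <= om}).
Variables (f : X -> R) (f_supp : forall x, x \notin s -> f x = 0).

Lemma sum_transport (m m' : X -> X) (F : X -> R) : cancel m m' -> cancel m' m ->
  {subset map m' s <= om} -> (forall x, x \notin s -> F x = 0) ->
  \sum_(x <- om) F (m x) = \sum_(x <- om) F x.
Proof.
move=> mK m'K sub F0.
have um : uniq (map m' s) by rewrite map_inj_uniq //; apply: can_inj m'K.
have Fm0 x : x \notin map m' s -> F (m x) = 0.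
  move=> nx; apply: F0; apply: contra nx => mx.
  by rewrite -[x]mK; apply: map_f.
rewrite [RHS](sum_support us uom s_om F0) (sum_support um uom sub Fm0).
by rewrite big_map; apply: eq_bigr => x _; rewrite m'K.
Qed.

Lemma energy_transport (m m' : X -> X) k k' : cancel m m' -> cancel m' m ->
  {subset map m' s <= om} ->
  (forall x y, x \in om -> y \in om -> kernel k' x y = kernel k (m x) (m y)) ->
  energy k' (f \o m) = energy k f.
Proof.
move=> mK m'K sub kE; rewrite !energyE.
rewrite (eq_big_seq (fun x => \sum_(y <- om) f (m x) * f y * kernel k (m x) y)).
  apply: (sum_transport (F := fun x => \sum_(y <- om) f x * f y * kernel k x y)
    mK m'K sub) => x xs.
  by rewrite big1 // => y _; rewrite f_supp // !mul0r.
move=> x xom; rewrite -(sum_transport (F := fun y => f (m x) * f y * kernel k (m x) y)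
  mK m'K sub) => [|y ys]; last by rewrite (f_supp ys) mulr0 mul0r.
by apply: eq_big_seq => y yom; rewrite kE.
Qed.

(** On the Fourier side translation is multiplication by a character. *)
Lemma energy_translate (t t' : X -> X) (z1 z2 : int) k : cancel t t' -> cancel t' t ->
  {subset map t' s <= om} -> (forall x, x \in om ->
    [/\ rep (t x) = rep x, c1 (t x) = c1 x + z1 & c2 (t x) = c2 x + z2]) ->
  energy k (fun x => f (t x) - f x) =
  (2 - 2 * cosn ((k.1 : nat)%:Z * z1 + (k.2 : nat)%:Z * z2)) * energy k f.
Proof.
move=> tK t'K sub tE; set p := (k.1 : nat)%:Z * z1 + _.
have phE x : x \in om -> phase k x = phase k (t x) - p.
  by move=> /tE[_ e1 e2]; rewrite /phase /p e1 e2; ring.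
have Ct r : cos_coef k r (f \o t) = cosn p * cos_coef k r f + sinn p * sin_coef k r f.
  rewrite /cos_coef /sin_coef !mulr_sumr -big_split /=.
  pose F y := (rep y == r)%:R * f y * cosn (phase k y - p).
  rewrite (eq_big_seq (F \o t)); last first.
    by move=> x xom /=; have [e _ _] := tE x xom; rewrite /F e phE.
  rewrite (sum_transport (F := F) tK t'K sub); last first.
    by move=> x xs; rewrite /F f_supp // mulr0 mul0r.
  by apply: eq_bigr => x _; rewrite /F cosnB; ring.
have St r : sin_coef k r (f \o t) = cosn p * sin_coef k r f - sinn p * cos_coef k r f.
  rewrite /cos_coef /sin_coef !mulr_sumr -sumrB /=.
  pose F y := (rep y == r)%:R * f y * sinn (phase k y - p).
  rewrite (eq_big_seq (F \o t)); last first.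
    by move=> x xom /=; have [e _ _] := tE x xom; rewrite /F e phE.
  rewrite (sum_transport (F := F) tK t'K sub); last first.
    by move=> x xs; rewrite /F f_supp // mulr0 mul0r.
  by apply: eq_bigr => x _; rewrite /F sinnD cosnN sinnN; ring.
rewrite /energy mulr_sumr; apply: eq_bigr => r _.
rewrite cos_coefB sin_coefB -/(f \o t) Ct St.
have := cosn2Dsinn2 R N' p.
set c := cosn p; set q := sinn p; set a := cos_coef _ _ _; set b := sin_coef _ _ _.
move=> cq.
transitivity ((a ^+ 2 + b ^+ 2) * (c ^+ 2 + q ^+ 2 + 1 - 2 * c)); first by ring.
by rewrite cq; ring.
Qed.

End Energy.

(** * Ping-pong on the dual plane *)

Lemma odd_doubleP m : odd m -> exists h, m = (1 + h * 2)%N.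
Proof.
by move=> om; exists m./2; have := odd_double_half m; rewrite om -muln2 => ->.
Qed.

Lemma opposite_side m l : odd m -> (l < m)%N -> l != 0%N ->
  [/\ (2 * l < m)%N = ~~ (m < 2 * l)%N,
      (2 * (m - l) < m)%N = (m < 2 * l)%N,
      (m < 2 * (m - l))%N = ~~ (m < 2 * l)%N,
      (0 < l)%N & (0 < m - l)%N /\ (m - l == 0)%N = false].
Proof. by move=> /odd_doubleP[h ->] lm l0; do !split; lia. Qed.

Lemma near_half m i j : odd m -> (4 * i <= m)%N -> (4 * j <= m)%N ->
  [/\ (i + j < m)%N, (2 * (i + j) < m)%N, (2 * i < m)%N & (2 * j < m)%N].
Proof. by move=> /odd_doubleP[h ->] im jm; split; lia. Qed.

Lemma half_not_near m i j : (2 * i < m)%N -> (0 < j)%N -> (2 * j < m)%N ->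
  ~~ [&& (4 * i <= m)%N, (0 < j)%N & (4 * j <= m)%N] ->
  (m < 4 * i)%N || (m < 4 * j)%N.
Proof. by move=> *; lia. Qed.

Lemma cover_le (R : realDomainType) (e : R) (b b1 b2 b3 b4 : bool) : 0 <= e ->
  (b -> [|| b1, b2, b3 | b4]) ->
  (if b then e else 0) <= (if b1 then e else 0) + (if b2 then e else 0) +
    (if b3 then e else 0) + (if b4 then e else 0).
Proof.
move=> e0; case: b => [/(_ isT)|_].
  by case: b1; case: b2; case: b3; case: b4 => //= _; lra.
by rewrite !addr_ge0 //; case: ifP.
Qed.

Section FreePlane.
Variables (R : realType) (X : choiceType) (D : set X) (T : int -> int -> X -> X).
Hypothesis T0 : forall x, T 0 0 x = x.
Hypothesis TD : forall z1 z2 w1 w2 x, T (z1 + w1) (z2 + w2) x = T z1 z2 (T w1 w2 x).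
Hypothesis DT : forall z1 z2 x, D x -> D (T z1 z2 x).
Hypothesis Tfree : forall z1 z2 x, D x -> T z1 z2 x = x -> z1 = 0 /\ z2 = 0.

Lemma plane_inj z1 z2 w1 w2 x : D x -> T z1 z2 x = T w1 w2 x -> z1 = w1 /\ z2 = w2.
Proof.
move=> Dx /(congr1 (T (- w1) (- w2))); rewrite -!TD !addNr T0.
rewrite ![- _ + _]addrC => /(Tfree Dx)[e1 e2].
by split; apply/eqP; rewrite -subr_eq0; apply/eqP.
Qed.

Lemma plane_coordinates : exists rep c1 c2,
  (forall x, x = T (c1 x) (c2 x) (rep x)) /\
  (forall z1 z2 x, rep (T z1 z2 x) = rep x).
Proof.
pose P x : pred X := fun y => `[< exists z : int * int, T z.1 z.2 y = x >].
have Pxx x : P x x by apply/asboolP; exists (0, 0); rewrite T0.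
pose rep x := choose (P x) x.
have repP x : exists z : int * int, T z.1 z.2 (rep x) = x.
  by apply/asboolP; apply: (chooseP (Pxx x)).
have [c cP] := choice repP.
exists rep, (fun x => (c x).1), (fun x => (c x).2); split=> [x|z1 z2 x].
  by rewrite cP.
have E : P (T z1 z2 x) =1 P x.
  move=> y; apply/asbool_equiv_eq; split=> -[z zE].
    exists (z.1 - z1, z.2 - z2) => /=.
    by rewrite ![_ - _]addrC TD zE -TD !addNr T0.
  by exists (z1 + z.1, z2 + z.2); rewrite TD zE.
rewrite /rep (eq_choose E); apply: choose_id => //.
by rewrite -E.
Qed.

Variables (rep : X -> X) (c1 c2 : X -> int).
Hypothesis repE : forall x, x = T (c1 x) (c2 x) (rep x).
Hypothesis repT : forall z1 z2 x, rep (T z1 z2 x) = rep x.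

Lemma rep_in x : D x -> D (rep x).
Proof.
move=> Dx; have := DT (- c1 x) (- c2 x) Dx.
by rewrite {3}[x]repE -TD !addNr T0.
Qed.

Lemma coordT z1 z2 x : D x ->
  c1 (T z1 z2 x) = c1 x + z1 /\ c2 (T z1 z2 x) = c2 x + z2.
Proof.
move=> Dx; apply: (plane_inj (rep_in Dx)).
by rewrite -{1}(repT z1 z2) -repE {1}[x]repE -TD ![_ + c1 _]addrC ![_ + c2 _]addrC.
Qed.

Lemma rep_eqP x y : rep x = rep y -> x = T (c1 x - c1 y) (c2 x - c2 y) y.
Proof.
move=> E; rewrite {3}[y]repE -TD !subrK -E; exact: repE.
Qed.

Variables (N' : nat).
Local Notation N := N'.+1.
Local Notation dual := ('I_N * 'I_N)%type.
Local Notation cosn := (@cosn R N').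
Local Notation ker := (@kernel R N' X rep c1 c2).

Lemma phaseB (k : dual) x y : phase c1 c2 k x - phase c1 c2 k y =
  (k.1 : nat)%:Z * (c1 x - c1 y) + (k.2 : nat)%:Z * (c2 x - c2 y).
Proof. by rewrite /phase !mulrBr opprD addrACA. Qed.

(** A map intertwining the plane with a linear map [g] of the plane acts on the
    dual by the transpose of [g]. *)
Lemma kernel_equivariant (m m' : X -> X) (g1 g2 h1 h2 : int -> int -> int)
    (k k' : dual) :
  cancel m m' -> cancel m' m -> (forall x, D x -> D (m x)) ->
  (forall z1 z2 x, m (T z1 z2 x) = T (g1 z1 z2) (g2 z1 z2) (m x)) ->
  (forall z1 z2, g1 (h1 z1 z2) (h2 z1 z2) = z1 /\ g2 (h1 z1 z2) (h2 z1 z2) = z2) ->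
  (forall z1 z2, cosn ((k'.1 : nat)%:Z * z1 + (k'.2 : nat)%:Z * z2) =
     cosn ((k.1 : nat)%:Z * g1 z1 z2 + (k.2 : nat)%:Z * g2 z1 z2)) ->
  forall x y, D x -> D y -> ker k' x y = ker k (m x) (m y).
Proof.
move=> mK m'K mD mT gh kk' x y Dx Dy.
have m'T z1 z2 u : m' (T z1 z2 u) = T (h1 z1 z2) (h2 z1 z2) (m' u).
  by apply: (can_inj mK); rewrite m'K mT m'K; have [-> ->] := gh z1 z2.
have repm : (rep (m x) == rep (m y)) = (rep x == rep y).
  apply/eqP/eqP => [/rep_eqP/(congr1 m')|/rep_eqP/(congr1 m)].
    by rewrite mK m'T mK => ->; rewrite repT.
  by rewrite mT => ->; rewrite repT.
rewrite /kernel repm; case: eqP => [E|_]; last by rewrite !mul0r.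
rewrite !phaseB kk'; congr (_ * cosn _).
have := rep_eqP E; set d1 := c1 x - c1 y; set d2 := c2 x - c2 y => /(congr1 m).
rewrite mT => mE; have [e1 e2] := coordT (g1 d1 d2) (g2 d1 d2) (mD y Dy).
by rewrite mE e1 e2 [c1 _ + _]addrC addrK [c2 _ + _]addrC addrK.
Qed.


Section SpectralContradiction.
Hypothesis N_odd : odd N.
Variables (om : seq X) (uom : uniq om) (omD : forall x, x \in om -> D x).
Hypothesis bounds : forall x y, x \in om -> y \in om ->
  (`|c1 x - c1 y| < N)%N /\ (`|c2 x - c2 y| < N)%N.
Hypothesis N_large : 10 * (size om)%:R <= N%:R ^+ 2 :> R.
Variables (s : seq X) (us : uniq s) (s_om : {subset s <= om}).
Variables (xi : X -> R) (xi_supp : forall x, x \notin s -> xi x = 0).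
Hypothesis xi1 : \sum_(x <- om) xi x ^+ 2 = 1.

Definition nearly_fixed (m : X -> X) :=
  \sum_(x <- om) (xi (m x) - xi x) ^+ 2 <= 5000^-1.

Local Notation energy := (@energy R N' X rep c1 c2 om).
Local Notation NN := (N%:R ^+ 2 : R).

Lemma sep_om x y : x \in om -> y \in om -> rep x = rep y ->
  [/\ (`|c1 x - c1 y| < N)%N, (`|c2 x - c2 y| < N)%N &
      c1 x = c1 y -> c2 x = c2 y -> x = y].
Proof.
move=> xom yom E; have [b1 b2] := bounds xom yom; split=> // e1 e2.
by rewrite [x]repE [y]repE E e1 e2.
Qed.

Let NN_gt0 : 0 < NN. Proof. by rewrite exprn_gt0 // ltr0n. Qed.

Lemma energy_sum_le (P : pred dual) f :
  \sum_(k | P k) energy k f <= NN * \sum_(x <- om) f x ^+ 2.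
Proof.
rewrite -(energy_total uom sep_om) [leRHS](bigID P) /= lerDl.
by apply: sumr_ge0 => k _; apply: energy_ge0.
Qed.

(** Composing [xi] with a map that nearly fixes it adds at most 3% of the total
    to the mass of a set of characters. *)
Lemma mass_transport (m m' : X -> X) (tau : dual -> dual) (P Q : pred dual) :
  cancel m m' -> cancel m' m -> {subset map m' s <= om} -> nearly_fixed m ->
  injective tau ->
  (forall k x y, D x -> D y -> ker (tau k) x y = ker k (m x) (m y)) ->
  (forall k, P k -> Q (tau k)) ->
  \sum_(k | P k) energy k xi <= \sum_(k | Q k) energy k xi + 3 / 100 * NN.
Proof.
move=> mK m'K sub nf tauI kE PQ.
have -> : \sum_(k | P k) energy k xi = \sum_(k | P k) energy (tau k) (xi \o m).
  apply: eq_bigr => k _; apply/esym/(energy_transport uom us s_om xi_supp mK m'K sub).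
  by move=> x y xom yom; apply: kE; apply: omD.
have le1 : \sum_(k | P k) energy (tau k) (xi \o m) <= \sum_(k | Q k) energy k (xi \o m).
  rewrite [leRHS](reindex_inj tauI) /=.
  rewrite [leRHS](bigID P) /= [X in _ <= X + _](eq_bigl P) => [|k].
    by rewrite lerDl; apply: sumr_ge0 => k _; apply: energy_ge0.
  by rewrite andbC; case: (boolP (P k)) => //= /PQ ->.
apply: (le_trans le1); rewrite -lerBlDl -sumrB.
(* With weight [100] the bound is [(100 / 5000 + 4 / 100) / 2 = 3 / 100]. *)
have l0 : 0 < 100 :> R by [].
apply: (@le_trans _ _ (\sum_(k | Q k)
   (100 * energy k (fun x => xi (m x) - xi x) +
    100^-1 * energy k (fun x => xi (m x) + xi x)) / 2)).
  by apply: ler_sum => k _; apply: energy_diff.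
rewrite -mulr_suml big_split /= -!mulr_sumr.
have := energy_sum_le Q (fun x => xi (m x) - xi x).
have := energy_sum_le Q (fun x => xi (m x) + xi x).
set S1 := \sum_(k | Q k) _; set S2 := \sum_(k | Q k) _ => le_p le_m.
have le_p' : \sum_(x <- om) (xi (m x) + xi x) ^+ 2 <= 4.
  have xim : \sum_(x <- om) xi (m x) ^+ 2 = 1.
    rewrite -xi1; apply: (sum_transport (F := fun x => xi x ^+ 2) uom us s_om mK m'K sub).
    by move=> x /xi_supp ->; rewrite expr0n.
  apply: (@le_trans _ _ (\sum_(x <- om) (2 * xi (m x) ^+ 2 + 2 * xi x ^+ 2))).
    by apply: ler_sum => x _; have := sqr_ge0 (xi (m x) - xi x); nra.
  by rewrite big_split /= -!mulr_sumr xim xi1; lra.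
have {le_p} : S1 <= NN * 4 by apply: (le_trans le_p); rewrite ler_pM2l.
have {le_m} : S2 <= NN * 5000^-1 by apply: (le_trans le_m); rewrite ler_pM2l.
lra.
Qed.

(** Translations move [xi] little, so characters far from [1] on a generator of
    the plane carry little mass. *)
Lemma mass_near_axis (t t' : X -> X) (z1 z2 : int) : cancel t t' -> cancel t' t ->
  {subset map t' s <= om} -> nearly_fixed t ->
  (forall x, x \in om ->
    [/\ rep (t x) = rep x, c1 (t x) = c1 x + z1 & c2 (t x) = c2 x + z2]) ->
  \sum_(k : dual) (2 - 2 * cosn ((k.1 : nat)%:Z * z1 + (k.2 : nat)%:Z * z2)) *
    energy k xi <= 5000^-1 * NN.
Proof.
move=> tK t'K sub nf tE.
under eq_bigr do rewrite -(energy_translate uom us s_om xi_supp _ tK t'K sub tE).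
by rewrite (energy_total uom sep_om) mulrC ler_pM2r.
Qed.

(** A bound independent of [N]: the share of the trivial character in the total
    mass tends to [0] as [N] grows. *)
Lemma energy_at0 : energy (0, 0) xi <= (size om)%:R.
Proof.
rewrite energyE; apply: (@le_trans _ _
    (\sum_(x <- om) \sum_(y <- om) (xi x ^+ 2 + xi y ^+ 2) / 2)).
  apply: ler_sum => x _; apply: ler_sum => y _.
  rewrite /kernel phaseB /= !mul0r addr0 cosn0 mulr1.
  have := sqr_ge0 (xi x - xi y); have := sqr_ge0 (xi x + xi y).
  by case: (_ == _); rewrite ?mulr1n ?mulr0n; nra.
have const (c : R) : \sum_(y <- om) c = (size om)%:R * c.
  by rewrite big_const_seq count_predT iter_addr addr0 mulr_natl.
under eq_bigr do rewrite -mulr_suml big_split /= xi1 const.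
by rewrite -mulr_suml big_split /= -mulr_sumr xi1 const; lra.
Qed.

Variables (A A' B B' W W' : X -> X).
Hypotheses (AK : cancel A A') (A'K : cancel A' A) (BK : cancel B B')
  (B'K : cancel B' B) (WK : cancel W W') (W'K : cancel W' W).
Hypotheses (DA : forall x, D x -> D (A x)) (DB : forall x, D x -> D (B x))
  (DW : forall x, D x -> D (W x)).
Hypothesis AT : forall z1 z2 x, A (T z1 z2 x) = T (z1 + z2) z2 (A x).
Hypothesis BT : forall z1 z2 x, B (T z1 z2 x) = T z1 (z1 + z2) (B x).
Hypothesis WT : forall z1 z2 x, W (T z1 z2 x) = T z2 (- z1) (W x).
Hypotheses (subA : {subset map A' s <= om}) (subB : {subset map B' s <= om})
  (subW : {subset map W' s <= om}) (sub1 : {subset map (T (- 1) 0) s <= om})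
  (sub2 : {subset map (T 0 (- 1)) s <= om}).
Hypotheses (nfA : nearly_fixed A) (nfB : nearly_fixed B) (nfW : nearly_fixed W)
  (nf1 : nearly_fixed (T 1 0)) (nf2 : nearly_fixed (T 0 1)).

Definition tauA (k : dual) : dual := (k.1, k.1 + k.2).
Definition tauB (k : dual) : dual := (k.1 + k.2, k.2).
Definition tauW (k : dual) : dual := (- k.2, k.1).

(** The closed-open first quadrant of the dual torus, its part within a quarter
   turn of the trivial character, and the fourth quadrant.  Residues below [N / 2]
    are the nonnegative ones. *)
Definition quad1 (k : dual) := [&& (2 * k.1 < N)%N, (0 < k.2)%N & (2 * k.2 < N)%N].
Definition near1 (k : dual) := [&& (4 * k.1 <= N)%N, (0 < k.2)%N & (4 * k.2 <= N)%N].
Definition quad4 (k : dual) :=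
  [&& (0 < k.1)%N, (2 * k.1 < N)%N & ((k.2 == 0 :> nat) || (N < 2 * k.2)%N)].

Lemma valNmod (i : 'I_N) : (- i : 'I_N) = ((N - i) %% N)%N :> nat.
Proof. by []. Qed.

Lemma cosn_opp (i : 'I_N) (z w : int) :
  cosn ((- i : 'I_N)%:Z * z + w) = cosn (w - i%:Z * z).
Proof.
rewrite valNmod cosn_modn -subzn; last exact: ltnW.
by rewrite -[RHS](cosn_shift _ _ _ z); congr cosn; ring.
Qed.

Lemma kernelA k x y : D x -> D y -> ker (tauA k) x y = ker k (A x) (A y).
Proof.
apply: (kernel_equivariant (h1 := fun z1 z2 => z1 - z2) (h2 := fun z1 z2 => z2)
  AK A'K DA AT) => [z1 z2|z1 z2]; first by rewrite subrK.
rewrite /= addrC cosn_modn PoszD; congr cosn; ring.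
Qed.

Lemma kernelB k x y : D x -> D y -> ker (tauB k) x y = ker k (B x) (B y).
Proof.
apply: (kernel_equivariant (h1 := fun z1 z2 => z1) (h2 := fun z1 z2 => z2 - z1)
  BK B'K DB BT) => [z1 z2|z1 z2]; first by rewrite addrC subrK.
rewrite /= cosn_modn PoszD; congr cosn; ring.
Qed.

Lemma kernelW k x y : D x -> D y -> ker (tauW k) x y = ker k (W x) (W y).
Proof.
apply: (kernel_equivariant (h1 := fun z1 z2 => - z2) (h2 := fun z1 z2 => z1)
  WK W'K DW WT) => [z1 z2|z1 z2]; first by rewrite opprK.
by rewrite /= cosn_opp; congr cosn; ring.
Qed.

Lemma energy_opp k f : energy (- k.1, - k.2) f = energy k f.
Proof.
rewrite !energyE; apply: eq_bigr => x _; apply: eq_bigr => y _.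
congr (_ * (_ * _)); rewrite !phaseB /= !cosn_opp -cosnN.
by congr cosn; ring.
Qed.

Lemma quad_cover k : k <> (0, 0) ->
  [|| quad1 k, quad4 k, quad1 (- k.1, - k.2) | quad4 (- k.1, - k.2)].
Proof.
case: k => i j; rewrite /quad1 /quad4 /= => nz.
have ij : (i != 0 :> nat) || (j != 0 :> nat).
  apply/negPn; rewrite negb_or !negbK; apply/negP => /andP[/eqP i0 /eqP j0].
  by apply: nz; congr pair; apply/val_inj.
have iN := ltn_ord i; have jN := ltn_ord j.
have modE (l : 'I_N) : ((N - l) %% N)%N = if (l : nat) == 0%N then 0%N else (N - l)%N.
  case: eqP => [->|/eqP l0]; first by rewrite subn0 modnn.
  by rewrite modn_small // ltn_subrL lt0n l0.
have cl l := @opposite_side N l N_odd.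
rewrite !modE; case: (eqVneq (i : nat) 0%N) ij => [->|i0] /= ij.
  rewrite (negbTE ij); have [e1 e2 e3 e4 [e5 e6]] := cl j jN ij.
  rewrite ?muln0 ?e1 ?e2 ?e3 ?e4 ?e5 ?e6 /=.
  by case: (N < 2 * j)%N.
have [e1 e2 e3 e4 [e5 e6]] := cl i iN i0.
rewrite ?e1 ?e2 ?e3 ?e4 ?e5 ?e6.
case: (eqVneq (j : nat) 0%N) => [->|j0] /=.
  by rewrite ?muln0 /=; case: (N < 2 * i)%N.
have [f1 f2 f3 f4 [f5 f6]] := cl j jN j0.
rewrite ?f1 ?f2 ?f3 ?f4 ?f5 ?f6 ?(negbTE j0) /=.
by case: (N < 2 * i)%N; case: (N < 2 * j)%N.
Qed.

(** Ping-pong on the dual plane: the unipotents map the first quadrant into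
    disjoint parts of itself, so it has almost no mass; rotating it by quarter
    turns covers everything but the trivial character. *)
Lemma spectral_contradiction : False.
Proof.
have tauA_inj : injective tauA.
  move=> [i j] [i' j'] [ii]; rewrite {}ii => e.
  by congr pair; apply: (addrI i'); apply/val_inj.
have tauB_inj : injective tauB.
  move=> [i j] [i' j'] [+ jj]; rewrite {}jj => e.
  by congr pair; apply: (addIr j'); apply/val_inj.
have tauW_inj : injective tauW.
  apply: (can_inj (g := fun k : dual => (k.2, - k.1))) => -[i j].
  by congr pair; apply: opprK.
pose low (k : dual) := (k.1 < k.2)%N.
have mA := @mass_transport A A' tauA near1 (fun k => quad1 k && low k)
  AK A'K subA nfA tauA_inj kernelA.
have mB := @mass_transport B B' tauB near1 (fun k => quad1 k && ~~ low k)
  BK B'K subB nfB tauB_inj kernelB.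
have mW := @mass_transport W W' tauW quad4 quad1 WK W'K subW nfW tauW_inj kernelW.
have {}mA : \sum_(k | near1 k) energy k xi <=
    \sum_(k | quad1 k && low k) energy k xi + 3 / 100 * NN.
  apply: mA => -[i j] /and3P[/= i4 j0 j4]; rewrite /quad1 /low /=.
  have [ij ij2 i2 j2] := near_half N_odd i4 j4.
  by rewrite modn_small // i2 ij2 addn_gt0 j0 orbT /= -{1}[i : nat]addn0 ltn_add2l j0.
have {}mB : \sum_(k | near1 k) energy k xi <=
    \sum_(k | quad1 k && ~~ low k) energy k xi + 3 / 100 * NN.
  apply: mB => -[i j] /and3P[/= i4 j0 j4]; rewrite /quad1 /low /=.
  have [ij ij2 i2 j2] := near_half N_odd i4 j4.
  by rewrite modn_small // ij2 j0 j2 /= -leqNgt leq_addl.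
have {}mW : \sum_(k | quad4 k) energy k xi <=
    \sum_(k | quad1 k) energy k xi + 3 / 100 * NN.
  apply: mW => -[i j] /and3P[/= i0 i2 j4]; rewrite /quad1 /=.
  have [j0|j0] := eqVneq (j : nat) 0%N; first by rewrite j0 subn0 modnn muln0 i0 i2.
  have [_ e _ _ [_ _]] := opposite_side N_odd (ltn_ord j) j0.
  have jm : (N - j < N)%N by rewrite ltn_subrL lt0n j0.
  rewrite (modn_small jm) e i0 i2 !andbT.
  by move: j4; rewrite (negbTE j0).
have split1 : \sum_(k | quad1 k) energy k xi =
    \sum_(k | quad1 k && low k) energy k xi + \sum_(k | quad1 k && ~~ low k) energy k xi.
  by rewrite (bigID low).
have t_coord z1 z2 x : x \in om ->
    [/\ rep (T z1 z2 x) = rep x, c1 (T z1 z2 x) = c1 x + z1 & c2 (T z1 z2 x) = c2 x + z2].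
  by move=> xom; have [-> ->] := coordT z1 z2 (omD xom); rewrite repT.
have T1K : cancel (T 1 0) (T (- 1) 0) by move=> x; rewrite -TD; exact: T0.
have T1'K : cancel (T (- 1) 0) (T 1 0) by move=> x; rewrite -TD; exact: T0.
have T2K : cancel (T 0 1) (T 0 (- 1)) by move=> x; rewrite -TD; exact: T0.
have T2'K : cancel (T 0 (- 1)) (T 0 1) by move=> x; rewrite -TD; exact: T0.
have ax1 := mass_near_axis T1K T1'K sub1 nf1 (t_coord 1 0).
have ax2 := mass_near_axis T2K T2'K sub2 nf2 (t_coord 0 1).
have near : \sum_(k | quad1 k) energy k xi <=
    \sum_(k | near1 k) energy k xi + 5000^-1 * NN.
  have : \sum_(k | quad1 k) energy k xi <= \sum_(k | near1 k) energy k xi +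
      (\sum_(k : dual) (2 - 2 * cosn ((k.1 : nat)%:Z * 1 + (k.2 : nat)%:Z * 0)) *
         energy k xi +
       \sum_(k : dual) (2 - 2 * cosn ((k.1 : nat)%:Z * 0 + (k.2 : nat)%:Z * 1)) *
         energy k xi) / 2.
    rewrite -big_split /= mulr_suml.
    rewrite [leLHS]big_mkcond [X in _ <= X + _]big_mkcond -big_split /=.
    apply: ler_sum => -[i j] _ /=; have e0 := energy_ge0 rep c1 c2 om (i, j) xi.
    rewrite !mulr0 !mulr1 addr0 add0r.
    have ci : cosn i%:Z <= 1 by have := cosn2Dsinn2 R N' i%:Z; nra.
    have cj : cosn j%:Z <= 1 by have := cosn2Dsinn2 R N' j%:Z; nra.
    have r0 : 0 <= ((2 - 2 * cosn i%:Z) * energy (i, j) xi +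
        (2 - 2 * cosn j%:Z) * energy (i, j) xi) / 2.
      by rewrite -mulrDl divr_ge0 // mulr_ge0 //; lra.
    case: (boolP (quad1 (i, j))) => [q1|_]; last first.
      by case: ifP => _; rewrite ?add0r // addr_ge0.
    case: (boolP (near1 (i, j))) => [_|n1]; first by rewrite lerDl.
    rewrite add0r -mulrDl.
    have : (N < 4 * i)%N || (N < 4 * j)%N.
      by move: q1 n1 => /and3P[i2 j0 j2]; apply: half_not_near.
    move: q1 => /and3P[/= i2 _ j2] /orP[i4|j4].
      have := cosn_quarter R i4 (ltnW i2) => c0.
      by rewrite ler_pdivlMr // mulrC ler_wpM2r //; lra.
    have := cosn_quarter R j4 (ltnW j2) => c0.
    by rewrite ler_pdivlMr // mulrC ler_wpM2r //; lra.
  lra.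
have opp_inj : injective (fun k : dual => (- k.1, - k.2) : dual).
  apply: (can_inj (g := fun k : dual => (- k.1, - k.2))) => -[i j].
  by congr pair; apply: opprK.
have opp1 : \sum_(k | quad1 (- k.1, - k.2)) energy k xi = \sum_(k | quad1 k) energy k xi.
  rewrite [RHS](reindex_inj opp_inj) /=; apply: eq_bigr => k _.
  by rewrite energy_opp.
have opp4 : \sum_(k | quad4 (- k.1, - k.2)) energy k xi = \sum_(k | quad4 k) energy k xi.
  rewrite [RHS](reindex_inj opp_inj) /=; apply: eq_bigr => k _.
  by rewrite energy_opp.
have total : NN <= energy (0, 0) xi + (\sum_(k | quad1 k) energy k xi +
    \sum_(k | quad4 k) energy k xi + \sum_(k | quad1 (- k.1, - k.2)) energy k xi +
    \sum_(k | quad4 (- k.1, - k.2)) energy k xi).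
  have := energy_total uom sep_om xi; rewrite xi1 mulr1 => <-.
  rewrite (bigD1 (0, 0)) //= lerD2l.
  rewrite [X in _ <= X + _ + _ + _]big_mkcond [X in _ <= _ + X + _ + _]big_mkcond.
  rewrite [X in _ <= _ + _ + X + _]big_mkcond [X in _ <= _ + _ + _ + X]big_mkcond.
  rewrite [leLHS]big_mkcond -!big_split /=; apply: ler_sum => k _.
  apply: cover_le; first exact: energy_ge0.
  by move=> /eqP/quad_cover.
have e00 := energy_at0; have := N_large; have := NN_gt0; lra.
Qed.

End SpectralContradiction.

End FreePlane.

Lemma sqr_sqrtB (R : realType) (a b : R) : 0 <= a -> 0 <= b ->
  (Num.sqrt a - Num.sqrt b) ^+ 2 <= `|a - b|.
Proof.
move=> a0 b0; have sa := sqrtr_ge0 a; have sb := sqrtr_ge0 b.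
have -> : a - b = (Num.sqrt a - Num.sqrt b) * (Num.sqrt a + Num.sqrt b).
  by rewrite -subr_sqr !sqr_sqrtr.
rewrite -real_normK ?num_real // normrM expr2 ler_wpM2l //.
rewrite (ger0_norm (addr_ge0 sa sb)) ler_norml; apply/andP; split; lra.
Qed.

Lemma box_diff (b t : nat) (a1 a2 b1 b2 : int) : (`|a1| + `|a2| <= b)%N ->
  (`|b1| + `|b2| <= b)%N -> (`|a1 - b1| < (2 * (b + 10 * t)).+1)%N /\
    (`|a2 - b2| < (2 * (b + 10 * t)).+1)%N.
Proof. by move=> h1 h2; split; lia. Qed.

Lemma box_large (b t : nat) : (10 * t <= (2 * (b + 10 * t)).+1)%N.
Proof. lia. Qed.

(** Otherwise square roots of almost invariant densities would have spectral
    measures on the dual of Z^2 that are concentrated near the trivial character,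
    have no mass there, and are almost invariant under SL_2(Z), of which the
    three maps induce generators; but the quadrants around the trivial character
    play ping-pong. *)
Lemma free_plane_null (R : realType) (X : choiceType) (D : set X)
    (T : int -> int -> X -> X) (mu : set X -> R) (A A' B B' W W' : X -> X) :
  (forall x, T 0 0 x = x) ->
  (forall z1 z2 w1 w2 x, T (z1 + w1) (z2 + w2) x = T z1 z2 (T w1 w2 x)) ->
  (forall z1 z2 x, D x -> D (T z1 z2 x)) ->
  (forall z1 z2 x, D x -> T z1 z2 x = x -> z1 = 0 /\ z2 = 0) ->
  [/\ cancel A A', cancel B B' & cancel W W'] ->
  [/\ cancel A' A, cancel B' B & cancel W' W] ->
  (forall x, D x -> [/\ D (A x), D (B x) & D (W x)]) ->
  (forall x, D x -> [/\ D (A' x), D (B' x) & D (W' x)]) ->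
  (forall z1 z2 x, [/\ A (T z1 z2 x) = T (z1 + z2) z2 (A x),
     B (T z1 z2 x) = T z1 (z1 + z2) (B x) & W (T z1 z2 x) = T z2 (- z1) (W x)]) ->
  (forall E, 0 <= mu E) ->
  (forall E F, E `&` F = set0 -> mu (E `|` F) = mu E + mu F) ->
  (forall m, m \in [:: T (- 1) 0; T 0 (- 1); A'; B'; W'] ->
     forall E, E `<=` D -> mu (D `&` [set x | E (m x)]) = mu E) ->
  mu D = 0.
Proof.
move=> T0 TD DT Tfree [AK BK WK] [A'K B'K W'K] Dm Dm' mT mu0 muU mu_inv.
apply: contrapT => muD.
pose maps := [:: (T 1 0, T (- 1) 0); (T 0 1, T 0 (- 1)); (A, A'); (B, B'); (W, W')].
pose s (i : 'I_5) := (nth (id, id) maps i).1.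
pose s' (i : 'I_5) := (nth (id, id) maps i).2.
have T1K x : T (- 1) 0 (T 1 0 x) = x by rewrite -TD; apply: T0.
have T1'K x : T 1 0 (T (- 1) 0 x) = x by rewrite -TD; apply: T0.
have T2K x : T 0 (- 1) (T 0 1 x) = x by rewrite -TD; apply: T0.
have T2'K x : T 0 1 (T 0 (- 1) x) = x by rewrite -TD; apply: T0.
have sK i : cancel (s i) (s' i).
  by case: i => -[|[|[|[|[|]]]]] //= ?; rewrite /s /s' /=.
have s'K i : cancel (s' i) (s i).
  by case: i => -[|[|[|[|[|]]]]] //= ?; rewrite /s /s' /=.
have sD i x : D x -> D (s i x).
  move=> Dx; have [DA DB DW] := Dm x Dx.
  by case: i => -[|[|[|[|[|]]]]] //= ?; rewrite /s /=; try exact: DT.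
have s'D i x : D x -> D (s' i x).
  move=> Dx; have [DA DB DW] := Dm' x Dx.
  by case: i => -[|[|[|[|[|]]]]] //= ?; rewrite /s' /=; try exact: DT.
have s'mu i E : E `<=` D -> mu (D `&` [set x | E (s' i x)]) = mu E.
  apply: mu_inv; case: i => -[|[|[|[|[|]]]]] //= ?; by rewrite /s' /= !inE eqxx ?orbT.
have eps0 : 0 < 5000^-1 :> R by rewrite invr_gt0.
have [f [sf [usf sfD [f0 fsf] f1 fs]]] :=
  almost_invariant_density sK s'K s'D mu0 muU s'mu muD eps0.
pose om := undup (sf ++ flatten [seq map (s' i) sf | i <- enum 'I_5]).
have uom : uniq om by apply: undup_uniq.
have s_om : {subset sf <= om} by move=> x xs; rewrite mem_undup mem_cat xs.
have subs i : {subset map (s' i) sf <= om}.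
  move=> x xs; rewrite mem_undup mem_cat; apply/orP; right; apply/flatten_mapP.
  by exists i; rewrite ?mem_enum.
have omD x : x \in om -> D x.
  rewrite mem_undup mem_cat => /orP[/sfD//|/flatten_mapP[i _ /mapP[y ysf ->]]].
  exact/s'D/sfD.
have [rep [c1 [c2 [repE repT]]]] := plane_coordinates T0 TD.
pose size_c x := (`|c1 x| + `|c2 x|)%N.
pose bd := \sum_(x <- om) size_c x.
have c_le x : x \in om -> (size_c x <= bd)%N.
  by move=> xom; rewrite /bd (big_rem x) //= leq_addr.
pose N' := (2 * (bd + 10 * size om))%N.
have N_odd : odd N'.+1 by rewrite /N' /= oddM.
have bounds x y : x \in om -> y \in om ->
    (`|c1 x - c1 y| < N'.+1)%N /\ (`|c2 x - c2 y| < N'.+1)%N.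
  by move=> /c_le xb /c_le yb; apply: box_diff.
have N_large : 10 * (size om)%:R <= N'.+1%:R ^+ 2 :> R.
  rewrite -natrX -natrM ler_nat; apply: (@leq_trans N'.+1).
    exact: box_large.
  by rewrite expnS expn1 leq_pmulr.
pose xi x := Num.sqrt (f x).
have xi_supp x : x \notin sf -> xi x = 0 by move=> /fsf xf; rewrite /xi xf sqrtr0.
have xi1 : \sum_(x <- om) xi x ^+ 2 = 1.
  rewrite -f1 -(sum_support usf uom s_om fsf).
  by apply: eq_bigr => x _; rewrite /xi sqr_sqrtr.
have nf i : nearly_fixed om xi (s i).
  apply: le_trans (fs i om uom); apply: ler_sum => x _; exact: sqr_sqrtB.
have o (k : nat) (k5 : (k < 5)%N) := Ordinal k5.
apply: (@spectral_contradiction R X D T T0 TD DT Tfree rep c1 c2 repE repT N' N_odd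
  om uom omD bounds N_large sf usf s_om xi xi_supp xi1 A A' B B' W W') => //.
- by move=> x /Dm[].
- by move=> x /Dm[].
- by move=> x /Dm[].
- by move=> z1 z2 x; have [] := mT z1 z2 x.
- by move=> z1 z2 x; have [] := mT z1 z2 x.
- by move=> z1 z2 x; have [] := mT z1 z2 x.
- exact: (subs (@Ordinal 5 2 isT)).
- exact: (subs (@Ordinal 5 3 isT)).
- exact: (subs (@Ordinal 5 4 isT)).
- exact: (subs (@Ordinal 5 0 isT)).
- exact: (subs (@Ordinal 5 1 isT)).
- exact: (nf (@Ordinal 5 2 isT)).
- exact: (nf (@Ordinal 5 3 isT)).
- exact: (nf (@Ordinal 5 4 isT)).
- exact: (nf (@Ordinal 5 0 isT)).
- exact: (nf (@Ordinal 5 1 isT)).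
Qed.

(** * Invariant means on transitive actions *)

Section InvariantMean.
Variables (R : realType) (G : groupType) (X : Type) (a : action_on G X).
Variables (mu : set X -> R) (mu_mean : is_mean mu) (mu_inv : invariant_mean a mu).

Let mu0 A : 0 <= mu A. Proof. by have [H _ _] := mu_mean. Qed.
Let muU A B : A `&` B = set0 -> mu (A `|` B) = mu A + mu B.
Proof. by have [_ _ H] := mu_mean; apply: H. Qed.

Lemma mean_mono A B : A `<=` B -> mu A <= mu B.
Proof.
move=> AB; have -> : B = A `|` (B `\` A).
  by apply/esym; rewrite setDE setUIr setUCr setIT; apply/setUidPr.
by rewrite muU ?lerDl // setDE setICA setICr setI0.
Qed.

Lemma mean_set0 : mu set0 = 0. Proof. exact: fa_set0 muU. Qed.

Lemma null_sub A B : A `<=` B -> mu B = 0 -> mu A = 0.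
Proof. by move=> /mean_mono AB B0; apply/eqP; rewrite eq_le mu0 -B0 AB. Qed.

Lemma null_setU A B : mu A = 0 -> mu B = 0 -> mu (A `|` B) = 0.
Proof.
move=> A0 B0; have -> : A `|` B = A `|` (B `\` A).
  by rewrite setDE setUIr setUCr setIT.
rewrite muU; last by rewrite setDE setICA setICr setI0.
by rewrite A0 add0r; apply: null_sub B0 => x [].
Qed.

Lemma null_exists (I : finType) (A : I -> set X) : (forall i, mu (A i) = 0) ->
  mu [set x | exists i, A i x] = 0.
Proof.
move=> A0; suff H (r : seq I) : mu [set x | exists2 i, i \in r & A i x] = 0.
  by apply: null_sub (H (enum I)) => x [i Ai]; exists i => //; rewrite mem_enum.
elim: r => [|i r IH].
  by rewrite -mean_set0; congr mu; apply/seteqP; split=> // x [].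
apply: null_sub (null_setU (A0 i) IH) => x [j]; rewrite inE => /orP[/eqP->|jr] Aj.
  by left.
by right; exists j.
Qed.

Lemma mean_preimage g A : mu [set x | A (a g x)] = mu A.
Proof.
rewrite -(mu_inv g [set x | A (a g x)]); congr mu; apply/seteqP; split=> x.
  by move=> [y Ay <-].
by move=> Ax; exists (a g^-1%g x) => /=; rewrite actVK.
Qed.

(** The forward translates are pairwise disjoint and have equal measure. *)
Lemma wandering_null g A :
  (forall l x, (0 < l)%N -> A x -> ~ A (a (g ^+ l)%g x)) -> mu A = 0.
Proof.
move=> wA; pose U N := [set x | exists2 l, (l < N)%N & A (a (g ^+ l)%g x)].
have UE N : mu (U N) = N%:R * mu A.
  elim: N => [|N IH].
    by rewrite mul0r -mean_set0; congr mu; apply/seteqP; split=> // x [].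
  have -> : U N.+1 = U N `|` [set x | A (a (g ^+ N)%g x)].
    apply/seteqP; split=> x.
      move=> [l]; rewrite ltnS leq_eqVlt => /orP[/eqP->|lN] Al; first by right.
      by left; exists l.
    move=> [[l lN Al]|AN]; last by exists N.
    by exists l => //; apply: ltnW.
  rewrite muU; last first.
    apply/seteqP; split=> // x [[l lN Al]] /=.
    rewrite -(subnK (ltnW lN)) expgnDr actM.
    by apply: wA => //; rewrite subn_gt0.
  by rewrite IH mean_preimage -[N.+1]addn1 natrD mulrDl mul1r.
apply/eqP; rewrite eq_le mu0 andbT leNgt; apply/negP => A0.
have : mu (U (Num.trunc (1 / mu A)).+1) <= mu [set: X] by apply: mean_mono.
have [_ -> _] := mu_mean; rewrite UE -ler_pdivlMr // leNgt => /negP; apply.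
exact: truncnS_gt.
Qed.

End InvariantMean.

(** * Stabilizers in the planes spanned by two root subgroups *)

Section PlaneTranslations.
Variables (F : fieldType) (n : nat).
Implicit Types (i j k : 'I_n) (r s c : F).

Definition plane_tr i j k r s : 'SL[F]_n := (elem i k r * elem j k s)%g.

Lemma plane_tr_swap i j k r s : i != k -> j != k ->
  plane_tr i j k r s = plane_tr j i k s r.
Proof. by move=> ik jk; apply: elem_commute; rewrite // eq_sym. Qed.

Lemma plane_trD i j k r s r' s' : i != k -> j != k ->
  plane_tr i j k (r + r') (s + s') =
  (plane_tr i j k r s * plane_tr i j k r' s')%g.
Proof.
move=> ik jk; rewrite /plane_tr !elemD // !mulgA; congr (_ * _)%g.
rewrite -!mulgA; congr (_ * _)%g; apply: elem_commute => //; by rewrite eq_sym.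
Qed.

Lemma plane_tr0 i j k : i != k -> j != k -> plane_tr i j k 0 0 = 1%g.
Proof. by move=> ik jk; rewrite /plane_tr !elem0 // mulg1. Qed.

Lemma plane_tr_row i j k c r s : i != j -> i != k -> j != k ->
  (elem i j c * plane_tr i j k r s =
   plane_tr i j k (r + c * s) s * elem i j c)%g.
Proof.
move=> ij ik jk; have cij t : commute (elem i j c) (elem i k t).
  by apply: elem_commute => //; rewrite eq_sym.
have cjk t t' : commute (elem j k t) (elem i k t').
  by apply: elem_commute => //; rewrite eq_sym.
rewrite /plane_tr mulgA cij -mulgA elem_comm // -!mulgA elemD //.
rewrite (cij (c * s)) !mulgA; congr (_ * _)%g; rewrite -!mulgA.
by congr (_ * _)%g; apply: cjk.
Qed.

Lemma plane_tr_col i j k c r s : i != j -> i != k -> j != k ->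
  (elem j i c * plane_tr i j k r s =
   plane_tr i j k r (s + c * r) * elem j i c)%g.
Proof.
move=> ij ik jk; rewrite !(plane_tr_swap _ _ ik jk).
by apply: plane_tr_row; rewrite // eq_sym.
Qed.

Definition hweight i j q l : F := if l == i then q else if l == j then q^-1 else 1.

Lemma hweight1 i j q : i != j -> q != 0 -> \prod_l hweight i j q l = 1.
Proof.
move=> ij q0; rewrite (bigD1 i) // (bigD1 j) 1?eq_sym //= big1 => [|l].
  by rewrite /hweight eqxx eq_sym (negbTE ij) eqxx mulr1 divff.
by rewrite /hweight => /andP[/negbTE-> /negbTE->].
Qed.

Lemma plane_tr_diag i j k q r s : i != j -> i != k -> j != k -> q != 0 ->
  (diagSL (hweight i j q) * plane_tr i j k r s =
   plane_tr i j k (q * r) (q^-1 * s) * diagSL (hweight i j q))%g.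
Proof.
move=> ij ik jk q0; rewrite /plane_tr mulgA diagSL_elem ?hweight1 // -mulgA.
rewrite diagSL_elem ?hweight1 // mulgA /hweight eqxx !(eq_sym k).
by rewrite (negbTE ik) (negbTE jk) eq_sym (negbTE ij) eqxx !divr1.
Qed.

End PlaneTranslations.

Lemma far_left (u v : int) (l : nat) : (0 < l)%N ->
  u - (2 * l * `|u - v|)%N%:Z <= v.
Proof. by case: l => // l _; lia. Qed.

Section PlaneOfRootGroups.
Variables (F : realFieldType).
Hypothesis ratF : forall r : F, exists2 b : nat, (0 < b)%N &
  exists z : int, b%:R * r = z%:~R.
Variables (n : nat) (X : Type) (a : action_on 'SL[F]_n X).
Variables (i j k : 'I_n) (ij : i != j) (ik : i != k) (jk : j != k).
Implicit Types (r s c : F) (x : X) (g : 'SL[F]_n) (K : nat -> Prop).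

Local Notation tr := (plane_tr i j k).

Lemma fix_trM r s m x : a (tr r s) x = x -> a (tr (m%:R * r) (m%:R * s)) x = x.
Proof.
move=> rsx; elim: m => [|m IH]; first by rewrite !mul0r plane_tr0 // act1.
by rewrite -[m.+1]addn1 natrD !mulrDl !mul1r plane_trD //; apply: fixM.
Qed.

Lemma fix_trN r s x : a (tr r s) x = x -> a (tr (- r) (- s)) x = x.
Proof.
move=> rsx; have -> : tr (- r) (- s) = (tr r s)^-1%g.
  by apply/esym/mulg1_eq; rewrite -plane_trD // !subrr plane_tr0.
exact: fixV.
Qed.

(** The vector [(r, s)] belongs, after localization at [K], to the stabilizer of
    [x] in the plane spanned by two root subgroups of one column. *)
Definition loc K x r s := exists2 m, K m & a (tr (m%:R * r) (m%:R * s)) x = x.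

Lemma locD K x r s r' s' : (forall m m', K m -> K m' -> K (m * m')%N) ->
  loc K x r s -> loc K x r' s' -> loc K x (r + r') (s + s').
Proof.
move=> KM [m Km mx] [m' Km' m'x]; exists (m * m')%N; first exact: KM.
rewrite !mulrDr plane_trD //; apply: fixM.
  by rewrite mulnC natrM -!mulrA; apply: fix_trM.
by rewrite natrM -!mulrA; apply: fix_trM.
Qed.

Lemma locN K x r s : loc K x r s -> loc K x (- r) (- s).
Proof. by move=> [m Km mx]; exists m => //; rewrite !mulrN; apply: fix_trN. Qed.

Lemma locM K x r s m : loc K x r s -> loc K x (m%:R * r) (m%:R * s).
Proof.
move=> [m' Km mx]; exists m' => //; rewrite ![m'%:R * _]mulrCA.
exact: fix_trM.
Qed.

Lemma locZ K x r s (z : int) : loc K x r s -> loc K x (z%:~R * r) (z%:~R * s).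
Proof.
move=> lrs; case: z => m; first exact: locM.
by rewrite NegzE rmorphN !mulNr; apply/locN/locM.
Qed.

Lemma loc_positive x r s c : loc positive x r s -> loc positive x (c * r) (c * s).
Proof.
move=> lrs; have [b b0 [z bc]] := ratF c.
have [m m0 mx] := locZ z lrs; exists (m * b)%N; first exact: positiveM.
have E t : (m * b)%N%:R * (c * t) = m%:R * (z%:~R * t) by rewrite natrM -bc !mulrA.
by rewrite !E.
Qed.

Lemma loc_act K g (g1 g2 : F -> F -> F) x r s :
  (forall r s, (g * tr r s = tr (g1 r s) (g2 r s) * g)%g) ->
  (forall m : nat, g1 (m%:R * r) (m%:R * s) = m%:R * g1 r s /\
     g2 (m%:R * r) (m%:R * s) = m%:R * g2 r s) ->
  loc K (a g x) (g1 r s) (g2 r s) <-> loc K x r s.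
Proof.
move=> gE gM; have E m : a (tr (m%:R * g1 r s) (m%:R * g2 r s)) (a g x) =
    a g (a (tr (m%:R * r) (m%:R * s)) x).
  by have [<- <-] := gM m; rewrite -!actM gE.
split=> -[m Km mx]; exists m => //; last by rewrite E mx.
by apply: (@act_inj _ _ a g); rewrite -E.
Qed.

Lemma loc_row K c x r s : loc K (a (elem i j c) x) (r + c * s) s <-> loc K x r s.
Proof.
apply: (loc_act K (g1 := fun r s => r + c * s) (g2 := fun r s => s)).
  by move=> r' s'; apply: plane_tr_row.
by move=> m; split=> //; rewrite mulrDr mulrCA.
Qed.

Lemma loc_col K c x r s : loc K (a (elem j i c) x) r (s + c * r) <-> loc K x r s.
Proof.
apply: (loc_act K (g1 := fun r s => r) (g2 := fun r s => s + c * r)).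
  by move=> r' s'; apply: plane_tr_col.
by move=> m; split=> //; rewrite mulrDr mulrCA.
Qed.

Lemma loc_diag K q x r s : q != 0 ->
  loc K (a (diagSL (hweight i j q)) x) (q * r) (q^-1 * s) <-> loc K x r s.
Proof.
move=> q0; apply: (loc_act K (g1 := fun r s => q * r) (g2 := fun r s => q^-1 * s)).
  by move=> r' s'; apply: plane_tr_diag.
by move=> m; split; rewrite mulrCA.
Qed.

Variables (R : realType) (mu : set X -> R).
Hypotheses (mu_mean : is_mean mu) (mu_inv : invariant_mean a mu).

(** The points with a stabilizer of rank one: the direction of the stabilizer
    is a point of the projective line, where translations by unipotents are
    wandering away from their fixed points. *)
Lemma rank_one_row : mu [set x | (exists2 s, `|s| <= 1 & loc positive x s 1) /\
  ~ loc positive x 1 0] = 0.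
Proof.
apply: (wandering_null mu_mean mu_inv (g := elem i j 3)) => l x l0.
move=> [[s s1 sx] nx] [[s' s'1 s'x] _]; apply: nx.
rewrite elemX // in s'x.
have {}s'x : loc positive x (s' - l%:R * 3) 1.
  by apply: (proj1 (loc_row positive (l%:R * 3) x _ 1)); rewrite mulr1 subrK.
have := locD positiveM sx (locN s'x); rewrite subrr.
set d := s - _ => dx; have d0 : d != 0.
  have l1 : 1 <= l%:R :> F by rewrite ler1n.
  by move: s1 s'1; rewrite !ler_norml /d => /andP[? ?] /andP[? ?]; rewrite gt_eqF //; lra.
by have := loc_positive d^-1 dx; rewrite mulVf // mulr0.
Qed.

Lemma rank_one_col : mu [set x | (exists2 s, `|s| <= 1 & loc positive x 1 s) /\
  ~ loc positive x 0 1] = 0.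
Proof.
apply: (wandering_null mu_mean mu_inv (g := elem j i 3)) => l x l0.
move=> [[s s1 sx] nx] [[s' s'1 s'x] _]; apply: nx.
rewrite elemX 1?eq_sym // in s'x.
have {}s'x : loc positive x 1 (s' - l%:R * 3).
  by apply: (proj1 (loc_col positive (l%:R * 3) x 1 _)); rewrite mulr1 subrK.
have := locD positiveM sx (locN s'x); rewrite subrr.
set d := s - _ => dx; have d0 : d != 0.
  have l1 : 1 <= l%:R :> F by rewrite ler1n.
  by move: s1 s'1; rewrite !ler_norml /d => /andP[? ?] /andP[? ?]; rewrite gt_eqF //; lra.
by have := loc_positive d^-1 dx; rewrite mulVf // mulr0.
Qed.

(** Where the stabilizer in the plane is trivial, Z^2 acts freely. *)
Lemma rank_zero : mu [set x | forall z1 z2 : int, a (tr z1%:~R z2%:~R) x = x ->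
  z1 = 0 /\ z2 = 0] = 0.
Proof.
have [mu0 _ muU] := mu_mean.
set D := [set x | _].
have ji : j != i by rewrite eq_sym.
pose T z1 z2 x := a (tr z1%:~R z2%:~R) x.
pose gW := (elem i j 1 * (elem j i (- 1) * elem i j 1))%g : 'SL[F]_n.
have AT z1 z2 x : a (elem i j 1) (T z1 z2 x) = T (z1 + z2) z2 (a (elem i j 1) x).
  by rewrite /T -!actM plane_tr_row // mul1r -rmorphD.
have BT z1 z2 x : a (elem j i 1) (T z1 z2 x) = T z1 (z1 + z2) (a (elem j i 1) x).
  by rewrite /T -!actM plane_tr_col // mul1r -rmorphD addrC.
have B'T z1 z2 x : a (elem j i (- 1)) (T z1 z2 x) =
    T z1 (z2 - z1) (a (elem j i (- 1)) x).
  by rewrite /T -!actM plane_tr_col // mulN1r -rmorphB.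
have WT z1 z2 x : a gW (T z1 z2 x) = T z2 (- z1) (a gW x).
  by rewrite /gW !actM AT B'T AT; congr (T _ _ _); ring.
have TD z1 z2 w1 w2 x : T (z1 + w1) (z2 + w2) x = T z1 z2 (T w1 w2 x).
  by rewrite /T -actM -plane_trD // !rmorphD.
have DT z1 z2 x : D x -> D (T z1 z2 x).
  move=> Dx w1 w2; rewrite -/(T w1 w2 _) -TD addrC [w2 + _]addrC TD.
  by move=> /(@act_inj _ _ a _ _ _)/Dx.
have mD g (g1 g2 h1 h2 : int -> int -> int) :
    (forall z1 z2 x, a g (T z1 z2 x) = T (g1 z1 z2) (g2 z1 z2) (a g x)) ->
    (forall z1 z2, g1 (h1 z1 z2) (h2 z1 z2) = z1 /\ g2 (h1 z1 z2) (h2 z1 z2) = z2) ->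
    g1 0 0 = 0 -> g2 0 0 = 0 ->
    (forall z1 z2, g1 z1 z2 = 0 -> g2 z1 z2 = 0 -> z1 = 0 /\ z2 = 0) ->
    (forall x, D x -> D (a g x)) /\ (forall x, D x -> D (a g^-1%g x)).
  move=> gT gh g10 g20 g0; split=> x Dx z1 z2 zx.
    have [e1 e2] := gh z1 z2.
    have := gT (h1 z1 z2) (h2 z1 z2) x; rewrite e1 e2 /T zx.
    move=> /(@act_inj _ _ a _ _ _)/Dx[h10 h20].
    by rewrite h10 h20 in e1 e2; rewrite -e1 -e2.
  have := gT z1 z2 (a g^-1%g x); rewrite {1}/T zx actVK => /esym/Dx[].
  exact: g0.
have [DA DA'] : (forall x, D x -> D (a (elem i j 1) x)) /\
    (forall x, D x -> D (a (elem i j 1)^-1%g x)).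
  apply: (mD _ _ _ (fun z1 z2 => z1 - z2) (fun z1 z2 => z2) AT) => //.
    by move=> z1 z2; rewrite subrK.
  by move=> z1 z2 e1 e2; split=> //; rewrite -e1 e2 addr0.
have [DB DB'] : (forall x, D x -> D (a (elem j i 1) x)) /\
    (forall x, D x -> D (a (elem j i 1)^-1%g x)).
  apply: (mD _ _ _ (fun z1 z2 => z1) (fun z1 z2 => z2 - z1) BT) => //.
    by move=> z1 z2; rewrite addrC subrK.
  by move=> z1 z2 e1 e2; split=> //; rewrite -e2 e1 add0r.
have [DW DW'] : (forall x, D x -> D (a gW x)) /\
    (forall x, D x -> D (a gW^-1%g x)).
  apply: (mD _ _ _ (fun z1 z2 => - z2) (fun z1 z2 => z1) WT) => //.
    by move=> z1 z2; rewrite opprK.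
  by move=> z1 z2 e1 e2; split=> //; apply/eqP; rewrite -oppr_eq0 e2.
have inv g : (forall x, D x -> D (a g^-1%g x)) -> forall E, E `<=` D ->
    mu (D `&` [set x | E (a g x)]) = mu E.
  move=> Dg E ED; rewrite -(mean_preimage mu_inv g E); congr mu.
  apply/seteqP; split=> x /= => [[]//|Ex]; split=> //.
  by rewrite -[x](actK a g); apply/Dg/ED.
have Tinv z1 z2 : forall E, E `<=` D -> mu (D `&` [set x | E (T z1 z2 x)]) = mu E.
  apply: (inv (tr z1%:~R z2%:~R)) => x Dx.
  have -> : (tr z1%:~R z2%:~R)^-1%g = tr (- z1)%:~R (- z2)%:~R :> 'SL[F]_n.
    by apply: mulg1_eq; rewrite -plane_trD // !rmorphN !subrr plane_tr0.
  exact: DT.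
apply: (@free_plane_null R {classic X} D T mu (a (elem i j 1)) (a (elem i j 1)^-1%g)
  (a (elem j i 1)) (a (elem j i 1)^-1%g) (a gW) (a gW^-1%g)) => //.
- by move=> x; rewrite /T plane_tr0 // act1.
- by move=> z1 z2 x Dx; apply: Dx.
- by split; exact: actK.
- by split; exact: actVK.
- by move=> x Dx; split; [exact: DA|exact: DB|exact: DW].
- by move=> x Dx; split; [exact: DA'|exact: DB'|exact: DW'].
move=> m; rewrite !inE => /orP[/eqP->|/orP[/eqP->|/orP[/eqP->|/orP[/eqP->|/eqP->]]]];
  [exact: Tinv|exact: Tinv| | |]; by apply: inv; rewrite invgK.
Qed.

Lemma rank_two : mu [set x | ~ (loc positive x 1 0 /\ loc positive x 0 1)] = 0.
Proof.
apply: (null_sub mu_mean) (null_setU mu_mean rank_zero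
  (null_setU mu_mean rank_one_row rank_one_col)) => x /= nx.
apply: contrapT => /not_orP[nz /not_orP[nr nc]]; apply: nx.
have scale (r s : F) : `|r| <= `|s| -> s != 0 -> loc positive x r s ->
    loc positive x (r / s) 1 /\ `|r / s| <= 1.
  move=> rs s0 lx; split.
    by have := loc_positive s^-1 lx; rewrite mulVf // mulrC.
  by rewrite normf_div ler_pdivrMr ?normr_gt0 // mul1r.
have {nz} [z1 [z2 [zx z0]]] : exists z1 z2 : int, loc positive x z1%:~R z2%:~R /\
    ~ (z1 = 0 /\ z2 = 0).
  apply: contrapT => nn; apply: nz => z1 z2 zx; apply: contrapT => z0.
  by apply: nn; exists z1, z2; split=> //; exists 1%N => //; rewrite !mul1r.
have F0 (z : int) : (z%:~R == 0 :> F) = (z == 0) by rewrite intr_eq0.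
have [le12|/ltW le21] := lerP `|z1%:~R : F| `|z2%:~R|.
  have z20 : z2%:~R != 0 :> F.
    apply/negP => /eqP E; move: le12; rewrite E normr0 normr_le0 F0 => /eqP z10.
    by apply: z0; split=> //; apply/eqP; rewrite -F0 E.
  have lx : loc positive x (z1%:~R / z2%:~R) 1.
    by have := loc_positive z2%:~R^-1 zx; rewrite mulVf // mulrC.
  have l1 : loc positive x 1 0.
    apply: contrapT => n1; apply: nr; split=> //.
    exists (z1%:~R / z2%:~R) => //.
    by rewrite normf_div ler_pdivrMr ?normr_gt0 // mul1r.
  split=> //; have := locD positiveM lx (loc_positive (- (z1%:~R / z2%:~R)) l1).
  by rewrite mulr1 mulr0 addr0 subrr.
have z10 : z1%:~R != 0 :> F.
  apply/negP => /eqP E; move: le21; rewrite E normr0 normr_le0 F0 => /eqP z20.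
  by apply: z0; split=> //; apply/eqP; rewrite -F0 E.
have lx : loc positive x 1 (z2%:~R / z1%:~R).
  by have := loc_positive z1%:~R^-1 zx; rewrite mulVf // mulrC.
have l1 : loc positive x 0 1.
  apply: contrapT => n1; apply: nc; split=> //.
  exists (z2%:~R / z1%:~R) => //.
  by rewrite normf_div ler_pdivrMr ?normr_gt0 // mul1r.
split=> //; have := locD positiveM lx (loc_positive (- (z2%:~R / z1%:~R)) l1).
by rewrite mulr1 mulr0 addr0 subrr.
Qed.

Variables (p : nat) (pp : prime p).
Local Notation lc := (loc (coprime_to p)).
Local Notation pe e := ((p%:R : F) ^ (e : int)).

(** The exponents [e] such that [p ^ e] times the vector belongs to the
    localized stabilizer: a p-adic norm of the vector, infinite values
    allowed. *)
Definition level x r s (e : int) := lc x (pe e * r) (pe e * s).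

Let p0 : p%:R != 0 :> F.
Proof. by rewrite pnatr_eq0 -lt0n prime_gt0. Qed.

Lemma level_up x r s e e' : e <= e' -> level x r s e -> level x r s e'.
Proof.
move=> ee' le; have [d ->] : exists d : nat, e' = d%:Z + e.
  by exists `|(e' - e)%R|%N; rewrite gez0_abs ?subr_ge0 // subrK.
rewrite /level expfzDr // -!mulrA -[pe d%:Z]/(p%:R ^+ d) -natrX.
exact: locM.
Qed.

Lemma levelD x r s r' s' e : level x r s e -> level x r' s' e ->
  level x (r + r') (s + s') e.
Proof. by rewrite /level !mulrDr; apply: locD; apply: coprime_toM. Qed.

Lemma levelN x r s e : level x r s e -> level x (- r) (- s) e.
Proof. by rewrite /level !mulrN; apply: locN. Qed.

Lemma level_row c x r s e :
  level (a (elem i j c) x) (r + c * s) s e <-> level x r s e.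
Proof. by rewrite /level mulrDr [pe e * (c * s)]mulrCA; apply: loc_row. Qed.

Lemma level_col c x r s e :
  level (a (elem j i c) x) r (s + c * r) e <-> level x r s e.
Proof. by rewrite /level mulrDr [pe e * (c * r)]mulrCA; apply: loc_col. Qed.

Lemma level_diag x l e :
  (level (a (diagSL (hweight i j p%:R) ^+ l)%g x) 1 0 e <-> level x 1 0 (e - l%:Z)) /\
  (level (a (diagSL (hweight i j p%:R) ^+ l)%g x) 0 1 e <-> level x 0 1 (e + l%:Z)).
Proof.
have step y e' :
    (level (a (diagSL (hweight i j p%:R)) y) 1 0 e' <-> level y 1 0 (e' - 1)) /\
    (level (a (diagSL (hweight i j p%:R)) y) 0 1 e' <-> level y 0 1 (e' + 1)).
  rewrite /level !mulr0; split.
    have := loc_diag (coprime_to p) y (pe (e' - 1) * 1) 0 p0.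
    by rewrite mulr0 mulrA -[X in X * pe _]expr1z -expfzDr // addrC subrK.
  have := loc_diag (coprime_to p) y 0 (pe (e' + 1) * 1) p0.
  by rewrite mulr0 mulrA -[X in X^-1 * pe _]expr1z invr_expz -expfzDr // addrC addrK.
elim: l e => [|l IH] e; first by split; rewrite act1 ?subr0 ?addr0.
rewrite expgS actM; have [s1 s2] := step (a (diagSL (hweight i j p%:R) ^+ l)%g x) e.
have [i1 _] := IH (e - 1); have [_ i2] := IH (e + 1).
have -> : e - l.+1%:Z = e - 1 - l%:Z by rewrite -addn1 PoszD; ring.
have -> : e + l.+1%:Z = e + 1 + l%:Z by rewrite -addn1 PoszD; ring.
by split; [apply: iff_trans s1 i1 | apply: iff_trans s2 i2].
Qed.

Definition same_finite_level r s r' s' := [set x |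
  [/\ forall e, level x r s e <-> level x r' s' e, exists e, level x r s e &
      exists e, ~ level x r s e]].

(** The diagonal matrix raises one norm and lowers the other. *)
Lemma same_level_axes : mu (same_finite_level 1 0 0 1) = 0.
Proof.
apply: (wandering_null mu_mean mu_inv (g := diagSL (hweight i j p%:R))) => l x l0.
move=> [E1 [e0 l_e0] [e1 nl_e1]] [E2 _ _]; apply: nl_e1.
have shift e : level x 1 0 (e - l%:Z) <-> level x 1 0 (e + l%:Z).
  have [d1 d2] := level_diag x l e.
  apply: (iff_trans (iff_sym d1)); apply: (iff_trans (E2 e)).
  by apply: (iff_trans d2); apply: iff_sym.
have down (t : nat) : level x 1 0 (e0 - (2 * l * t)%N%:Z).
  elim: t => [|t IH]; first by rewrite muln0 subr0.
  have -> : e0 - (2 * l * t.+1)%N%:Z = (e0 - (2 * l * t)%N%:Z - l%:Z) - l%:Z by lia.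
  by apply/shift; rewrite subrK.
apply: level_up (down `|e0 - e1|%N).
exact: far_left.
Qed.

Lemma same_level_row : mu (same_finite_level 1 0 1 1) = 0.
Proof.
rewrite -same_level_axes -(mean_preimage mu_inv (elem i j 1)).
congr mu; apply/seteqP.
have E x e : level (a (elem i j 1) x) 1 0 e <-> level x 1 0 e.
  by have := level_row 1 x 1 0 e; rewrite mulr0 addr0.
have E' x e : level (a (elem i j 1) x) 1 1 e <-> level x 0 1 e.
  by have := level_row 1 x 0 1 e; rewrite mulr1 add0r.
split=> x [/= H [e0 h0] [e1 h1]]; split.
- by move=> e; apply: iff_trans (iff_sym (E x e)) _; apply: iff_trans (H e) (E' x e).
- by exists e0; apply/E.
- by exists e1 => /E.
- by move=> e; apply: iff_trans (E x e) _; apply: iff_trans (H e) (iff_sym (E' x e)).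
- by exists e0; apply/E.
- by exists e1 => /E.
Qed.

Lemma same_level_col : mu (same_finite_level 1 1 0 1) = 0.
Proof.
rewrite -same_level_axes -(mean_preimage mu_inv (elem j i 1)).
congr mu; apply/seteqP.
have E x e : level (a (elem j i 1) x) 1 1 e <-> level x 1 0 e.
  by have := level_col 1 x 1 0 e; rewrite mulr1 add0r.
have E' x e : level (a (elem j i 1) x) 0 1 e <-> level x 0 1 e.
  by have := level_col 1 x 0 1 e; rewrite mulr0 addr0.
split=> x [/= H [e0 h0] [e1 h1]]; split.
- by move=> e; apply: iff_trans (iff_sym (E x e)) _; apply: iff_trans (H e) (E' x e).
- by exists e0; apply/E.
- by exists e1 => /E.
- by move=> e; apply: iff_trans (E x e) _; apply: iff_trans (H e) (iff_sym (E' x e)).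
- by exists e0; apply/E.
- by exists e1 => /E.
Qed.

(** The sets of exponents of three vectors, one being the sum of the others, are
    nested, and the ultrametric inequality makes the two smallest equal. *)
Lemma ultrametric (K1 K2 K3 : int -> Prop) :
  (forall e e', e <= e' -> K1 e -> K1 e') -> (forall e e', e <= e' -> K2 e -> K2 e') ->
  (forall e e', e <= e' -> K3 e -> K3 e') ->
  (forall e, K1 e -> K2 e -> K3 e) -> (forall e, K1 e -> K3 e -> K2 e) ->
  (forall e, K3 e -> K2 e -> K1 e) ->
  ~ ((forall e, K1 e <-> K2 e) /\ exists e, ~ K1 e) ->
  ~ ((forall e, K1 e <-> K3 e) /\ exists e, ~ K1 e) ->
  ~ ((forall e, K3 e <-> K2 e) /\ exists e, ~ K3 e) -> forall e, K1 e.
Proof.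
move=> u1 u2 u3 s12 s13 s32 n12 n13 n32 e0; apply: contrapT => ne0.
have chain (K K' : int -> Prop) : (forall e e', e <= e' -> K e -> K e') ->
    (forall e e', e <= e' -> K' e -> K' e') ->
    (forall e, K e -> K' e) \/ (forall e, K' e -> K e).
  move=> u u'; have [?|] := pselect (forall e, K e -> K' e); first by left.
  move=> /existsNP[e /not_implyP[Ke nK'e]].
  right=> e' K'e'; have [le|/ltW le] := lerP e e'; first exact: u Ke.
  by case: nK'e; apply: u' K'e'.
have [c12|c21] := chain K1 K2 u1 u2.
  have [c23|c32] := chain K2 K3 u2 u3.
    by apply: n12; split; [split=> [/c12//|k2]; apply: s32 (c23 _ k2) k2|exists e0].
  apply: n13; split; last by exists e0.
  by move=> e; split=> [k1|k3]; [apply: s12 k1 (c12 _ k1)|apply: s32 k3 (c32 _ k3)].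
have [c13|c31] := chain K1 K3 u1 u3.
  apply: n12; split; last by exists e0.
  by move=> e; split=> [k1|/c21//]; apply: s13 k1 (c13 _ k1).
apply: n32; split; last by exists e0 => /c31.
by move=> e; split=> [k3|k2]; [apply: s13 (c31 _ k3) k3|apply: s12 (c21 _ k2) k2].
Qed.

(** The norms of the two axis vectors and of their sum cannot be finite, as two
    of them would coincide; so they are all zero. *)
Lemma loc_full : mu [set x | ~ forall r, exists2 m, coprime_to p m &
  a (elem i k (m%:R * r)) x = x] = 0.
Proof.
apply: (null_sub mu_mean) (null_setU mu_mean rank_two (null_setU mu_mean
  same_level_axes (null_setU mu_mean same_level_row same_level_col))) => x /= nx.
apply: contrapT => /not_orP[/contrapT[l10 l01] /not_orP[n12 /not_orP[n13 n32]]].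
apply: nx.
have ne r s : loc positive x r s -> exists e, level x r s e.
  move=> [m m0 mx]; have [m' pm' E] := pfactor_coprime pp m0.
  exists (logn p m)%:Z, m'; first by rewrite /coprime_to -prime_coprime.
  by rewrite !mulrA -[pe _]/(p%:R ^+ _) -natrX -natrM -E.
have l11 : loc positive x 1 1.
  by have := locD positiveM l10 l01; rewrite addr0 add0r.
have full e : level x 1 0 e.
  move: e; apply: (ultrametric (K2 := level x 0 1) (K3 := level x 1 1)).
  - by move=> e e'; apply: level_up.
  - by move=> e e'; apply: level_up.
  - by move=> e e'; apply: level_up.
  - by move=> e k1 k2; have := levelD k1 k2; rewrite addr0 add0r.
  - by move=> e k1 k3; have := levelD k3 (levelN k1); rewrite subrr oppr0 addr0.
  - by move=> e k3 k2; have := levelD k3 (levelN k2); rewrite subrr oppr0 addr0.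
  - by move=> [E ex]; apply: n12; split=> //; apply: ne.
  - by move=> [E ex]; apply: n13; split=> //; apply: ne.
  - by move=> [E ex]; apply: n32; split=> //; apply: ne.
move=> r; have [b b0 [z br]] := ratF r.
have [b' pb' E] := pfactor_coprime pp b0.
set d := logn p b in E.
have [m pm mx] := locZ z (full (- d%:Z)).
exists (m * b')%N.
  by apply: coprime_toM => //; rewrite /coprime_to -prime_coprime.
move: mx; rewrite !mulr0 /plane_tr elem0 // mulg1 mulr1.
congr (a (elem i k _) x = x).
rewrite -br E !natrM natrX -exprnN.
have pd : (p%:R : F) ^+ d != 0 by rewrite expf_neq0.
by field.
Qed.

End PlaneOfRootGroups.

Section MeanTransitive.
Variables (F : realFieldType).
Hypothesis ratF : forall r : F, exists2 b : nat, (0 < b)%N &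
  exists z : int, b%:R * r = z%:~R.
Variables (n : nat) (n3 : (2 < n)%N) (R : realType).

Lemma SL_FM' : property_FM' R 'SL[F]_n.
Proof.
move=> X a tr [mu [mu_mean mu_inv]].
suff lp p : prime p -> exists x, root_loc a (coprime_to p) x.
  by have [x ->] := transitive_locally_full n3 tr lp; apply: finite_set1.
move=> pp; apply: contrapT => nex.
have [_ mu1 _] := mu_mean.
suff : mu [set: X] = 0 by rewrite mu1 => /eqP; rewrite oner_eq0.
pose bad (ik : 'I_n * 'I_n) := [set x | ik.1 != ik.2 /\
  ~ forall r, exists2 m, coprime_to p m & a (elem ik.1 ik.2 (m%:R * r)) x = x].
have bad0 ik : mu (bad ik) = 0.
  case: ik => i k; have [eik|nik] := eqVneq i k.
    by apply: (null_sub mu_mean) (mean_set0 mu_mean) => x [/=]; rewrite eik eqxx.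
  have [j [ji jk]] := third_index i k n3.
  have ij : i != j by rewrite eq_sym.
  by apply: (null_sub mu_mean) (loc_full ratF ij nik jk mu_mean mu_inv pp) => x [].
apply: (null_sub mu_mean) (null_exists mu_mean bad0) => x _.
apply: contrapT => nb; apply: nex; exists x => i k r ik.
apply: contrapT => nr; apply: nb; exists (i, k); split=> // H.
Qed.

End MeanTransitive.

(** * Ascending unions of subgroups of infinite index *)

Section AscendingUnion.
Variables (G : groupType) (H : nat -> set G).
Hypothesis H1 : forall k, H k 1%g.
Hypothesis HM : forall k g h, H k g -> H k h -> H k (g * h)%g.
Hypothesis HV : forall k g, H k g -> H k g^-1%g.
Hypothesis H_exhaust : forall g, exists K, forall k, (K <= k)%N -> H k g.
Hypothesis H_index : forall k, exists u : nat -> G,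
  forall l m, l <> m -> ~ H k ((u l)^-1 * u m)%g.
Implicit Types (g h : G) (k l m : nat).

Definition translate g (S : set G) := [set h | S (g^-1 * h)%g].

Lemma translateM g h S : translate (g * h)%g S = translate g (translate h S).
Proof. by apply/funext => y; rewrite /translate /= invgM mulgA. Qed.

Lemma translate1 S : translate 1%g S = S.
Proof. by apply/funext => y; rewrite /translate /= invg1 mul1g. Qed.

(** The disjoint union of the coset spaces [G / H k], with a coset encoded as a
    set of group elements. *)
Definition tower := {x : nat * set G | exists g, x.2 = translate g (H x.1)}.

Lemma tower_eq (x y : tower) : sval x = sval y -> x = y.
Proof. by case: x => u xP; case: y => v yP /= uv; apply: eq_exist. Qed.

Lemma tower_translate g (x : tower) :
  exists g', ((sval x).1, translate g (sval x).2).2 = translate g' (H (sval x).1).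
Proof. by have [g' /= ->] := svalP x; exists (g * g')%g; rewrite translateM. Qed.

Definition tower_act g (x : tower) : tower := exist _ _ (tower_translate g x).

Lemma tower_act1 x : tower_act 1%g x = x.
Proof. by case: x => -[k S] xP; apply: tower_eq; rewrite /= translate1. Qed.

Lemma tower_actM g h x : tower_act (g * h)%g x = tower_act g (tower_act h x).
Proof. by case: x => -[k S] xP; apply: tower_eq; rewrite /= translateM. Qed.

Definition tower_action : action_on G tower := ActionOn tower_act1 tower_actM.

Lemma tower_base k : exists g, (k, H k).2 = translate g (H (k, H k).1).
Proof. by exists 1%g; rewrite translate1. Qed.

Definition base k : tower := exist _ _ (tower_base k).

Local Notation a := tower_action.

Lemma base_stab k g : a g (base k) = base k <-> H k g.
Proof.
split=> [/(congr1 sval)[/(congr1 (fun S : set G => S g))] /= E|Hg].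
  by rewrite -E /translate /= mulVg; apply: H1.
apply: tower_eq => /=; congr pair; apply/seteqP; split=> h; rewrite /translate /=.
  by move=> /(HM Hg); rewrite mulVKg.
by move=> Hh; apply: HM => //; apply: HV.
Qed.

Lemma base_eq k g h : a g (base k) = a h (base k) <-> H k (h^-1 * g)%g.
Proof.
apply: iff_trans (base_stab k _); rewrite actM; split=> [->|E].
  by rewrite actK.
by rewrite -[in RHS]E actVK.
Qed.

Lemma base_orbit x : exists g, x = a g (base (sval x).1).
Proof.
by case: x => -[k S] [g /= SE]; exists g; apply: tower_eq; rewrite /= SE.
Qed.

(** The base points form a commensurated set, meeting each of the infinitely
    many nontrivial transitive pieces in a single point. *)
Lemma union_not_FW : ~ property_FW G.
Proof.
move=> FW; pose M := range base.
have cM : commensurated a M.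
  move=> g; have [K HK] := H_exhaust g.
  have fin : finite_set ((base @` [set k | (k < K)%N]) `|`
      ((fun k => a g (base k)) @` [set k | (k < K)%N])).
    by rewrite finite_setU; split; apply: finite_image; apply: finite_II.
  apply: sub_finite_set fin => x -[[[k _ <-] nx]|[[_ [k _ <-] <-] nx]].
    left; exists k => //=; rewrite ltnNge; apply/negP => /HK Hk; apply: nx.
    by exists (base k); [exists k|apply/base_stab].
  right; exists k => //=; rewrite ltnNge; apply/negP => /HK /base_stab E; apply: nx.
  by exists k => //; rewrite E.
have [N [Ninv finMN]] := FW _ _ _ cM.
have NJ g x : N x -> N (a g x) by move=> Nx; rewrite -(Ninv g); exists x.
have pick k : exists y, (M `+` N) y /\ (sval y).1 = k.
  have [Nk|Nk] := pselect (N (base k)); last first.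
    by exists (base k); split=> //; left; split=> //; exists k.
  have [u uH] := H_index k.
  have [g ng] : exists g, ~ H k g by exists ((u 0%N)^-1 * u 1%N)%g; apply: uH.
  exists (a g (base k)); split=> //; right; split; first exact: NJ.
  move=> [l _ E]; apply: ng; apply/base_stab; rewrite -E.
  by have := congr1 (fun x => (sval x).1) E => /= ->.
have [y yP] := choice pick.
have yI : injective y by move=> k l E; rewrite -(proj2 (yP k)) E (proj2 (yP l)).
have [K HK] := finite_avoid yI finMN.
by apply: (HK K) => //; have [] := yP K.
Qed.

(** The limit of the point masses at the base points along an ultrafilter is
    invariant, since every group element fixes all but finitely many of them. *)
Lemma union_not_FM (R : realType) : ~ property_FM R G.
Proof.
pose F : set_system nat := [set A | exists K, forall k, (K <= k)%N -> A k].
have FF : ProperFilter F.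
  split; first by move=> [K HK]; apply: (HK K).
  split; first by exists 0%N.
    move=> P Q [K HK] [L HL]; exists (maxn K L) => k; rewrite geq_max.
    by move=> /andP[/HK ? /HL].
  by move=> P Q PQ [K HK]; exists K => k /HK /PQ.
have [U [UU FU]] := ultraFilterLemma FF.
pose at_base (A : set tower) := [set k | A (base k)].
pose mu (A : set tower) : R := (`[< U (at_base A) >])%:R.
have U0 : ~ U set0 by apply: filter_not_empty.
move=> FM; have [|x fx] := FM tower a.
  exists mu; split; first split.
  - by move=> A; apply: ler0n.
  - rewrite /mu (_ : `[< _ >] = true) //; apply/asboolP.
    by rewrite (_ : at_base _ = setT) //; apply: filterT.
  - move=> A B AB; rewrite /mu.
    have [UA|nUA] := pselect (U (at_base A)).
      have nUB : ~ U (at_base B).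
        move=> UB; apply: U0; have <- : at_base A `&` at_base B = set0.
          apply/seteqP; split=> // k [Ak Bk].
          by have : (A `&` B) (base k) by []; rewrite AB.
        exact: filterI.
      have UAB : U (at_base (A `|` B)) by apply: filterS UA => k Ak; left.
      by rewrite (asboolT UAB) (asboolT UA) (asboolF nUB) addr0.
    have UnA : U (~` at_base A).
      by have [] := in_ultra_setVsetC (at_base A) UU.
    rewrite (asboolF nUA) add0r; congr ((_ : bool)%:R).
    apply/asbool_equiv_eq; split=> [UAB|]; last by apply: filterS => k Bk; right.
    by apply: filterS (filterI UAB UnA) => k [[//|]].
  move=> g A; rewrite /mu; congr ((_ : bool)%:R); apply/asbool_equiv_eq.
  have Ug : U [set k | H k g].
    by apply: FU; have [K HK] := H_exhaust g; exists K.
  have E k : H k g -> (a g @` A) (base k) <-> A (base k).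
    by move=> /HV /base_stab gk; rewrite image_actE gk.
  split=> UA; apply: filterS (filterI UA Ug) => k [Ak Hk]; exact/E.
have [g xE] := base_orbit x; set k := (sval x).1 in xE.
have [u uH] := H_index k.
have uI : injective (fun l => a (u l) (base k)).
  move=> l m /base_eq Hlm; apply: contrapT => ml.
  by apply: (uH m l) => //; apply/nesym.
have [K HK] := finite_avoid uI fx.
apply: (HK K) => //; exists (u K * g^-1)%g => //.
by rewrite xE actM actK.
Qed.

End AscendingUnion.

(** * Matrices over subrings of the rationals *)

Section Smooth.
Variables (F : numFieldType).
Hypothesis ratF : forall r : F, exists2 b : nat, (0 < b)%N &
  exists z : int, b%:R * r = z%:~R.
Variables (n : nat) (n3 : (2 < n)%N).
Implicit Types (r s : F) (k b : nat).

Definition smooth k b := (0 < b)%N /\ forall p, prime p -> (p %| b)%N -> (p <= k)%N.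

(** The subring generated by the inverses of the integers up to [k]. *)
Definition smooth_ring k : set F :=
  [set r | exists2 b, smooth k b & exists z : int, b%:R * r = z%:~R].

Lemma smoothM k b b' : smooth k b -> smooth k b' -> smooth k (b * b')%N.
Proof.
move=> [b0 bk] [b'0 b'k]; split; first by rewrite muln_gt0 b0.
by move=> p pp; rewrite Euclid_dvdM // => /orP[/(bk p pp)|/(b'k p pp)].
Qed.

Lemma smooth1 k : smooth k 1.
Proof. by split=> // p /prime_gt1 p1; rewrite dvdn1 => /eqP p_1; rewrite p_1 in p1. Qed.

Lemma smooth_ring_int k (z : int) : smooth_ring k z%:~R.
Proof. by exists 1%N; [exact: smooth1|exists z; rewrite mul1r]. Qed.

Lemma smooth_ringD k r s : smooth_ring k r -> smooth_ring k s -> smooth_ring k (r + s).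
Proof.
move=> [b bk [z zr]] [b' b'k [z' z's]]; exists (b * b')%N; first exact: smoothM.
exists (b'%:Z * z + b%:Z * z').
by rewrite rmorphD !rmorphM /= -zr -z's ?natrM; ring.
Qed.

Lemma smooth_ringM k r s : smooth_ring k r -> smooth_ring k s -> smooth_ring k (r * s).
Proof.
move=> [b bk [z zr]] [b' b'k [z' z's]]; exists (b * b')%N; first exact: smoothM.
by exists (z * z'); rewrite natrM intrM -zr -z's; ring.
Qed.

Lemma smooth_ring_exhaust r : exists K, forall k, (K <= k)%N -> smooth_ring k r.
Proof.
have [b b0 zr] := ratF r; exists b => k bk; exists b => //; split=> // p pp pb.
by apply: leq_trans bk; apply: dvdn_leq.
Qed.

(** The inverse powers of a prime above [k] lie in different classes modulo the
    subring. *)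
Lemma smooth_ring_sep k p l d : prime p -> (k < p)%N ->
  ~ smooth_ring k (p%:R ^- (l + d.+1) - p%:R ^- l).
Proof.
move=> pp kp [b [b0 bk] [z E]].
have p0 : p%:R != 0 :> F by rewrite pnatr_eq0 -lt0n prime_gt0.
have {}E : b%:Z * (1 - p%:Z ^+ d.+1) = z * p%:Z ^+ (l + d.+1).
  apply: (@intr_inj F); rewrite !intrM intrB !rmorphXn /= -E.
  rewrite -![p%:~R]/(p%:R) -![b%:~R]/(b%:R) exprD.
  by field; rewrite !expf_neq0.
have : (p%:Z %| b%:Z * (1 - p%:Z ^+ d.+1))%Z.
  by rewrite E addnS exprS mulrCA dvdz_mulr.
have cop : coprimez p%:Z (1 - p%:Z ^+ d.+1).
  by apply/coprimezP; exists (p%:Z ^+ d, 1) => /=; rewrite exprSr; ring.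
rewrite mulrC Gauss_dvdzr // dvdzE /= => pb.
by have := bk p pp pb; rewrite leqNgt kp.
Qed.

Definition smooth_SL k : set 'SL[F]_n := [set g | forall i j,
  smooth_ring k (SLval g i j) /\ smooth_ring k (SLval g^-1%g i j)].

Lemma smooth_mx k (A B : 'M[F]_n) : (forall i j, smooth_ring k (A i j)) ->
  (forall i j, smooth_ring k (B i j)) -> forall i j, smooth_ring k ((A *m B) i j).
Proof.
move=> kA kB i j; rewrite mxE; apply: (big_ind (smooth_ring k)).
- exact: (smooth_ring_int k 0).
- by move=> r s; apply: smooth_ringD.
- by move=> l _; apply: smooth_ringM.
Qed.

Lemma SL_not_FW_FM (R : realType) : ~ property_FW 'SL[F]_n /\ ~ property_FM R 'SL[F]_n.
Proof.
have H1 k : smooth_SL k 1%g.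
  move=> i j; rewrite invg1 SLval1 mxE.
  by case: (i == j); split; [exact: (smooth_ring_int k 1)|exact: (smooth_ring_int k 1)
    |exact: (smooth_ring_int k 0)|exact: (smooth_ring_int k 0)].
have HV k g : smooth_SL k g -> smooth_SL k g^-1%g.
  by move=> Hg i j; have [] := Hg i j; rewrite invgK.
have HM k g h : smooth_SL k g -> smooth_SL k h -> smooth_SL k (g * h)%g.
  move=> Hg Hh i j; rewrite invgM !SLvalM; split; apply: smooth_mx => i' j'.
  - by have [] := Hg i' j'.
  - by have [] := Hh i' j'.
  - by have [] := Hh i' j'.
  - by have [] := Hg i' j'.
have Hex g : exists K, forall k, (K <= k)%N -> smooth_SL k g.
  have /choice[f fP] (ij : 'I_n * 'I_n) := smooth_ring_exhaust (SLval g ij.1 ij.2).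
  have /choice[f' f'P] (ij : 'I_n * 'I_n) :=
    smooth_ring_exhaust (SLval g^-1%g ij.1 ij.2).
  exists (\sum_ij (f ij + f' ij))%N => k + i j; rewrite (bigD1 (i, j)) //= => le.
  by split; [apply: (fP (i, j))|apply: (f'P (i, j))]; lia.
have Hind k : exists u : nat -> 'SL[F]_n,
    forall l m, l <> m -> ~ smooth_SL k ((u l)^-1 * u m)%g.
  pose i := Ordinal (ltnW (ltnW n3)); have [j [ji _]] := third_index i i n3.
  have ij : i != j by rewrite eq_sym.
  have [p kp pp] := prime_above k.
  have entry r : SLval (elem i j r) i j = r.
    by rewrite val_elem // !mxE !eqxx (negbTE ij) /= mulr1 add0r.
  exists (fun l => elem i j (p%:R ^- l)).
  suff sep l m : (l < m)%N ->
      ~ smooth_SL k ((elem i j (p%:R ^- l))^-1 * elem i j (p%:R ^- m))%g.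
    move=> l m lm; have [|ml|//] := ltngtP l m; first exact: sep.
    by move=> /HV; rewrite invgM invgK; apply: sep.
  move=> lm; rewrite -elemV // -elemD // => /(_ i j)[+ _]; rewrite entry addrC.
  have -> : m = (l + (m - l.+1).+1)%N by rewrite -subSn // subSS subnKC // ltnW.
  exact: smooth_ring_sep.
split; first exact: (union_not_FW H1 HM HV Hex Hind).
exact: (union_not_FM H1 HM HV Hex Hind).
Qed.

End Smooth.

Lemma rat_fraction (r : rat) : exists2 b : nat, (0 < b)%N &
  exists z : int, b%:R * r = z%:~R.
Proof.
exists `|denq r|%N; first by rewrite absz_gt0 denq_neq0.
by exists (numq r); rewrite numqE -[in RHS]absz_denq -pmulrn mulrC.
Qed.

Theorem theorem1p17 (R : realType) (n : nat) (hn : (3 <= n)%N) :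
  [/\ property_FM' R 'SL[rat]_n,
      property_FW' 'SL[rat]_n,
      ~ property_FM R 'SL[rat]_n
    & ~ property_FW 'SL[rat]_n].
Proof.
have [nFW nFM] := SL_not_FW_FM rat_fraction hn R.
by split=> //; [exact: (SL_FM' rat_fraction hn)|exact: (SL_FW' rat_fraction hn)].
Qed.
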